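(* Let $S\subset\mathbb{C}$ be a finitely generated $\mathbb{Z}$-algebra with fraction field $K$ such that $S\cap\overline{\mathbb{Q}}=\mathcal{O}$ is a (localized) ring of integers of a number field. Let $\mathcal{X}_{r_1,r_2}$ be the closed rigid annulus over $K((q))$ in the coordinate $t$ with rational radii $r_1\le r_2$, and let $(V,\nabla)$ be a vector bundle with connection on $\mathcal{X}_{r_1,r_2}$. Suppose there is a cyclic vector with respect to which all data can be reduced modulo $\mathfrak{p}$ for almost all primes $\mathfrak{p}\subset\mathcal{O}$, and that the $p$-curvatures of the reductions vanish for almost all $p$. Then, after a finite pullback, $(V,\nabla)$ has a basis of flat sections on the annulus.
   Context: For almost all primes $\mathfrak{p}\subset\mathcal{O}$, $S/\mathfrak{p}$ is a domain; let $K_\mathfrak{p}$ be its fraction field. An element of $K$ can be reduced mod $\mathfrak{p}$ if its $\mathfrak{p}$-adic valuation is nonnegative (it then has an image in $K_\mathfrak{p}$). $|\cdot|$ is the $q$-adic absolute value on $K((q))$; ''rational radius'' means a radius $|q|^\alpha$ with $\alpha\in\mathbb{Q}$. $\mathcal{O}^{\mathrm{rig}}(\mathcal{X}_{r_1,r_2})$ consists of series $\sum_{k\in\mathbb{Z}}a_kt^k$, $a_k\in K((q))$, with $|a_k|r_i^k\to0$ as $|k|\to\infty$ for $i=1,2$; $\mathcal{X}_{r_1,r_2,\mathfrak{p}}$ is the analogous annulus over $K_\mathfrak{p}((q))$. Vector bundles on such annuli are trivial. Let $D=t\,\frac{d}{dt}$. A cyclic vector is a section $v$ such that $v,\nabla(D)v,\dots,\nabla(D)^{n-1}v$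 form a basis; ''all data can be reduced mod $\mathfrak{p}$'' means every coefficient (in $K$, of the $t$- and $q$-expansions) of the entries of the matrix of $\nabla(D)$ in this basis has nonnegative $\mathfrak{p}$-adic valuation, so that one obtains a connection on $\mathcal{X}_{r_1,r_2,\mathfrak{p}}$. Its $p$-curvature is $\nabla(D)^p-\nabla(D^p)$, and vanishing is required for almost all $\mathfrak{p}$. A finite pullback means pullback along a finite cover of the annulus (e.g. $t=s^m$), together with the finite extension of scalars (such as adjoining roots of $q$) this entails. *)

(* Defs.v *)
From HB Require Import structures.
From mathcomp Require Import all_boot all_order all_algebra all_field.
From mathcomp Require Import ring_quotient fraction.
From mathcomp Require Import all_classical reals.
From mathcomp Require Import complex.
From mathcomp Require Import lra.

Set Implicit Arguments.
Unset Strict Implicit.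
Unset Printing Implicit Defensive.

Import Order.TTheory GRing.Theory Num.Theory.
Local Open Scope classical_set_scope.
Local Open Scope ring_scope.

Section FiniteSums.
Variables (R : zmodType) (I J : choiceType).

Lemma exchange_fsumT (P : set I) (Q : set J) (F : I -> J -> R) :
  finite_set P -> finite_set Q ->
  (forall i j, F i j <> 0 -> P i /\ Q j) ->
  \sum_(i \in [set: I]) \sum_(j \in [set: J]) F i j =
  \sum_(j \in [set: J]) \sum_(i \in [set: I]) F i j.
Proof.
move=> Pfin Qfin FPQ.
have F0l i j : ~ P i -> F i j = 0.
  by move=> nP; apply: contrapT => /FPQ[].
have F0r i j : ~ Q j -> F i j = 0.
  by move=> nQ; apply: contrapT => /FPQ[].
transitivity (\sum_(i \in P) \sum_(j \in Q) F i j).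
  rewrite -(fsbig_widen P setT) //=; last first.
    by move=> i [_ nP]; rewrite /preimage /= fsbig1// => j _; apply: F0l.
  apply: eq_fsbigr => i _; rewrite -(fsbig_widen Q setT) //=.
  by move=> j [_ nQ]; rewrite /preimage /=; apply: F0r.
rewrite exchange_fsbig//.
rewrite -[RHS](fsbig_widen Q setT) //=; last first.
  by move=> j [_ nQ]; rewrite /preimage /= fsbig1// => i _; apply: F0r.
apply: eq_fsbigr => j _; rewrite -[RHS](fsbig_widen P setT) //=.
by move=> i [_ nP]; rewrite /preimage /=; apply: F0l.
Qed.

Lemma fsumD_T (P : set I) (F G : I -> R) :
  finite_set P -> (forall i, F i <> 0 -> P i) -> (forall i, G i <> 0 -> P i) ->
  \sum_(i \in [set: I]) (F i + G i) =
  \sum_(i \in [set: I]) F i + \sum_(i \in [set: I]) G i.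
Proof.
move=> Pfin FP GP.
have F0 i : ~ P i -> F i = 0 by move=> nP; apply: contrapT => /FP.
have G0 i : ~ P i -> G i = 0 by move=> nP; apply: contrapT => /GP.
rewrite -(fsbig_widen P setT) //=; last first.
  by move=> i [_ nP]; rewrite /preimage /= F0// G0// addr0.
rewrite fsbig_split//; congr (_ + _); apply: fsbig_widen => //.
  by move=> i [_ nP]; apply: F0.
by move=> i [_ nP]; apply: G0.
Qed.

End FiniteSums.

Lemma eq_fsumT (F : fieldType) (I : choiceType) (f g : I -> F) : f =1 g ->
  \sum_(i \in [set: I]) f i = \sum_(i \in [set: I]) g i.
Proof. by move=> /funext->. Qed.

Lemma reindex_fsumT (F : fieldType) (I : choiceType) (h h' : I -> I)
    (f : I -> F) : cancel h h' -> cancel h' h ->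
  \sum_(i \in [set: I]) f i = \sum_(i \in [set: I]) f (h i).
Proof. by move=> hK h'K; apply: reindex_fsbigT; exists h'. Qed.

Lemma mulr_fsumT (F : fieldType) (I : choiceType) (a : F) (f : I -> F) :
  a * (\sum_(i \in [set: I]) f i) = \sum_(i \in [set: I]) a * f i.
Proof. exact: mulr_fsumr. Qed.

Lemma mulr_fsumlT (F : fieldType) (I : choiceType) (a : F) (f : I -> F) :
  (\sum_(i \in [set: I]) f i) * a = \sum_(i \in [set: I]) f i * a.
Proof. exact: mulr_fsuml. Qed.

Section Convolution.
Variable F : fieldType.
Implicit Types (u v t : int * int -> F) (x y z : int * int).

Definition conv u v z : F := \sum_(x \in [set: int * int]) u x * v (z - x).

Definition weight (al : rat) x : rat := x.2%:~R + al * x.1%:~R.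

Lemma weightD al x y : weight al (x + y) = weight al x + weight al y.
Proof. by rewrite /weight /= !rmorphD /=; lra. Qed.

Lemma weightN al x : weight al (- x) = - weight al x.
Proof. by rewrite /weight /= !rmorphN /=; lra. Qed.

Definition summable al u :=
  forall N : rat, finite_set [set x | weight al x < N /\ u x <> 0].

Variable al : rat.
Local Notation w := (weight al).

Lemma summable_bound u :
  summable al u -> exists m, forall x, u x <> 0 -> m <= w x.
Proof.
move=> /(_ 0)/finite_seqP[s Es].
have [m [m0 ms]] : exists m : rat, m <= 0 /\ (forall x, x \in s -> m <= w x).
  elim: s {Es} => [|a s [m [m0 ms]]]; first by exists 0.
  exists (Num.min m (w a)); split; first by rewrite ge_min m0.
  move=> x; rewrite inE => /orP[/eqP->|/ms xm]; rewrite ge_min ?lexx ?orbT//.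
  by rewrite xm.
exists m => x ux; have [x0|] := ltP (w x) 0; last exact: le_trans.
by apply: ms; have : [set` s] x by rewrite -Es.
Qed.

Lemma conv_terms u v z : summable al u -> summable al v ->
  finite_set [set x | u x * v (z - x) <> 0].
Proof.
move=> su sv; have [m vm] := summable_bound sv.
apply: sub_finite_set (su (w z - m + 1)) => x /= /eqP.
rewrite mulf_eq0 negb_or => /andP[/eqP ux /eqP /vm].
by rewrite weightD weightN => ?; split => //; lra.
Qed.

Lemma conv_supp u v z : conv u v z <> 0 ->
  exists x y, [/\ z = x + y, u x <> 0 & v y <> 0].
Proof.
move=> uvz; apply: contrapT => nxy; apply: uvz; apply: fsbig1 => x _.
apply/eqP; apply: contrapT => /negP; rewrite mulf_eq0 negb_or.
move=> /andP[/eqP ux /eqP vx]; apply: nxy.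
by exists x, (z - x); split => //; rewrite addrC subrK.
Qed.

Lemma summable_conv u v :
  summable al u -> summable al v -> summable al (conv u v).
Proof.
move=> su sv N; have [mu um] := summable_bound su.
have [mv vm] := summable_bound sv.
apply: sub_finite_set
  (finite_image2 (fun x y => x + y) (su (N - mv)) (sv (N - mu))).
move=> z /= [zN /conv_supp[x [y [Ez ux vy]]]].
have := um _ ux; have := vm _ vy; move: zN; rewrite Ez weightD => ? ? ?.
by exists x; [split => //; lra|exists y; [split => //; lra|]].
Qed.

Lemma convC u v : conv u v = conv v u.
Proof.
apply/funext => z; rewrite /conv (@reindex_fsumT F (int * int)%type _ _ _ (subKr z) (subKr z)).
by refine (@eq_fsumT F (int * int)%type _ _ _) => x; rewrite subKr mulrC.
Qed.

Lemma convDl u u' v : summable al u -> summable al u' -> summable al v ->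
  conv (fun x => u x + u' x) v = (fun z => conv u v z + conv u' v z).
Proof.
move=> su su' sv; apply/funext => z; rewrite /conv.
under eq_fsbigr do rewrite mulrDl.
apply: (@fsumD_T _ _ ([set x | u x * v (z - x) <> 0] `|`
                      [set x | u' x * v (z - x) <> 0])).
- by rewrite finite_setU; split; apply: conv_terms.
- by move=> x; left.
- by move=> x; right.
Qed.

Lemma convA u v t : summable al u -> summable al v -> summable al t ->
  conv u (conv v t) = conv (conv u v) t.
Proof.
move=> su sv st; apply/funext => z.
have [mu um] := summable_bound su; have [mv vm] := summable_bound sv.
have [mt tm] := summable_bound st.
pose U := [set x | w x < w z - mv - mt + 1 /\ u x <> 0].
pose V := [set x | w x < w z - mu - mt + 1 /\ v x <> 0].
pose W := [set x + y | x in U & y in V].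
have Wfin : finite_set W by apply: finite_image2; [apply: su|apply: sv].
transitivity (\sum_(x \in [set: int * int]) \sum_(s \in [set: int * int])
    (u x * v (s - x) * t (z - s))).
  refine (@eq_fsumT F (int * int)%type _ _ _) => x; rewrite /conv mulr_fsumT.
  rewrite [RHS](@reindex_fsumT F (int * int)%type _ _ _ (@addrK _ x) (@subrK _ x)).
  by refine (@eq_fsumT F (int * int)%type _ _ _) => y; rewrite addrK mulrA opprD addrA addrAC.
have Ufin : finite_set U by apply: su.
rewrite (exchange_fsumT Ufin Wfin); last first.
  move=> x s /eqP; rewrite !mulf_eq0 !negb_or.
  case/andP=> /andP[/eqP ux /eqP vx] /eqP tx.
  have := um _ ux; have := vm _ vx; have := tm _ tx.
  rewrite !weightD !weightN => ? ? ?.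
  have Ux : U x by split => //; lra.
  split => //; exists x => //; exists (s - x); last by rewrite addrC subrK.
  by split => //; rewrite weightD weightN; lra.
by refine (@eq_fsumT F (int * int)%type _ _ _) => s; rewrite /conv mulr_fsumlT.
Qed.

End Convolution.

(* The ring of functions on the closed annulus |q|^a1 <= |t| <= |q|^a2 over   *)
(* F((q)). A function is stored as its coefficients: f k j is the coefficient *)
(* of q^j in a_k, where f = \sum_k a_k t^k. Absolute values are written       *)
(* additively: |a| <= |q|^x means that the q-adic valuation of a is >= x.     *)

Section AnnulusPredicate.
Variable F : fieldType.

Definition qval_ge (a : int -> F) (x : rat) :=
  forall j : int, j%:~R < x -> a j = 0.

Definition is_laurent (a : int -> F) := exists x, qval_ge a x.

(* |a_k| r^k --> 0 as |k| --> oo, for r = |q|^al *)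
Definition null_at (al : rat) (f : int -> int -> F) :=
  forall N : rat, exists B : nat, forall k : int,
    (B < `|k|)%N -> qval_ge (f k) (N - al * k%:~R).

Definition on_annulus (a1 a2 : rat) (f : int -> int -> F) :=
  [/\ forall k, is_laurent (f k), null_at a1 f & null_at a2 f].

Lemma int_finite (B : nat) : finite_set [set k : int | (`|k| <= B)%N].
Proof.
apply: (@sub_finite_set _ _
  ([set Posz m | m in `I_B.+1] `|` [set - Posz m | m in `I_B.+1])).
  move=> k /= kB; have [k0|k0] := leP 0 k; [left|right]; exists `|k|%N => //.
    by rewrite gez0_abs.
  by rewrite ltz0_abs// opprK.
by rewrite finite_setU; split; apply: finite_image; apply: finite_II.
Qed.

Lemma null_atP al f :
  ((forall k, is_laurent (f k)) /\ null_at al f) <->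
  summable al (fun x => f x.1 x.2).
Proof.
split=> [[fL f0] N|fs].
  have [B fB] := f0 N.
  have {fL} /choice[c fc] := fL.
  pose M k := absz (Num.ceil (`|c k| + `|N - al * k%:~R|)).
  apply: (@sub_finite_set _ _
    (\bigcup_(k in [set k : int | (`|k| <= B)%N])
       [set (k, j) | j in [set j : int | (`|j| <= M k)%N]])).
    move=> [k j] /= [kN fkj].
    have kB : (`|k| <= B)%N.
      rewrite leqNgt; apply/negP => /fB /(_ j) fk0; apply: fkj; apply: fk0.
      by move: kN; rewrite /weight /=; lra.
    exists k => //; exists j => //=.
    have jc : c k <= j%:~R.
      by rewrite leNgt; apply/negP => /fc.
    have jN : j%:~R < N - al * k%:~R by move: kN; rewrite /weight /=; lra.
    have : `|j%:~R : rat| <= `|c k| + `|N - al * k%:~R|.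
      rewrite ler_norml.
      have := ler_norm (- c k); have := ler_norm (N - al * k%:~R).
      have := normr_ge0 (c k); have := normr_ge0 (N - al * k%:~R).
      by rewrite normrN => ? ? ? ?; apply/andP; split; lra.
    rewrite /M; set X := `|c k| + _ => jX.
    have Xc : X <= (Num.ceil X)%:~R by apply: real_ceil_ge; apply: num_real.
    have c0 : 0 <= Num.ceil X.
      by rewrite -(ler_int rat) (le_trans _ Xc)// addr_ge0.
    by rewrite -lez_nat !abszE (ger0_norm c0) -(ler_int rat) intr_norm
      (le_trans jX).
  by apply: bigcup_finite => [|k _]; [|apply: finite_image]; apply: int_finite.
split=> [k|N].
  have [m fm] := summable_bound fs.
  exists (m - al * k%:~R) => j jm; apply: contrapT => fkj.
  by have := fm (k, j) fkj; rewrite /weight /= leNgt => /negP; apply; lra.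
have /finite_seqP[s Es] := fs N.
have [B sB] : exists B : nat, forall x, x \in s -> (`|x.1| <= B)%N.
  elim: s {Es} => [|a s [B sB]]; first by exists 0%N.
  exists (maxn B `|a.1|) => x; rewrite inE leq_max.
  by case/orP=> [/eqP->|/sB ->//]; rewrite leqnn orbT.
exists B => k kB j jN; apply: contrapT => fkj.
have : [set` s] (k, j) by rewrite -Es /weight /=; split => //; lra.
by move=> /= /sB /=; rewrite leqNgt kB.
Qed.

Lemma on_annulusP a1 a2 f : on_annulus a1 a2 f <->
  summable a1 (fun x => f x.1 x.2) /\ summable a2 (fun x => f x.1 x.2).
Proof.
by rewrite -!null_atP /on_annulus; split=> [[]|[[] ? ? []]].
Qed.

Lemma on_annulus_sub (F' : fieldType) a1 a2 (f : int -> int -> F')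
    (g : int -> int -> F) :
  (forall k j, f k j = 0 -> g k j = 0) ->
  summable a1 (fun x => f x.1 x.2) /\ summable a2 (fun x => f x.1 x.2) ->
  on_annulus a1 a2 g.
Proof.
move=> fg [f1 f2]; apply/on_annulusP; split => N.
  by apply: sub_finite_set (f1 N) => x /= [? gx]; split => // /fg.
by apply: sub_finite_set (f2 N) => x /= [? gx]; split => // /fg.
Qed.

End AnnulusPredicate.

Section AnnulusRing.
Variables (F : fieldType) (a1 a2 : rat).

Definition annulus_pred : {pred int -> int -> F} :=
  fun f => `[< on_annulus a1 a2 f >].

Record annulus := Annulus {
  coefs :> int -> int -> F;
  coefsP : coefs \in annulus_pred
}.

HB.instance Definition _ := [isSub for coefs].
HB.instance Definition _ := [Choice of annulus by <:].

Lemma annulusP (f : annulus) : on_annulus a1 a2 f.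
Proof. by case: f => f /= /asboolP. Qed.

Lemma annulus_inj (f g : annulus) : (forall k j, f k j = g k j) -> f = g.
Proof. by move=> fg; apply: val_inj; apply/funext => k; apply/funext. Qed.

Definition mk_annulus f (fP : on_annulus a1 a2 f) : annulus :=
  @Annulus f (asboolT fP).

Lemma annulus_sum1 (f : annulus) : summable a1 (fun x => f x.1 x.2).
Proof. by have /on_annulusP[] := annulusP f. Qed.

Lemma annulus_sum2 (f : annulus) : summable a2 (fun x => f x.1 x.2).
Proof. by have /on_annulusP[] := annulusP f. Qed.

Lemma annulus_zmod_closed : zmod_closed annulus_pred.
Proof.
split.
  apply/asboolP/on_annulusP.
  by split => N; apply: sub_finite_set (@finite_set0 _) => x /= [_].
move=> f g /asboolP/on_annulusP[f1 f2] /asboolP/on_annulusP[g1 g2].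
apply/asboolP/on_annulusP; split => N.
  have : finite_set ([set x | weight a1 x < N /\ f x.1 x.2 <> 0] `|`
                     [set x | weight a1 x < N /\ g x.1 x.2 <> 0]).
    by rewrite finite_setU.
  apply: sub_finite_set => x /= [xN fg].
  have [fx|fx] := eqVneq (f x.1 x.2) 0; [right|left]; split => //.
    by move=> gx; apply: fg; rewrite !fctE fx gx subr0.
  exact/eqP.
have : finite_set ([set x | weight a2 x < N /\ f x.1 x.2 <> 0] `|`
                   [set x | weight a2 x < N /\ g x.1 x.2 <> 0]).
  by rewrite finite_setU.
apply: sub_finite_set => x /= [xN fg].
have [fx|fx] := eqVneq (f x.1 x.2) 0; [right|left]; split => //.
  by move=> gx; apply: fg; rewrite !fctE fx gx subr0.
exact/eqP.
Qed.

HB.instance Definition _ :=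
  GRing.isZmodClosed.Build _ annulus_pred annulus_zmod_closed.
HB.instance Definition _ := [SubChoice_isSubZmodule of annulus by <:].

Lemma annulusD (f g : annulus) k j : (f + g) k j = f k j + g k j.
Proof. by []. Qed.

(* c q^j t^k *)
Definition monomial_coefs (c : F) (k j : int) : int -> int -> F :=
  fun k' j' => if (k' == k) && (j' == j) then c else 0.

Lemma monomial_subproof c k j : on_annulus a1 a2 (monomial_coefs c k j).
Proof.
apply/on_annulusP; split => N;
  apply: sub_finite_set (@finite_set1 _ (k, j)) => -[k' j'] /= [_];
  by rewrite /monomial_coefs; case: ifP => // /andP[/eqP-> /eqP->].
Qed.

Definition monomial c k j : annulus := mk_annulus (monomial_subproof c k j).

(* Cauchy product; all the sums have finitely many nonzero terms *)
Definition mul_coefs (f g : int -> int -> F) (k j : int) : F :=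
  \sum_(x \in [set: int * int]) f x.1 x.2 * g (k - x.1) (j - x.2).

Lemma mul_coefsE f g :
  (fun x => mul_coefs f g x.1 x.2) =
  conv (fun x => f x.1 x.2) (fun x => g x.1 x.2).
Proof. by []. Qed.

Lemma mul_subproof (f g : annulus) : on_annulus a1 a2 (mul_coefs f g).
Proof.
apply/on_annulusP; rewrite mul_coefsE; split; apply: summable_conv;
  by [apply: annulus_sum1|apply: annulus_sum2].
Qed.

Definition annulus_mul (f g : annulus) : annulus :=
  mk_annulus (mul_subproof f g).
Definition annulus_one : annulus := monomial 1 0 0.

Lemma annulus_mulE f g k j : annulus_mul f g k j =
  conv (fun x => f x.1 x.2) (fun x => g x.1 x.2) (k, j).
Proof. by []. Qed.

Lemma annulus_mulC : commutative annulus_mul.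
Proof.
by move=> f g; apply: annulus_inj => k j; rewrite !annulus_mulE convC.
Qed.

Lemma annulus_mulA : associative annulus_mul.
Proof.
move=> f g h; apply: annulus_inj => k j; rewrite !annulus_mulE.
by have /(congr1 (fun u => u (k, j))) :=
  convA (annulus_sum1 f) (annulus_sum1 g) (annulus_sum1 h).
Qed.

Lemma annulus_mul1l : left_id annulus_one annulus_mul.
Proof.
move=> f; apply: annulus_inj => k j; rewrite annulus_mulE /conv.
rewrite -(fsbig_widen [set ((0, 0) : int * int)] setT) //=; last first.
  move=> [k' j'] [_ /= n0]; rewrite /preimage /= /monomial_coefs.
  case: ifP => [/andP[/eqP Ek /eqP Ej]|_]; last by rewrite mul0r.
  by case: n0; rewrite Ek Ej.
by rewrite fsbig_set1 /= /monomial_coefs !eqxx /= mul1r !subr0.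
Qed.

Lemma annulus_mulDl : left_distributive annulus_mul +%R.
Proof.
move=> f g h; apply: annulus_inj => k j; rewrite annulusD !annulus_mulE.
by have /(congr1 (fun u => u (k, j))) :=
  convDl (annulus_sum1 f) (annulus_sum1 g) (annulus_sum1 h).
Qed.

Lemma annulus_one_neq0 : annulus_one != 0.
Proof.
apply/eqP => /(congr1 (fun f : annulus => f 0 0)) /=.
by rewrite /monomial_coefs !eqxx /=; apply/eqP; rewrite oner_neq0.
Qed.

HB.instance Definition _ := GRing.Zmodule_isComNzRing.Build annulus
  annulus_mulA annulus_mulC annulus_mul1l annulus_mulDl annulus_one_neq0.

End AnnulusRing.

Section ClassicalUnits.
Variable R : comNzRingType.

Definition cunit : {pred R} := fun x => `[< exists y, y * x = 1 >].
Definition cinv (x : R) : R := if x \in cunit then xget x [set y | y * x = 1] else x.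

Lemma cmulVr : {in cunit, left_inverse 1 cinv *%R}.
Proof.
move=> x xU; rewrite /cinv xU; have /asboolP[y yx] := xU.
by case: xgetP => [z _ //|/(_ y)].
Qed.

Lemma cunitP (x y : R) : y * x = 1 -> x \in cunit.
Proof. by move=> yx; apply/asboolP; exists y. Qed.

Lemma cinv_out : {in [predC cunit], cinv =1 id}.
Proof. by move=> x; rewrite inE /= /cinv => /negPf->. Qed.

End ClassicalUnits.

HB.instance Definition _ (F : fieldType) (a1 a2 : rat) :=
  GRing.ComNzRing_hasMulInverse.Build (annulus F a1 a2)
    (@cmulVr (annulus F a1 a2)) (@cunitP (annulus F a1 a2))
    (@cinv_out (annulus F a1 a2)).

Section AnnulusMaps.
Variables (F : fieldType) (a1 a2 : rat).
Local Notation A := (annulus F a1 a2).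

Definition coord_t : A := monomial a1 a2 1 1 0.

Lemma coord_t_unit : coord_t \is a GRing.unit.
Proof.
apply/asboolP; exists (monomial a1 a2 1 (-1) 0).
apply: annulus_inj => k j; rewrite [LHS]annulus_mulE /conv.
rewrite -(fsbig_widen [set ((-1, 0) : int * int)] setT) //=; last first.
  move=> [k' j'] [_ /= n0]; rewrite /preimage /= /monomial_coefs.
  case: ifP => [/andP[/eqP Ek /eqP Ej]|_]; last by rewrite mul0r.
  by case: n0; rewrite Ek Ej.
rewrite fsbig_set1 /= /monomial_coefs !eqxx /= mul1r opprK subr0.
by rewrite -[in X in X && _](add0r 1) (inj_eq (addIr 1)).
Qed.

Lemma tddt_subproof (f : A) :
  on_annulus a1 a2 (fun k j => k%:~R * f k j : F).
Proof.
apply: (@on_annulus_sub _ _ a1 a2 f); last exact/on_annulusP/annulusP.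
by move=> k j ->; rewrite mulr0.
Qed.

(* the derivation D = t d/dt, which is linear over F((q)) *)
Definition tddt (f : A) : A := mk_annulus (tddt_subproof f).

Variables (F' : fieldType) (h : F -> F') (h0 : h 0 = 0).

Lemma annulus_map_subproof (f : A) : on_annulus a1 a2 (fun k j => h (f k j)).
Proof.
apply: (@on_annulus_sub _ _ a1 a2 f); last exact/on_annulusP/annulusP.
by move=> k j ->.
Qed.

Definition annulus_map (f : A) : annulus F' a1 a2 :=
  mk_annulus (annulus_map_subproof f).

End AnnulusMaps.

(* Connections on the trivial bundle of rank n over a ring A with a           *)
(* derivation D. On the annulus the relative differentials are free with      *)
(* basis dt/t, so a connection is the same thing as the operator nabla(D).    *)

Definition is_derivation (A : nzRingType) (D : A -> A) :=
  {morph D : x y / x + y} /\ forall x y, D (x * y) = D x * y + x * D y.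

Definition is_connection (A : comNzRingType) (D : A -> A) (n : nat)
    (nabla : 'cV[A]_n -> 'cV[A]_n) :=
  {morph nabla : v w / v + w} /\
  forall f v, nabla (f *: v) = D f *: v + f *: nabla v.

(* column j consists of the coordinates of nabla (col j P) in the basis given *)
(* by the columns of P                                                        *)
Definition connection_matrix (A : comUnitRingType) (n : nat)
    (nabla : 'cV[A]_n -> 'cV[A]_n) (P : 'M[A]_n) : 'M[A]_n :=
  invmx P *m \matrix_(i, j) nabla (col j P) i 0.

Definition connection_of (A : comNzRingType) (D : A -> A) (n : nat)
    (N : 'M[A]_n) (v : 'cV[A]_n) : 'cV[A]_n :=
  map_mx D v + N *m v.

Definition cyclic_family (A : comUnitRingType) (n : nat)
    (nabla : 'cV[A]_n -> 'cV[A]_n) (v : 'cV[A]_n) : 'M[A]_n :=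
  \matrix_(i, j < n) iter j nabla v i 0.

Definition cyclic_vector (A : comUnitRingType) (n : nat)
    (nabla : 'cV[A]_n -> 'cV[A]_n) (v : 'cV[A]_n) :=
  cyclic_family nabla v \in unitmx.

Definition has_flat_basis (A : comUnitRingType) (n : nat)
    (nabla : 'cV[A]_n -> 'cV[A]_n) :=
  exists2 G : 'M[A]_n, G \in unitmx & forall j, nabla (col j G) = 0.

Section PCurvature.
Variables (F : fieldType) (a1 a2 : rat) (n : nat).
Local Notation A := (annulus F a1 a2).
Variable nabla : 'cV[A]_n -> 'cV[A]_n.

(* A (continuous F((q))-linear) derivation E equals (E t / t) D, so that      *)
(* nabla(E) = (E t / t) nabla(D).                                             *)
Definition connection_along (E : A -> A) (v : 'cV[A]_n) : 'cV[A]_n :=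
  (E (coord_t F a1 a2) / coord_t F a1 a2) *: nabla v.

(* D^p is the p-fold iterate of D, a derivation in characteristic p *)
Definition p_curvature (p : nat) (v : 'cV[A]_n) : 'cV[A]_n :=
  iter p nabla v - connection_along (iter p (@tddt F a1 a2)) v.

Definition p_curvature_vanishes :=
  exists2 p, p \in [pchar F] & forall v, p_curvature p v = 0.

End PCurvature.

(* A finite cover of the affinoid annulus, possibly                           *)
(* after a finite extension of the field F((q)), is the spectrum of a finite  *)
(* etale algebra over its ring of functions; as vector bundles on the annulus *)
(* are trivial, such an algebra is free of finite rank. Kummer covers t = s^m *)
(* combined with q = u^e and a finite extension of F are of this form.        *)

Section Covers.
Variables (A : comNzRingType) (B : comNzRingType) (phi : {rmorphism A -> B}).

(* free of positive rank m.+1 *)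
Definition finite_free :=
  exists (m : nat) (b : 'I_m.+1 -> B), forall x : B,
    exists! c : 'rV[A]_m.+1, x = \sum_i phi (c 0 i) * b i.

(* every A-linear derivation of B into a B-module is zero, i.e. the module of *)
(* relative differentials of B over A vanishes                                *)
Definition unramified :=
  forall (M : lmodType B) (d : B -> M),
    {morph d : x y / x + y} ->
    (forall x y, d (x * y) = x *: d y + y *: d x) ->
    (forall a, d (phi a) = 0) ->
    forall x, d x = 0.

Definition finite_etale_cover := finite_free /\ unramified.

End Covers.

Definition pullback_connection (A B : comUnitRingType) (phi : {rmorphism A -> B})
    (DB : B -> B) (n : nat) (nabla : 'cV[A]_n -> 'cV[A]_n) :
    'cV[B]_n -> 'cV[B]_n :=
  connection_of DB (map_mx phi (connection_matrix nabla 1%:M)).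

Definition flat_after_finite_pullback (A : comUnitRingType) (D : A -> A)
    (n : nat) (nabla : 'cV[A]_n -> 'cV[A]_n) :=
  exists (B : comUnitRingType) (phi : {rmorphism A -> B}) (DB : B -> B),
    [/\ finite_etale_cover phi,
        is_derivation DB,
        forall a, DB (phi a) = phi (D a) &
        has_flat_basis (pullback_connection phi DB nabla)].

Definition finitely_generated_ring (S : nzRingType) :=
  exists gs : seq S, forall U : {pred S},
    subring_closed U -> {subset gs <= U} -> forall x, x \in U.

(* O is the localization of the ring of integers of the number field E at a   *)
(* multiplicative set T                                                       *)
Definition localized_ring_of_integers (O : nzRingType) :=
  exists (E : fieldExtType rat) (e : {rmorphism O -> E}) (T : {pred E}),
    [/\ injective e,
        mulr_closed T,
        0 \notin T,
        forall y, y \in T -> integralOver (intr : int -> E) y &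
        forall z : E, (exists x, z = e x) <->
          exists x y, [/\ integralOver (intr : int -> E) x, y \in T & z = x / y]].

(* the set of nonzero primes of O at which Q fails is finite *)
Definition almost_all_primes (O : comNzRingType) (Q : prime_idealr O -> Prop) :=
  finite_set [set X : set O | exists p : prime_idealr O,
    [/\ X = [set x | x \in (p : {pred O})],
        (exists2 x : O, x \in (p : {pred O}) & x != 0) & ~ Q p]].

(* P is the ideal of S generated by the image of p *)
Definition is_extension (O S : comNzRingType) (i : O -> S)
    (p : {pred O}) (P : {pred S}) :=
  forall x : S, x \in P <->
    exists (m : nat) (a : 'I_m -> O) (s : 'I_m -> S),
      (forall k, a k \in p) /\ x = \sum_k i (a k) * s k.

Definition residue_ring (S : comNzRingType) (P : prime_idealr S) :=
  {ideal_quot P}.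

HB.instance Definition _ (S : comNzRingType) (P : prime_idealr S) :=
  GRing.ComNzRing.on (residue_ring P).
HB.instance Definition _ (S : comNzRingType) (P : prime_idealr S) :=
  GRing.ComNzRing_hasMulInverse.Build (residue_ring P)
    (@cmulVr (residue_ring P)) (@cunitP (residue_ring P))
    (@cinv_out (residue_ring P)).
HB.instance Definition _ (S : comNzRingType) (P : prime_idealr S) :=
  GRing.ComUnitRing_isIntegral.Build (residue_ring P)
    (@Quotient.rquot_IdomainAxiom S P).

Section Reduction.
Variables (S : idomainType) (P : prime_idealr S).
Local Notation "x %:F" := (@FracField.tofrac _ x).

Definition residue_class (x : S) : residue_ring P := \pi_({ideal_quot P})%qT x.

Definition residue_field := {fraction residue_ring P}.

(* a generator of the maximal ideal of the localization of S at P *)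
Definition uniformizer (pi : S) :=
  [/\ pi \in (P : {pred S}), pi != 0 &
      forall x, x \in (P : {pred S}) ->
        exists2 s, s \notin (P : {pred S}) & exists c, s * x = c * pi].

Definition padic_val (x : {fraction S}) (m : int) :=
  exists pi a b, [/\ uniformizer pi, a \notin (P : {pred S}),
    b \notin (P : {pred S}) & x = pi%:F ^ m * (a%:F / b%:F)].

(* the valuation of 0 is +oo *)
Definition padic_val_ge0 (x : {fraction S}) :=
  x = 0 \/ exists2 m : int, 0 <= m & padic_val x m.

(* the image of a / b when b is not in P; 0 on the elements that are not of   *)
(* this form, which have negative valuation                                   *)
Definition reduction (x : {fraction S}) : residue_field :=
  let ab := xget (0, 1)
    [set ab : S * S | ab.2 \notin (P : {pred S}) /\ x = ab.1%:F / ab.2%:F] in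
  (residue_class ab.1)%:F / (residue_class ab.2)%:F.

Lemma residue_class0 : residue_class 0 = 0.
Proof. exact: (rmorph0 (\pi_({ideal_quot P})%qT)). Qed.

Lemma reduction0 : reduction 0 = 0.
Proof.
rewrite /reduction; case: xgetP => [[a b] _ /= [bP]|_]; last first.
  by rewrite residue_class0 tofrac0 mul0r.
have b0 : b != 0 by apply: contraNneq bP => ->; rewrite rpred0.
move=> /esym/eqP; rewrite mulf_eq0 invr_eq0 !tofrac_eq0 (negPf b0) orbF.
by move=> /eqP->; rewrite residue_class0 tofrac0 mul0r.
Qed.

Variables (a1 a2 : rat) (n : nat).
Local Notation A := (annulus {fraction S} a1 a2).

Definition can_be_reduced (N : 'M[A]_n) :=
  forall i j k l, padic_val_ge0 (N i j k l).

Definition reduced_connection (N : 'M[A]_n) :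
    'cV[annulus residue_field a1 a2]_n -> 'cV[annulus residue_field a1 a2]_n :=
  connection_of (@tddt residue_field a1 a2)
    (map_mx (annulus_map reduction0) N).

End Reduction.

Arguments reduced_connection [S] P [a1 a2 n] N.

(* Main.v *)
(* In the cyclic basis nabla = D + N with N a companion matrix; give t^k q^j the weights j + a1 k
   and j + a2 k. If the p-curvature vanishes modulo P then nabla^p = nabla there, and comparing
   terms of lowest weight shows that N mod P is supported at the exponent 0 and at exponents of
   positive weight. As this holds for infinitely many P, N = C + N_+ with C constant and N_+ of
   positive weight, and C^p = C modulo P.
   So C is diagonalizable with rational eigenvalues. For if an eigenvalue is irrational, then S
   can be specialized to a number field so that it remains irrational, and its minimal polynomial
   g over Q splits into linear factors modulo every large p. This is impossible without any appeal
   to the Chebotarev theorem: the product of the values of the homogenized g at the pairs of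
   integers of a large box is divisible by a power of p for every p, and these powers multiply to
   more than the size of the product.
   If C v0 = lam v0, a contraction produces v = v0 + (positive weight) solving nabla v = lam v up to
   a resonant remainder, and the p-curvature kills the remainder. This gives a basis v_i with
   nabla v_i = (l_i / m) v_i, and s^(-l_i) v_i is flat on the Kummer cover t = s^m. *)
Require Import Defs.
From HB Require Import structures.
From mathcomp Require Import all_boot all_order all_algebra all_field.
From mathcomp Require Import ring_quotient fraction.
From mathcomp Require Import all_classical reals.
From mathcomp Require Import complex.
From mathcomp Require Import zify lra ring.

Set Implicit Arguments.
Unset Strict Implicit.
Unset Printing Implicit Defensive.

Import Order.TTheory GRing.Theory Num.Theory.
Local Open Scope ring_scope.

(** * Polynomials splitting modulo almost all primes *)

Section Factorials.
Local Open Scope nat_scope.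

(** Only the primes of [S] generated by primes of [O] are controlled, so no prime of a specialized
    ring can be chosen at will. The substitute: an element lying in all good primes above p is
    nilpotent modulo p, and the number field has a lattice whose quotient by a large p is reduced,
    so the specialized element is divisible by p there. This carries C^p = C to the number field,
    and it also yields, for any nonzero element, good primes above arbitrarily large p that avoid
    it. A solution over K has infinitely many coefficients, in general without common denominator.
    It is cut off at the weight where its residual starts, and the finitely many coefficients left
    are reduced. In the count of prime factors, the H^2 points of a box of side H and the deg g = r
    roots modulo p force, by pigeonhole and Legendre's formula, a factor of about H^(4r/3) per pair
    of points, against H^r from the size of g. The margin 4/3 > 1 absorbs crude estimates, so
    nothing is needed on the distribution of primes. *)

Lemma dvdn_logn (m n : nat) : 0 < m -> 0 < n ->
  (forall p, prime p -> logn p m <= logn p n) -> m %| n.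
Proof.
move=> m0 n0 le; apply/dvdn_partP => // p; rewrite mem_primes => /andP[pp _].
by rewrite p_part pfactor_dvdn// le.
Qed.

(** One step of Legendre's formula: the multiples of p up to n are p times the numbers up to n /
    p. *)
Lemma logn_fact_rec p n : prime p ->
  logn p n`! = n %/ p + logn p (n %/ p)`!.
Proof.
move=> pp; have p1 := prime_gt1 pp.
case: n => [|n]; first by rewrite div0n fact0 logn1.
rewrite !logn_fact// big_ltn// expn1; congr (_ + _).
have le : n.+1 %/ p <= n by rewrite -ltnS ltn_Pdiv.
rewrite big_add1 /= (big_cat_nat (n := (n.+1 %/ p).+1)) //=.
rewrite [X in _ + X]big_nat_cond [X in _ + X]big1 ?addn0.
  by apply: eq_bigr => k _; rewrite expnS divnMA.
move=> k /andP[/andP[ltk _] _]; rewrite expnS divnMA divn_small//.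
by rewrite (leq_trans ltk)// ltnW// ltn_expl.
Qed.

Lemma logn_fact_ub p n : prime p -> p.-1 * logn p n`! <= n.
Proof.
move=> pp; have p1 := prime_gt1 pp.
elim/ltn_ind: n => n IH; have [->|n0] := posnP n; first by rewrite fact0 logn1 muln0.
rewrite logn_fact_rec// mulnDr (leq_trans (n := p.-1 * (n %/ p) + n %/ p))//.
  by rewrite leq_add2l IH// ltn_Pdiv.
rewrite -mulSnr prednK ?prime_gt0// mulnC; exact: leq_divM.
Qed.

(** What remains of n! when Legendre's formula is cut after its first term; these are the exponents
    that [collisions_lb] produces. *)
Definition primepart (n : nat) := \prod_(0 <= p < n.+1 | prime p) p ^ (n %/ p).

Lemma primepart_gt0 n : 0 < primepart n.
Proof. by apply: prodn_cond_gt0 => p pp; rewrite expn_gt0 prime_gt0. Qed.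

Lemma logn_prod p (I : Type) (r : seq I) (P : pred I) (F : I -> nat) :
  (forall i, P i -> 0 < F i) ->
  logn p (\prod_(i <- r | P i) F i) = \sum_(i <- r | P i) logn p (F i).
Proof.
move=> F0; elim: r => [|i r IH]; first by rewrite !big_nil logn1.
rewrite !big_cons; case: ifP => // Pi.
by rewrite lognM ?F0 ?IH// prodn_cond_gt0.
Qed.

Lemma logn_primepart p n : prime p -> logn p (primepart n) = n %/ p.
Proof.
move=> pp; rewrite logn_prod => [|q pq]; last by rewrite expn_gt0 prime_gt0.
have [np|pn] := ltnP n p.
  rewrite divn_small// big_nat_cond big1// => q /andP[/andP[_ qn] pq].
  by rewrite lognX logn_prime// (gtn_eqF (leq_trans qn np)) muln0.
rewrite big_mkcond (bigD1_seq p) ?iota_uniq ?mem_index_iota//=.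
rewrite pp lognX logn_prime// eqxx muln1 big1 ?addn0// => q qp.
by case: ifP => // pq; rewrite lognX logn_prime// eq_sym (negPf qp) muln0.
Qed.

(* Higher prime powers contribute at most half as much to n! as the first powers, except at 2. *)
Lemma fact_primepart n : n`! ^ 2 <= primepart n ^ 3 * 2 ^ n.
Proof.
have L0 := primepart_gt0 n.
apply: dvdn_leq; first by rewrite muln_gt0 !expn_gt0 L0.
apply: dvdn_logn; rewrite ?muln_gt0 ?expn_gt0 ?fact_gt0 ?L0// => p pp.
rewrite lognM ?expn_gt0 ?L0// !lognX logn_primepart// logn_fact_rec//.
have := logn_fact_ub (n %/ p) pp.
have [->|p3] := eqVneq p 2; first by rewrite (@logn_prime 2 2)// eqxx muln1 /=;
  move: (logn 2 _) => c; lia.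
have: 1 < p.-1 by have := prime_gt1 pp; lia.
move=> p1 ab; have {ab} := leq_trans (leq_mul p1 (leqnn _)) ab.
move: (logn p 2) => c; lia.
Qed.

(** A substitute for Stirling's formula: m^j / j! is at most the binomial coefficient of m + j over
    j. *)
Lemma expn_fact m j : m ^ j <= j`! * 2 ^ (m + j).
Proof.
have: m ^ j <= 'C(m + j, j) * j`!.
  rewrite bin_ffact; elim: j => // j IH.
  rewrite addnS ffactSS expnS leq_mul// leqW//; exact: leq_addr.
move=> /leq_trans; apply; rewrite mulnC leq_mul2l orbC; apply/orP; left.
have -> : 2 ^ (m + j) = (1 + 1) ^ (m + j) by [].
rewrite expnDn (bigD1 (inord j)) //= inordK ?ltnS ?leq_addl//.
by rewrite !exp1n !muln1 leq_addr.
Qed.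


(** Closed form of the least number of collisions of m objects in p boxes, written with an addition
    to avoid truncated subtraction. *)
Lemma sum_divn m p : 0 < p ->
  2 * (\sum_(j < m) j %/ p) + p * ((m %/ p) * (m %/ p).+1) = 2 * (m %/ p) * m.
Proof.
move=> p0; elim: m => [|m IH]; first by rewrite big_ord0 div0n; lia.
rewrite big_ord_recr /=; have [dv|ndv] := boolP (p %| m.+1); last first.
  have E : m.+1 %/ p = m %/ p by rewrite divnS// (negPf ndv).
  by move: IH; rewrite E; move: (m %/ p) (\sum_(_ < _) _) => k c; nia.
have E : m.+1 %/ p = (m %/ p).+1 by rewrite divnS// dv add1n.
have E2 : m.+1 = p * (m %/ p).+1 by rewrite -E mulnC divnK.
by move: IH E2; rewrite E; move: (m %/ p) (\sum_(_ < _) _) => k c; nia.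
Qed.

End Factorials.

(** * Collisions of a map between finite sets *)

Section Pigeonhole.
Local Open Scope nat_scope.

Lemma card_collisions (T R : finType) (f : T -> R) :
  #|[set xy : T * T | f xy.1 == f xy.2]| = \sum_c #|[set x | f x == c]| ^ 2.
Proof.
rewrite cardsE -sum1_card (partition_big (fun xy => f xy.1) predT)//=.
apply: eq_bigr => c _; rewrite -mulnn -cardsX -[RHS]sum1_card.
apply: eq_bigl => xy; rewrite !inE /= unfold_in.
change ((f xy.1 == f xy.2) && (f xy.1 == c) = ((f xy.1 == c) && (f xy.2 == c))).
by apply/andP/andP => -[/eqP-> /eqP->].
Qed.

(** A fibre with n_c elements satisfies (n_c - k)(n_c - k - 1) >= 0 for every integer k. With k the
    integral part of the mean size, the sum over all fibres gives the number of collisions of an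
    equidistributed map. *)
Lemma collisions_lb (T R : finType) (f : T -> R) : 0 < #|R| ->
  2 * (\sum_(j < #|T|) j %/ #|R|) <=
  #|[set xy : T * T | (xy.1 != xy.2) && (f xy.1 == f xy.2)]|.
Proof.
move=> R0; set k := #|T| %/ #|R|; set cnt := #|_|.
have E : cnt + #|T| = \sum_c #|[set x | f x == c]| ^ 2.
  rewrite -card_collisions /cnt.
  have -> : [set xy : T * T | (xy.1 != xy.2) && (f xy.1 == f xy.2)] =
    [set xy : T * T | f xy.1 == f xy.2] :\: ((fun x => (x, x)) @: [set: T])%SET.
    apply/setP => -[x y]; rewrite !inE /= andbC [RHS]andbC; congr andb.
    by congr negb; apply/eqP/imsetP => [->|[z _ [-> ->]]] //; exists y.
  rewrite cardsD (finset.setIidPr _); last first.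
    by apply/fintype.subsetP => _ /imsetP[x _ ->]; rewrite inE.
  rewrite card_imset; last by move=> x y [].
  rewrite cardsT subnK// -cardsT -(@card_imset _ _ (fun x : T => (x, x))); last by move=> x y [].
  by apply: subset_leq_card; apply/fintype.subsetP => _ /imsetP[x _ ->]; rewrite inE.
have F : #|T| = \sum_c #|[set x | f x == c]|.
  rewrite -sum1_card (partition_big f predT)//=; apply: eq_bigr => c _.
  by rewrite sum1_card; apply: eq_card => x; rewrite !inE.
have := sum_divn #|T| R0; rewrite -/k.
suff: 2 * k * #|T| + #|T| <= cnt + #|T| + #|R| * (k * k.+1) by lia.
have -> : 2 * k * #|T| + #|T| = (2 * k).+1 * #|T| by rewrite mulSn addnC.
rewrite E [X in _ * X <= _]F big_distrr /= -sum_nat_const -big_split /=.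
apply: leq_sum => c _; rewrite -mulnn; move: k #|_| => k n.
by have [] := leqP n k; nia.
Qed.

End Pigeonhole.

(** * Valuations against size for a product over pairs *)

Section VandermondeBound.
Local Open Scope nat_scope.

Lemma sum_ord_id m : 2 * (\sum_(j < m) j) = m * m.-1.
Proof.
by elim: m => [|m IH]; rewrite ?big_ord0// big_ord_recr /= mulnDr IH; case: m {IH} => //= m; lia.
Qed.

(** Nothing is assumed about the primes up to B0. Each of them divides B0!, whose power r m^2 covers
    the exponent needed, at most r m (m - 1). *)
Lemma primepart_prod_le r B0 m V : 0 < V ->
  (forall p, prime p -> B0 < p -> 2 * r * (\sum_(j < m) j %/ p) <= logn p V) ->
  (\prod_(j < m) primepart j) ^ (2 * r) <= V * (B0`! ^ r) ^ (m * m).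
Proof.
move=> V0 VP; have L0 : 0 < \prod_(j < m) primepart j.
  by apply: prodn_gt0 => j; apply: primepart_gt0.
have B1 : 0 < (B0`! ^ r) ^ (m * m) by rewrite !expn_gt0 fact_gt0.
apply: dvdn_leq; first by rewrite muln_gt0 V0 B1.
apply: dvdn_logn; rewrite ?muln_gt0 ?V0 ?B1 ?expn_gt0 ?L0// => p pp.
rewrite lognM// lognX logn_prod => [|j _]; last exact: primepart_gt0.
rewrite (eq_bigr (fun j : 'I_m => j %/ p)) => [|j _]; last exact: logn_primepart.
have [pB|pB] := ltnP B0 p; first by rewrite (leq_trans (VP _ pp pB))// leq_addr.
rewrite !lognX (leq_trans _ (leq_addl _ _))//.
have p1 : 0 < logn p B0`! by rewrite logn_gt0 mem_primes pp fact_gt0 dvdn_fact// prime_gt0.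
have le : \sum_(j < m) j %/ p <= \sum_(j < m) j by apply: leq_sum => j _; apply: leq_div.
have := sum_ord_id m; move: (\sum_(j < m) j) le p1 => s le p1 E.
apply: (@leq_trans (r * (m * m))); last by rewrite [leqRHS]mulnCA leq_mul2l leq_pmulr ?orbT.
rewrite mulnAC mulnC leq_mul2l; apply/orP; right.
by rewrite (leq_trans (leq_mul (leqnn 2) le))// E leq_mul2l leq_pred orbT.
Qed.

(** Factor by factor, m^(2j) <= (j! 2^(m+j))^2, and (j!)^2 is bounded by [fact_primepart]. The
    powers of 2 add up to 3j + 2m <= 5m. *)
Lemma expn_primepart_prod m :
  m ^ (m * m.-1) <= (\prod_(j < m) primepart j) ^ 3 * 2 ^ (5 * (m * m)).
Proof.
have -> : m ^ (m * m.-1) = \prod_(j < m) m ^ (2 * j).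
  by rewrite -sum_ord_id big_distrr /= expn_sum.
have -> : 2 ^ (5 * (m * m)) = \prod_(j < m) 2 ^ (5 * m).
  by rewrite prod_nat_const card_ord -expnM; congr expn; lia.
rewrite (big_morph (expn^~ 3) (fun x y => expnMn x y 3) (exp1n 3)).
rewrite -big_split /=; apply: leq_prod => j _.
rewrite mulnC expnM.
apply: (@leq_trans ((j`! * 2 ^ (m + j)) ^ 2)); first by rewrite leq_exp2r// expn_fact.
rewrite expnMn; apply: (@leq_trans (primepart j ^ 3 * 2 ^ j * (2 ^ (m + j)) ^ 2)).
  by rewrite leq_mul2r fact_primepart orbT.
rewrite -mulnA -expnM -expnD leq_mul2l; apply/orP; right.
by rewrite leq_exp2l//; have := ltn_ord j; lia.
Qed.

(** With m = H^2, V is at least about H^(4r m^2 / 3) and at most about H^(r m^2). The constants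
    gather in K and the comparison ends in H <= K^2. The summand 8 in the bound on H gives 8m <=
    m^2, which absorbs the difference between m (m - 1) and m^2. *)
Lemma vandermonde_size_absurd r B0 H Bc V : 0 < r -> 0 < V ->
  (forall p, prime p -> B0 < p -> 2 * r * (\sum_(j < H * H) j %/ p) <= logn p V) ->
  V <= (Bc * H ^ r) ^ ((H * H) * (H * H)) ->
  (Bc ^ 3 * (B0`! ^ r) ^ 3 * 2 ^ (10 * r)) ^ 2 + 8 <= H -> False.
Proof.
move=> r0 V0 VP Vub.
have [K EK] : exists K, Bc ^ 3 * (B0`! ^ r) ^ 3 * 2 ^ (10 * r) = K by eexists.
rewrite EK => HK.
have := primepart_prod_le V0 VP; have := expn_primepart_prod (H * H).
have [m Em] : exists m, H * H = m by eexists.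
rewrite Em in VP Vub *; move: (\prod_(j < m) _) => L mL LV.
have H8 : 8 <= H := leq_trans (leq_addl _ _) HK.
have H0 : 0 < H by rewrite (leq_trans _ H8).
have H1 : 1 < H by rewrite (leq_trans _ H8).
have m8 : 8 <= m by rewrite (leq_trans H8)// -Em leq_pmulr.
have mE : (m.-1).+1 = m by rewrite prednK// (leq_trans _ m8).
have E1 : (m ^ (m * m.-1)) ^ (2 * r) <= (K * H ^ (3 * r)) ^ (m * m).
  apply: (@leq_trans ((L ^ 3 * 2 ^ (5 * (m * m))) ^ (2 * r))).
    by rewrite leq_exp2r// muln_gt0.
  rewrite expnMn -expnM [3 * _]mulnC expnM.
  apply: (@leq_trans (((Bc * H ^ r) ^ (m * m) * (B0`! ^ r) ^ (m * m)) ^ 3 *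
     (2 ^ (5 * (m * m))) ^ (2 * r))).
    by rewrite leq_mul2r leq_exp2r// (leq_trans LV) ?orbT// leq_mul2r Vub orbT.
  apply: eq_leq; rewrite -expnMn -!expnM [_ * 3]mulnC expnM.
  have -> : 5 * (m * m) * (2 * r) = (10 * r) * (m * m) by lia.
  rewrite [X in _ * X]expnM -expnMn; congr (_ ^ _); rewrite -EK !expnMn.
  by rewrite -!expnM [r * 3]mulnC; ring.
have E2 : H ^ (2 * (m * m.-1) * (2 * r)) <= (K * H ^ (3 * r)) ^ (m * m).
  by rewrite (leq_trans _ E1)// -expnM -Em mulnn -expnM; apply: eq_leq; congr expn; rewrite !mulnA.
have E3 : H ^ (4 * r * (m * m)) <= H ^ (4 * r * m) * (K * H ^ (3 * r)) ^ (m * m).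
  apply: leq_trans (leq_mul (leqnn _) E2); rewrite -expnD.
  by rewrite leq_exp2l// -mE /=; apply: eq_leq; ring.
have E4 : H ^ (r * (m * m)) <= H ^ (4 * r * m) * K ^ (m * m).
  rewrite -(@leq_pmul2r (H ^ (3 * r * (m * m)))) ?expn_gt0 ?H0// -expnD.
  have E5 : K ^ (m * m) * H ^ (3 * r * (m * m)) = (K * H ^ (3 * r)) ^ (m * m).
    by rewrite expnMn -expnM.
  rewrite -[leqRHS]mulnA E5.
  have -> : r * (m * m) + 3 * r * (m * m) = 4 * r * (m * m) by lia.
  exact: E3.
have E5 : H ^ (r * (m * m)) <= (K ^ 2) ^ (m * m).
  rewrite -(@leq_pmul2r (H ^ (r * (m * m)))) ?expn_gt0 ?H0//.
  apply: (@leq_trans ((H ^ (4 * r * m) * K ^ (m * m)) ^ 2)).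
    by rewrite mulnn leq_exp2r.
  rewrite expnMn mulnC -!expnM [m * m * 2]mulnC leq_mul2l; apply/orP; right.
  rewrite leq_exp2l// (_ : 4 * r * m * 2 = r * (8 * m)); last by lia.
  by rewrite leq_mul2l leq_mul2r m8 !orbT.
have : H ^ r <= K ^ 2 by move: E5; rewrite expnM leq_exp2r// muln_gt0 (leq_trans _ m8).
have : H ^ 1 <= H ^ r by rewrite leq_exp2l.
rewrite expn1 => HHr HrK; have := leq_trans (leq_trans HK HHr) HrK.
by rewrite leqNgt addnS ltnS leq_addr.
Qed.
End VandermondeBound.

(** * Binary forms with roots modulo p *)

Section Homogenization.
Variable R : comNzRingType.

(** The binary form b^(deg g) g(a / b). *)
Definition homog (g : {poly R}) (a b : R) :=
  \sum_(i < size g) g`_i * a ^+ i * b ^+ ((size g).-1 - i).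

Lemma homogZ g c a b :
  homog g (c * a) (c * b) = c ^+ (size g).-1 * homog g a b.
Proof.
rewrite /homog mulr_sumr; apply: eq_bigr => i _; rewrite !exprMn.
have /subnK E : (i <= (size g).-1)%N by have := ltn_ord i; lia.
by rewrite -[X in _ = c ^+ X * _]E exprD; ring.
Qed.

End Homogenization.

(** Where [f b] is nonzero this is g(a / b) times a power of b; where it vanishes, both sides reduce
    to the term in a^(deg g). *)
Lemma homog_split (F : fieldType) (R : comNzRingType) (f : {rmorphism R -> F})
    (g : {poly R}) (cs : seq F) (a b : R) : size cs = (size g).-1 ->
  map_poly f g = f (lead_coef g) *: \prod_(c <- cs) ('X - c%:P) ->
  f (homog g a b) = f (lead_coef g) * \prod_(c <- cs) (f a - c * f b).
Proof.
move=> szcs Eg.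
have fE : f (homog g a b) =
    \sum_(i < size g) (map_poly f g)`_i * f a ^+ i * f b ^+ ((size g).-1 - i).
  rewrite rmorph_sum; apply: eq_bigr => i _.
  by rewrite coef_map !rmorphM !rmorphXn.
case Es : (size g) szcs fE => [|n] /= szcs ->.
  rewrite big_ord0; move/eqP: Es; rewrite size_poly_eq0 => /eqP->.
  by rewrite lead_coef0 rmorph0 mul0r.
have [b0|b0] := eqVneq (f b) 0.
  rewrite big_ord_recr big1 ?add0r /= => [|i _]; last first.
    by rewrite b0 expr0n subn_eq0 leqNgt ltn_ord mulr0.
  under [in RHS]eq_bigr do rewrite b0 mulr0 subr0.
  rewrite coef_map subnn mulr1 lead_coefE Es add0r.
  by rewrite big_const_seq count_predT iter_mulr_1 szcs.
transitivity (f b ^+ n * (map_poly f g).[f a / f b]).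
  rewrite (@horner_coef_wide _ n.+1) ?(leq_trans (size_poly _ _)) ?Es// mulr_sumr.
  apply: eq_bigr => i _; have ile : (i <= n)%N by rewrite -ltnS.
  by rewrite expr_div_n exprB ?unitfE//; ring.
rewrite Eg hornerZ horner_prod mulrCA; congr (_ * _).
rewrite -szcs -(iter_mulr_1 _ (f b)) -count_predT -big_const_seq -big_split /=.
by apply: eq_bigr => c _; rewrite hornerXsubC mulrBr mulrCA divff// mulr1 [f b * c]mulrC.
Qed.

Lemma intr_Fp_eq0 p (z : int) : prime p -> ((z%:~R : 'F_p) == 0) = (p %| `|z|)%N.
Proof. by move=> pp; rewrite -(dvdz_pcharf (pchar_Fp pp)). Qed.

(** One root c with a = c b modulo p gives one factor p. Two distinct ones force p to divide a and
    b, and homogeneity then gives p^(deg g), as many factors as there are roots at all. *)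
Lemma logn_homog p (g : {poly int}) (cs : seq 'F_p) (a b : int) : prime p ->
  uniq cs -> size cs = (size g).-1 ->
  map_poly intr g = (lead_coef g)%:~R *: \prod_(c <- cs) ('X - c%:P) ->
  homog g a b != 0 ->
  (count (fun c : 'F_p => a%:~R == c * b%:~R)%R cs <= logn p `|homog g a b|)%N.
Proof.
move=> pp ucs szcs Eg n0; have n0' : (0 < `|homog g a b|)%N by rewrite absz_gt0.
case E : (count _ _) => [//|[|k]].
  rewrite -(pfactor_dvdn 1) // expn1 -intr_Fp_eq0// (homog_split _ _ szcs Eg).
  have : has (fun c : 'F_p => a%:~R == c * b%:~R)%R cs by rewrite has_count E.
  case/hasP => c ccs /eqP ac; rewrite (big_rem c)//= ac subrr mul0r mulr0.
  by [].
have [c [c' [cc' /eqP ac /eqP ac']]] : exists c c', [/\ c != c',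
    (a%:~R : 'F_p) == c * b%:~R & (a%:~R : 'F_p) == c' * b%:~R].
  move: E; set P := (fun c : 'F_p => _) => E.
  have := filter_uniq P ucs; have := filter_all P cs.
  have : (1 < size (seq.filter P cs))%N by rewrite size_filter E.
  case: (seq.filter P cs) => [//|c [//|c' s]] _ /= /and3P[ac ac' _].
  by rewrite inE negb_or => /andP[/andP[cc' _] _]; exists c, c'.
have b0 : (b%:~R : 'F_p) == 0.
  have : (c - c') * (b%:~R : 'F_p) == 0 by rewrite mulrBl -ac -ac' subrr.
  by rewrite mulf_eq0 subr_eq0 (negPf cc').
have a0 : (a%:~R : 'F_p) == 0 by rewrite ac (eqP b0) mulr0.
move: a0 b0; rewrite !intr_Fp_eq0// -!(dvdzE p).
move=> /dvdzP[a' Ea] /dvdzP[b' Eb].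
rewrite -E (leq_trans (count_size _ _))// szcs -pfactor_dvdn// Ea Eb.
by rewrite [a' * _]mulrC [b' * _]mulrC homogZ abszM abszX dvdn_mulr.
Qed.

Lemma homog_ub (g : {poly int}) (a b : int) (H : nat) : (0 < size g)%N ->
  (`|a| <= H)%N -> (`|b| <= H)%N ->
  (`|homog g a b| <= (\sum_(i < size g) `|(g`_i)%R|) * H ^ (size g).-1)%N.
Proof.
move=> sg aH bH; rewrite /homog big_distrl /=.
elim/big_ind2: _ => // [x m y n xm yn|i _].
  by lia.
rewrite !abszM !abszX -mulnA leq_mul2l; apply/orP; right.
have /subnKC <- : (i <= (size g).-1)%N by rewrite -ltnS prednK.
have mono x e : (x <= H -> x ^ e <= H ^ e)%N by case: e => [|e] xH //; rewrite leq_exp2r.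
by rewrite addKn expnD leq_mul// mono.
Qed.

Lemma distn_ord n (i j : 'I_n) : (`|i%:Z - j%:Z| <= n)%N.
Proof. by have := ltn_ord i; have := ltn_ord j; lia. Qed.

(** For each root c modulo p, the map (x1, x2) -> x1 - c x2 sends the H^2 points of the box into p
    classes, and a collision puts a factor p into the value of the form at the difference of the two
    points. Homogenizing is what makes the box two-dimensional: the differences have size H while
    the points number H^2. *)
Theorem splits_mod_primes_absurd (g : {poly int}) (B0 : nat) : (1 < size g)%N ->
  (forall a b, homog g a b = 0 -> a = 0 /\ b = 0) ->
  (forall p, prime p -> (B0 < p)%N -> exists cs : seq 'F_p, 
     [/\ uniq cs, size cs = (size g).-1 &
       map_poly intr g = (lead_coef g)%:~R *: \prod_(c <- cs) ('X - c%:P)]) ->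
  False.
Proof.
move=> sg g0 gP; set r := (size g).-1.
pose Bc := (\sum_(i < size g) `|(g`_i)%R|)%N.
set H := ((Bc ^ 3 * (B0`! ^ r) ^ 3 * 2 ^ (10 * r)) ^ 2 + 8)%N.
have [H' EH] : exists H', H = H' by eexists.
pose T := ('I_H' * 'I_H')%type.
pose F (xy : T * T) : int := homog g (xy.1.1%:Z - xy.2.1%:Z) (xy.1.2%:Z - xy.2.2%:Z).
have F0 xy : xy.1 != xy.2 -> F xy != 0.
  apply: contraNneq => /g0[/eqP]; rewrite subr_eq0 => /eqP[E1] /eqP; rewrite subr_eq0.
  by move=> /eqP[E2]; case: xy E1 E2 => [[x1 x2] [y1 y2]] /= /val_inj-> /val_inj->.
pose V := (\prod_(xy : T * T | xy.1 != xy.2) `|F xy|)%N.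
have V0 : (0 < V)%N by apply: prodn_cond_gt0 => xy /F0; rewrite absz_gt0.
have cT : #|{: T}| = (H' * H')%N by rewrite card_prod !card_ord.
apply: (@vandermonde_size_absurd r B0 H' Bc V) => //; last by rewrite -EH.
- by rewrite /r -subn1 subn_gt0.
- move=> p pp /(gP _ pp)[cs [ucs szcs Eg]].
  rewrite logn_prod => [|xy]; last by move/F0; rewrite absz_gt0.
  pose f c (x : T) : 'F_p := x.1%:R - c * x.2%:R.
  have step1 : (\sum_(xy : T * T | xy.1 != xy.2) \sum_(c <- cs) (f c xy.1 == f c xy.2) <=
      \sum_(xy : T * T | xy.1 != xy.2) logn p `|F xy|)%N.
    apply: leq_sum => xy /F0 Fxy; apply: leq_trans (logn_homog pp ucs szcs Eg Fxy).
    rewrite -sum1_count [leqRHS]big_mkcond /=; apply: leq_sum => c _.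
    suff -> : ((xy.1.1%:Z - xy.2.1%:Z)%:~R == c * (xy.1.2%:Z - xy.2.2%:Z)%:~R :> 'F_p)
        = (f c xy.1 == f c xy.2) by case: eqP.
    rewrite !rmorphB /= -!pmulrn /f -[LHS]subr_eq0 -[RHS]subr_eq0.
    by congr (_ == 0); ring.
  apply: leq_trans step1; rewrite exchange_big /= -mulnA mulnCA mulnC /r -szcs.
  have -> : forall k, (k * size cs = \sum_(c <- cs) k)%N.
    by move=> k; rewrite big_const_seq count_predT iter_addn_0 mulnC.
  apply: leq_sum => c _; rewrite -cT; under eq_bigr do rewrite -[X in (_ %/ X)%N](card_Fp pp).
  apply: leq_trans (collisions_lb (f c) _) _; first by rewrite (card_Fp pp) prime_gt0.
  rewrite cardsE -sum1_card big_mkcond [leqRHS]big_mkcond /=; apply: leq_sum => xy _.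
  by rewrite unfold_in /=; case: (_ != _) => //=; case: (_ == _).
rewrite /V; have BH : (0 < Bc * H' ^ r)%N.
  rewrite muln_gt0 expn_gt0 -EH /H addn_gt0 orbT /= andbT lt0n /Bc sum_nat_eq0 negb_forall.
  have lt : ((size g).-1 < size g)%N by rewrite prednK// (leq_trans _ sg).
  apply/existsP; exists (Ordinal lt); rewrite /= absz_eq0 -lead_coefE lead_coef_eq0.
  by rewrite -size_poly_gt0 (leq_trans _ sg).
rewrite -cT -card_prod -prod_nat_const big_mkcond /=.
apply: leq_prod => xy _; case: ifP => // _; apply: homog_ub; first by rewrite (leq_trans _ sg).
  exact: distn_ord.
exact: distn_ord.
Qed.

(** * Localization and specialization *)

Section Localization.
Variables (S : comNzRingType) (K k : fieldType).
Variables (j : {rmorphism S -> K}) (r : {rmorphism S -> k}).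
Hypothesis j_inj : injective j.

(** The local ring of S at the kernel of r, inside K. It is used for Z with F_p, for S with a
    residue field, and for S with a specialization to [algC]. *)
Definition loc_pred : {pred K} :=
  fun x => `[< exists a b, r b != 0 /\ x = j a / j b >].

Lemma loc_den_neq0 b : r b != 0 -> j b != 0.
Proof.
by apply: contra_neq => jb; have /j_inj-> : j b = j 0; rewrite ?jb ?rmorph0.
Qed.

Lemma loc_subring_closed : subring_closed loc_pred.
Proof.
split.
- by apply/asboolP; exists 1, 1; rewrite !rmorph1 oner_neq0 divr1.
- move=> x y /asboolP[a [b [b0 ->]]] /asboolP[c [d [d0 ->]]].
  apply/asboolP; exists (a * d - c * b), (b * d); rewrite rmorphM mulf_neq0//.
  split=> //; rewrite rmorphB !rmorphM; field.
  by rewrite !loc_den_neq0.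
- move=> x y /asboolP[a [b [b0 ->]]] /asboolP[c [d [d0 ->]]].
  apply/asboolP; exists (a * c), (b * d); rewrite rmorphM mulf_neq0//.
  by rewrite !rmorphM invfM; split=> //; ring.
Qed.

(** The injectivity proof is a parameter of the type because the ring structure, to be attached to
    the type, depends on it. *)
Record locring (h : injective j) := Locring { locval : K; locvalP : locval \in loc_pred }.
Arguments Locring : clear implicits.
Local Notation L := (locring j_inj).

HB.instance Definition _ := [isSub of L for @locval j_inj].
HB.instance Definition _ := [Choice of L by <:].
HB.instance Definition _ := GRing.isSubringClosed.Build K loc_pred loc_subring_closed.
HB.instance Definition _ := [SubChoice_isSubComNzRing of L by <:].

Lemma locval_inj : injective (@locval j_inj). Proof. exact: val_inj. Qed.

Definition locred (x : L) : k :=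
  let ab := xget (0, 1) [set ab : S * S | r ab.2 != 0 /\ locval x = j ab.1 / j ab.2]%classic in
  r ab.1 / r ab.2.

Lemma locredE x a b : r b != 0 -> locval x = j a / j b -> locred x = r a / r b.
Proof.
move=> b0 xE; rewrite /locred; case: xgetP => [[c d] _ /= [d0 xE']|/(_ (a, b))]; last first.
  by case.
have : j (a * d) = j (c * b).
  apply/eqP; rewrite !rmorphM -eqr_div ?loc_den_neq0// -xE xE'//.
by move=> /j_inj /(congr1 r); rewrite !rmorphM => E; apply/eqP; rewrite eqr_div// E.
Qed.

Lemma locE (x : L) : exists a b, r b != 0 /\ locval x = j a / j b.
Proof. by case: x => x /= /asboolP. Qed.

Lemma locred_zmod : zmod_morphism locred.
Proof.
move=> x y; have [a [b [b0 Ex]]] := locE x; have [c [d [d0 Ey]]] := locE y.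
rewrite (locredE b0 Ex) (locredE d0 Ey) (@locredE _ (a * d - c * b) (b * d)).
- by rewrite rmorphB !rmorphM; field; apply/andP.
- by rewrite rmorphM mulf_neq0.
rewrite [LHS]/= Ex Ey rmorphB !rmorphM; field.
by rewrite !loc_den_neq0.
Qed.

Lemma locred_monoid : monoid_morphism locred.
Proof.
split.
  by rewrite (@locredE _ 1 1) ?rmorph1 ?oner_neq0 ?divr1.
move=> x y; have [a [b [b0 Ex]]] := locE x; have [c [d [d0 Ey]]] := locE y.
rewrite (locredE b0 Ex) (locredE d0 Ey) (@locredE _ (a * c) (b * d)).
- by rewrite !rmorphM invfM; ring.
- by rewrite rmorphM mulf_neq0.
by rewrite [LHS]/= Ex Ey !rmorphM invfM; ring.
Qed.

HB.instance Definition _ := GRing.isZmodMorphism.Build L k locred locred_zmod.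
HB.instance Definition _ := GRing.isMonoidMorphism.Build L k locred locred_monoid.

HB.instance Definition _ := GRing.RMorphism.copy (@locval j_inj : L -> K) (\val : L -> K).

Lemma locP x : (exists a b, r b != 0 /\ x = j a / j b) -> exists y : L, locval y = x.
Proof. by move=> /asboolP xP; exists (Locring _ _ xP). Qed.

Lemma map_mx_loc m n (M : 'M[K]_(m, n)) : (forall i l, M i l \in loc_pred) ->
  exists M', M = map_mx (@locval j_inj) M'.
Proof.
move=> MP; exists (\matrix_(i, l) Locring j_inj _ (MP i l)).
by apply/matrixP => i l; rewrite !mxE.
Qed.

Lemma map_poly_loc (g : {poly K}) : (forall i, g`_i \in loc_pred) ->
  exists g', g = map_poly (@locval j_inj) g'.
Proof.
move=> gP; exists (\poly_(i < size g) Locring j_inj _ (gP i)).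
apply/polyP => i; rewrite coef_map_id0// coef_poly; case: ltnP => //= le.
by rewrite nth_default.
Qed.

Lemma locred_eq0 (x : L) : locred x = 0 <->
  exists a b, [/\ r b != 0, r a = 0 & locval x = j a / j b].
Proof.
split=> [x0|[a [b [b0 a0 Ex]]]]; last by rewrite (locredE b0 Ex) a0 mul0r.
have [a [b [b0 Ex]]] := locE x; exists a, b; split => //; apply/eqP.
by move/eqP: x0; rewrite (locredE b0 Ex) mulf_eq0 invr_eq0 (negPf b0) orbF.
Qed.

End Localization.

Arguments locval {S K k j r h} l.
Arguments locred {S K k j r j_inj} x.

Lemma nat_argmin (T : Type) (P : T -> Prop) (f : T -> nat) : (exists x, P x) ->
  exists2 x, P x & forall y, P y -> (f x <= f y)%N.
Proof.
move=> [x0 Px0].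
have ex : exists n, `[< exists2 x, P x & f x = n >] by exists (f x0); apply/asboolP; exists x0.
case: (ex_minnP ex) => n /asboolP[x Px <-] min; exists x => // y Py.
by apply: min; apply/asboolP; exists y.
Qed.

(** * Extending a specialization by one element *)

Section SpecializationStep.
Variables (R : comNzRingType) (K : fieldType) (e : {rmorphism R -> K}) (g : K).
Local Notation mp := (map_poly e).

(** R stands for a subring of K but e need not be injective: it will be an iterated polynomial ring
    with an evaluation map. Everything below is therefore modulo the kernel of e. *)
Definition evalp : {poly R} -> K := horner_eval g \o mp.
HB.instance Definition _ := GRing.RMorphism.copy evalp (horner_eval g \o mp).

Lemma evalpE h : evalp h = (mp h).[g]. Proof. by []. Qed.

(** Pseudo-division needs leading coefficients that e does not kill; dropping the top coefficients
    killed by e provides them. *)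
Lemma poly_truncate (h : {poly R}) :
  exists h' : {poly R}, mp h' = mp h /\ size h' = size (mp h).
Proof.
exists (\poly_(i < size (mp h)) h`_i).
have E : mp (\poly_(i < size (mp h)) h`_i) = mp h.
  apply/polyP => i; rewrite !coef_map coef_poly; case: ltnP => // le.

  by rewrite /= rmorph0 -(coef_map e) nth_default.
split=> //; apply/eqP; rewrite eqn_leq size_poly /= -{1}E.
by rewrite (leq_trans (size_poly _ _)).
Qed.

Lemma lead_coef_trunc (h : {poly R}) : size h = size (mp h) -> mp h != 0 ->
  e (lead_coef h) != 0.
Proof.
by move=> szh; rewrite -lead_coef_eq0 lead_coefE coef_map -szh -lead_coefE.
Qed.

(** m acts as the minimal polynomial of g, but only pseudo-division is available. Let r be of least
    degree among the combinations of s and m that do not vanish at g. The pseudo-remainder of m by r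
    vanishes at g, hence is zero by minimality of m. So a multiple of m is q r, where q vanishes at
    g, and comparing degrees makes r constant. *)
Lemma algebraic_bezout (m s : {poly R}) : evalp m = 0 -> mp m != 0 ->
  (forall h, evalp h = 0 -> mp h != 0 -> (size (mp m) <= size (mp h))%N) ->
  size m = size (mp m) -> evalp s != 0 ->
  exists a b c, e c != 0 /\ mp (a * s + b * m) = (e c)%:P.
Proof.
move=> m0 mn0 mmin szm s0.
have mnz : m != 0 by apply: contraNneq mn0 => ->; rewrite rmorph0.
have small h : evalp h = 0 -> (size h < size m)%N -> mp h = 0.
  move=> h0 lt; apply/eqP/negP => /negP/(mmin _ h0); rewrite -szm leqNgt.
  by rewrite (leq_ltn_trans (size_poly _ _)).
pose I r := (exists a b, mp r = mp (a * s + b * m)) /\ evalp r != 0.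
have [r [[a [b Er]] r0] rmin] : exists2 r, I r &
    forall r', I r' -> (size (mp r) <= size (mp r'))%N.
  by apply: nat_argmin; exists s; split=> //; exists 1, 0; rewrite mul1r mul0r addr0.
(* The pseudo-remainder of s by m is already an admissible combination of degree below that of m. *)
have lt_rm : (size (mp r) < size m)%N.
  have Em := Pdiv.ComRing.rdivp_eq m s.
  apply: leq_ltn_trans (Pdiv.CommonRing.ltn_rmodpN0 s mnz).
  apply: leq_trans (rmin (Pdiv.CommonRing.rmodp s m) _) (size_poly _ _); split.
    exists ((lead_coef m ^+ Pdiv.CommonRing.rscalp s m)%:P), (- Pdiv.CommonRing.rdivp s m).
    by rewrite mul_polyC Em mulNr addrAC subrr add0r.
  move/(congr1 evalp): Em; rewrite -mul_polyC rmorphD !rmorphM /= m0 mulr0 add0r => <-.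
  rewrite mulf_neq0// evalpE map_polyC hornerC /= rmorphXn expf_neq0//.
  exact: lead_coef_trunc.
have [r1 [Er1 szr1]] := poly_truncate r.
have r1n0 : mp r1 != 0 by rewrite Er1; apply: contraNneq r0; rewrite evalpE => ->; rewrite horner0.
have r1nz : r1 != 0 by apply: contraNneq r1n0 => ->; rewrite rmorph0.
have Em := Pdiv.ComRing.rdivp_eq r1 m.
set c1 := lead_coef r1 ^+ _ in Em.
have c10 : e c1 != 0 by rewrite rmorphXn expf_neq0// lead_coef_trunc// Er1.
set q := Pdiv.CommonRing.rdivp m r1 in Em; set r' := Pdiv.CommonRing.rmodp m r1 in Em.
have lt' : (size r' < size (mp r))%N by rewrite -szr1 Pdiv.CommonRing.ltn_rmodpN0.
have er' : evalp r' = 0.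
  apply/eqP/negP => /negP r'0; have : (size (mp r) <= size (mp r'))%N.
    apply: rmin; split=> //; exists (- q * a), (c1%:P - q * b).
    have -> : mp (- q * a * s + (c1%:P - q * b) * m) = mp (c1%:P * m) - mp q * mp (a * s + b * m).
      by rewrite !rmorphD !rmorphM /= !rmorphB !rmorphM /= !rmorphN; ring.
    by rewrite -Er -Er1 mul_polyC Em rmorphD rmorphM /=; ring.
  by rewrite leqNgt (leq_ltn_trans (size_poly _ _)).
have mpr' : mp r' = 0 by apply: small => //; rewrite (leq_trans lt')// ltnW.
have eq0 : evalp q = 0.
  move/(congr1 evalp): Em; rewrite -mul_polyC rmorphD !rmorphM /= m0 mulr0 er' addr0.
  by move/esym/eqP; rewrite mulf_eq0 [evalp r1]evalpE Er1 -evalpE (negPf r0) orbF => /eqP.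
have Emp : e c1 *: mp m = mp q * mp r.
  move/(congr1 mp): Em; rewrite -mul_polyC rmorphD !rmorphM /= map_polyC /= mul_polyC.
  by rewrite mpr' addr0 Er1.
have qn0 : mp q != 0.
  apply: contraNneq mn0 => q0; move/eqP: Emp; rewrite q0 mul0r scaler_eq0 (negPf c10).
  by [].
have rn0 : mp r != 0 by rewrite -Er1.
have : (size (mp r) <= 1)%N.
  have := mmin _ eq0 qn0; rewrite -(size_scale (mp m) c10) Emp size_mul//.
  by case: (size (mp r)) => [|[|n]] //; rewrite addnS /= addnS ltnNge leq_addr.
move=> /size1_polyC E; exists a, b, r`_0.
by rewrite -Er E coef_map; split=> //; move: rn0; rewrite E polyC_eq0 coef_map.
Qed.

Lemma minimal_relation (h : {poly R}) : evalp h = 0 -> mp h != 0 ->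
  exists m, [/\ evalp m = 0, mp m != 0,
    forall h, evalp h = 0 -> mp h != 0 -> (size (mp m) <= size (mp h))%N &
    size m = size (mp m)].
Proof.
move=> h0 hn0; have [m1 [m10 m1n0] m1min] := @nat_argmin _
  (fun h => evalp h = 0 /\ mp h != 0) (fun h => size (mp h)) 
  (ex_intro _ h (conj h0 hn0)).
have [m [Em szm]] := poly_truncate m1; exists m; rewrite evalpE Em -evalpE.
by split=> // h' ? ?; apply: m1min.
Qed.

End SpecializationStep.

Lemma ex_nonroot (p : {poly algC}) : p != 0 -> exists n : nat, p.[n%:R] != 0.
Proof.
move=> p0; apply: contrapT => nex.
have := max_poly_roots p0 (rs := [seq n%:R | n <- iota 0 (size p)]).
rewrite size_map size_iota ltnn => H; suff: false by []; apply: H.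
  apply/allP => _ /mapP[n _ ->]; apply/negPn/negP => nr; apply: nex; exists n.
  exact: nr.
by rewrite map_inj_uniq ?iota_uniq//; apply: mulrIn; apply: oner_neq0.
Qed.

(** If g is transcendental over the image of R, any z outside the roots of s will do, and u is the
    leading coefficient of s. If g is algebraic, z is a root of the specialized minimal relation m,
    and u keeps both the degree of m and the Bezout constant from vanishing. *)
Lemma specialization_step (R : comNzRingType) (K : fieldType)
    (e : {rmorphism R -> K}) (g : K) (s : {poly R}) : (map_poly e s).[g] != 0 ->
  exists2 u, e u != 0 & forall phi : {rmorphism R -> algC},
    (forall x, e x = 0 -> phi x = 0) -> phi u != 0 ->
    exists z, (forall h, (map_poly e h).[g] = 0 -> (map_poly phi h).[z] = 0) /\
      (map_poly phi s).[z] != 0.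
Proof.
move=> s0; have [tr|/existsNP[h /not_implyP[h0 /eqP hn0]]] :=
    pselect (forall h, evalp e g h = 0 -> map_poly e h = 0).
  have sn0 : map_poly e s != 0 by apply: contraNneq s0 => ->; rewrite horner0.
  exists s`_(size (map_poly e s)).-1; first by rewrite -coef_map -lead_coefE lead_coef_eq0.
  move=> phi phi0 phis; have [|n nr] := @ex_nonroot (map_poly phi s).
    by apply: contraNneq phis => E; rewrite -coef_map E coef0.
  exists n%:R; split=> // h /tr eh; suff -> : map_poly phi h = 0 by rewrite horner0.
  apply/polyP => i; rewrite coef_map coef0; apply: phi0.
  by rewrite -coef_map eh coef0.
have [m [m0 mn0 mmin szm]] := minimal_relation h0 hn0.
have mnz : m != 0 by apply: contraNneq mn0 => ->; rewrite rmorph0.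
have [a [b [c [c0 Ec]]]] := algebraic_bezout m0 mn0 mmin szm s0.
exists (lead_coef m * c); first by rewrite rmorphM mulf_neq0// lead_coef_trunc.
move=> phi phi0; rewrite rmorphM mulf_eq0 negb_or => /andP[lm0 phic].
have cl := lead_coef_trunc szm mn0.
have szphi : size (map_poly phi m) = size m by apply: size_map_poly_id0.
have : size (map_poly phi m) != 1%N.
  rewrite szphi szm; apply/negP => /eqP E; move/eqP: E; move=> /eqP.
  move=> E; have := size1_polyC (eq_leq E) => E2; move: m0 mn0; rewrite evalpE E2 hornerC.
  by move=> ->; rewrite eqxx.
case/closed_rootP => z /rootP mz; exists z.
have ev0 h' : map_poly e h' = 0 -> map_poly phi h' = 0.
  move=> eh; apply/polyP => i; rewrite coef_map coef0; apply: phi0.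
  by rewrite -coef_map eh coef0.
split.
  move=> h' h'0; have := Pdiv.ComRing.rdivp_eq m h'.
  set k := lead_coef m ^+ _; set q := Pdiv.CommonRing.rdivp _ _.
  set r := Pdiv.CommonRing.rmodp _ _ => E.
  have lt : (size r < size m)%N by rewrite Pdiv.CommonRing.ltn_rmodpN0.
  have er : evalp e g r = 0.
    move/(congr1 (evalp e g)): E; rewrite -mul_polyC rmorphD !rmorphM /= m0 mulr0 add0r => <-.
    by rewrite [evalp e g h']evalpE h'0 mulr0.
  have mr : map_poly e r = 0.
    apply/eqP/negP => /negP/(mmin _ er); rewrite -szm leqNgt.
    by rewrite (leq_ltn_trans (size_poly _ _)).
  move/(congr1 (map_poly phi)): E; rewrite -mul_polyC rmorphD !rmorphM /= (ev0 _ mr) addr0.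
  move/(congr1 (fun p => p.[z])); rewrite !hornerM mz mulr0 map_polyC hornerC /= => /eqP.
  by rewrite mulf_eq0 rmorphXn expf_eq0 (negPf lm0) andbF => /eqP.
have /ev0 : map_poly e (a * s + b * m - c%:P) = 0.
  by rewrite rmorphB /= Ec map_polyC subrr.
rewrite !rmorphB !rmorphD !rmorphM /= map_polyC => /(congr1 (fun p => p.[z])).
rewrite horner0 hornerD hornerN hornerD !hornerM mz mulr0 addr0 hornerC /= => /eqP.
rewrite subr_eq0 => /eqP E; apply: contraNneq phic => sz0.
by rewrite -E sz0 mulr0.
Qed.

(** T is R[X_1]...[X_n] with evaluation at the generators, and the open condition is pulled back
    through one variable at a time. The specialization of R stays arbitrary, so that it can be
    prescribed on a base larger than Z. *)
Lemma specialization_tower (K : fieldType) (gs : seq K) :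
  forall (R : comNzRingType) (e : {rmorphism R -> K}),
  exists (T : comNzRingType) (i : {rmorphism R -> T}) (E : {rmorphism T -> K}),
  [/\ forall x, E (i x) = e x,
      forall g, g \in gs -> exists x, E x = g &
      forall t, E t != 0 -> exists2 u, e u != 0 &
        forall phi : {rmorphism R -> algC},
          (forall x, e x = 0 -> phi x = 0) -> phi u != 0 ->
          exists Phi : {rmorphism T -> algC},
            [/\ forall x, E x = 0 -> Phi x = 0, Phi t != 0 &
                forall x, Phi (i x) = phi x]].
Proof.
elim: gs => [|g gs IH] R e.
  exists R, idfun, e; split=> // t t0; exists t => // phi phi0 phit.
  by exists phi.
have [T [i [E [iE gsE tE]]]] := IH {poly R} (evalp e g).
exists T, (i \o polyC), E; split.
- by move=> x /=; rewrite iE /= evalpE map_polyC hornerC.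
- move=> x; rewrite inE => /orP[/eqP->|/gsE//].
  by exists (i 'X); rewrite iE /= evalpE map_polyX hornerX.
move=> t /tE[s s0 sP]; have [u u0 uP] := specialization_step s0.
exists u => // phi phi0 /(uP _ phi0)[z [z0 zs]].
have [||Phi [Phi0 Phit PhiE]] := sP (evalp phi z).
- by move=> x /=; rewrite !evalpE => /z0.
- by rewrite /= evalpE.
exists Phi; split=> // x /=.
by rewrite PhiE /= evalpE map_polyC hornerC.
Qed.

(** * Specializing a finitely generated domain *)

Section SpecializeDomain.
Variables (S : idomainType) (S_fg : finitely_generated_ring S).
Variables (K : fieldType) (j : {rmorphism S -> K}).
Hypothesis j_inj : injective j.

Lemma specialization_descend (T : comNzRingType) (E : {rmorphism T -> K})
    (Phi : {rmorphism T -> algC}) : (forall x, E x = 0 -> Phi x = 0) ->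
  (forall s, exists x, E x = j s) ->
  exists psi : {rmorphism S -> algC}, forall x s, E x = j s -> Phi x = psi s.
Proof.
move=> E0 /choice[f fE].
have PhiE x s : E x = j s -> Phi x = Phi (f s).
  move=> Ex; apply/eqP; rewrite -subr_eq0 -rmorphB E0//.
  by rewrite rmorphB /= Ex fE subrr.
pose psi s := Phi (f s).
have psiB : zmod_morphism psi.
  by move=> x y; rewrite /psi -rmorphB; apply/esym/PhiE; rewrite !rmorphB /= !fE.
have psiM : monoid_morphism psi.
  split; first by rewrite /psi -(rmorph1 Phi); apply/esym/PhiE; rewrite !rmorph1.
  by move=> x y; rewrite /psi -rmorphM; apply/esym/PhiE; rewrite !rmorphM /= !fE.
pose z := GRing.isZmodMorphism.Build _ _ psi psiB.
pose m := GRing.isMonoidMorphism.Build _ _ psi psiM.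
pose psi' : {rmorphism S -> algC} := HB.pack psi z m.
by exists psi' => x s /PhiE.
Qed.

Lemma fg_tower (gs : seq S) (T : comNzRingType) (E : {rmorphism T -> K}) :
  (forall U : {pred S}, subring_closed U -> {subset gs <= U} -> forall x, x \in U) ->
  (forall g, g \in map j gs -> exists x, E x = g) -> forall s, exists x, E x = j s.
Proof.
move=> gsP gsE s; pose U : {pred S} := fun s => `[< exists x, E x = j s >].
suff : s \in U by move/asboolP.
apply: gsP => [|g /(map_f j)/gsE ?]; last exact/asboolP.
split; first by apply/asboolP; exists 1; rewrite !rmorph1.
  move=> x y /asboolP[a Ea] /asboolP[b Eb]; apply/asboolP; exists (a - b).
  by rewrite !rmorphB /= Ea Eb.
move=> x y /asboolP[a Ea] /asboolP[b Eb]; apply/asboolP; exists (a * b).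
by rewrite !rmorphM /= Ea Eb.
Qed.

Hypothesis int_inj : injective (intr : int -> K).

(** The last clause makes phi and psi agree on the elements of K that come from R and are fractions
    of S; it is written without division because [psi a] may vanish. *)
Lemma specialize (gs : seq S) (R : comNzRingType) (e : {rmorphism R -> K}) (f : S) :
  (forall U : {pred S}, subring_closed U -> {subset gs <= U} -> forall x, x \in U) ->
  f != 0 ->
  exists2 u, e u != 0 & forall phi : {rmorphism R -> algC},
    (forall x, e x = 0 -> phi x = 0) -> phi u != 0 ->
    exists psi : {rmorphism S -> algC}, psi f != 0 /\
      forall x a b, e x * j a = j b -> phi x * psi a = psi b.
Proof.
move=> gsP f0; have [T [i [E [iE gsE tE]]]] := specialization_tower (map j gs) e.
have ES := fg_tower gsP gsE; have [t Et] := ES f.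
have [|u u0 uP] := tE t.
  by rewrite Et; apply: contra_neq f0 => jf; apply: j_inj; rewrite jf rmorph0.
exists u => // phi phi0 /(uP _ phi0)[Phi [Phi0 Phit iPhi]].
have [psi psiE] := specialization_descend Phi0 ES; exists psi.
rewrite -(psiE _ _ Et); split=> // x a b Exab; have [a' Ea] := ES a.
rewrite -(psiE _ _ Ea) -(psiE (i x * a')) -?iPhi ?rmorphM//=.
by rewrite iE Ea.
Qed.

Lemma specialize_neq0 (f : S) : f != 0 ->
  exists psi : {rmorphism S -> algC}, psi f != 0.
Proof.
move=> f0; have [gs gsP] := S_fg.
have [u u0 uP] := specialize (intr : int -> K) gsP f0.
have [||psi [psif _]] := uP (intr : int -> algC); last by exists psi.
  by move=> x; rewrite -[RHS](rmorph0 (intr : int -> K)) => /int_inj ->.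
by rewrite intr_eq0; apply: contra_neq u0 => ->.
Qed.

(** The base is Z[c]. A transcendental c goes to n + i for a suitable n, which is not even real; an
    algebraic c goes to a root of its minimal relation. *)
Lemma specialize_irrational (f : S) (c : K) : f != 0 ->
  (forall a b : int, b != 0 -> c * b%:~R != a%:~R) ->
  exists (psi : {rmorphism S -> algC}) (z : algC),
    [/\ psi f != 0, z \notin Crat & forall a b, c * j a = j b -> z * psi a = psi b].
Proof.
move=> f0 cQ; have [gs gsP] := S_fg.
have intr0 (R' : nzRingType) : (0 : int)%:~R = 0 :> R' by [].
have mapi0 (h : {poly int}) : map_poly (intr : int -> K) h = 0 -> h = 0.
  move=> h0; apply/polyP => i; apply: int_inj; rewrite coef0 -coef_map_id0// h0 coef0.
  by [].
have [u u0 uP] := specialize (evalp (intr : int -> K) c) gsP f0.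
suff [z [zQ z0 zu]] : exists z : algC, [/\ z \notin Crat,
    forall h, evalp (intr : int -> K) c h = 0 -> evalp (intr : int -> algC) z h = 0 &
    evalp (intr : int -> algC) z u != 0].
  have [psi [psif psiE]] := uP (evalp (intr : int -> algC) z) z0 zu.
  exists psi, z; split=> // a b Eab; have := psiE 'X a b.
  by rewrite /= !evalpE !map_polyX !hornerX; apply.
have [tr|/existsNP[h /not_implyP[h0 /eqP hn0]]] :=
    pselect (forall h, evalp (intr : int -> K) c h = 0 -> h = 0).
  have un0 : map_poly (intr : int -> algC) u != 0.
    rewrite map_poly_eq0_id0 ?intr_eq0 ?lead_coef_eq0//.
      by apply: contraNneq u0 => ->; rewrite rmorph0.
    by apply: contraNneq u0 => ->; rewrite rmorph0.
  have [|n nr] := @ex_nonroot (map_poly (intr : int -> algC) u \Po ('X + 'i%:P)).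
    by rewrite comp_poly_eq0 ?size_XaddC.
  exists (n%:R + 'i); split.
  - apply/negP => zQ; have : 'i \in Crat.
      by rewrite -(addKr n%:R 'i) rpredD// rpredN rpred_nat.
    move/Creal_Crat/Creal_ImP; rewrite Im_i; apply/eqP; exact: oner_neq0.
  - by move=> h' /tr->; rewrite rmorph0.
  - by move: nr; rewrite horner_comp !hornerE evalpE.
have hn0' : map_poly (intr : int -> K) h != 0 by apply: contra_neq hn0 => /mapi0.
have [m [m0 mn0 mmin szm]] := minimal_relation h0 hn0'.
have [u' u'0 u'P] := specialization_step u0.
have [||z [z0 zu]] := u'P (intr : int -> algC).
- by move=> x; rewrite -[RHS](rmorph0 (intr : int -> K)) => /int_inj ->.
- by rewrite intr_eq0; apply: contra_neq u'0 => ->.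
exists z; split=> //; apply/CratP => -[q Eq].
have dq : denq q != 0 := denq_neq0 q.
(* A rational z would be a root of both [l] and m, but a combination of the two is a nonzero
   constant. *)
pose l : {poly int} := (denq q)%:P * 'X - (numq q)%:P.
have lE (F : fieldType) (x : F) : evalp (intr : int -> F) x l = (denq q)%:~R * x - (numq q)%:~R.
  by rewrite evalpE rmorphB rmorphM /= !map_polyC map_polyX /= !hornerE.
have lc : evalp (intr : int -> K) c l != 0.
  by rewrite lE subr_eq0 mulrC cQ.
have [a [b [c' [c'0 Ec]]]] := algebraic_bezout m0 mn0 mmin szm lc.
have Ec' : a * l + b * m = c'%:P.
  apply/eqP; rewrite -subr_eq0; apply/eqP/mapi0; rewrite rmorphB /= Ec map_polyC subrr.
  by [].
have /eqP : evalp (intr : int -> algC) z (a * l + b * m) = 0.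
  have z0' : evalp (intr : int -> algC) z m = 0 := z0 _ m0.
  rewrite rmorphD !rmorphM /= z0' mulr0 addr0 lE Eq.
  rewrite -[X in _ * (_ * ratr X - _)]divq_num_den fmorph_div /= !ratr_int.
  by rewrite mulrCA divff ?intr_eq0// mulr1 subrr mulr0.
rewrite Ec' evalpE map_polyC hornerC intr_eq0 => /eqP c'z.
by move: c'0; rewrite c'z eqxx.
Qed.

End SpecializeDomain.

(** * Lattices in number fields and rationality of eigenvalues *)

Definition for_large_primes (Q : nat -> Prop) :=
  exists B : nat, forall p, prime p -> (B < p)%N -> Q p.

Lemma large_primes_and (Q Q' : nat -> Prop) : for_large_primes Q ->
  for_large_primes Q' -> for_large_primes (fun p => Q p /\ Q' p).
Proof.
move=> [B BP] [B' BP']; exists (maxn B B') => p pp; rewrite gtn_max => /andP[? ?].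
by split; [apply: BP|apply: BP'].
Qed.

Lemma large_primes_impl (Q Q' : nat -> Prop) : (forall p, prime p -> Q p -> Q' p) ->
  for_large_primes Q -> for_large_primes Q'.
Proof. by move=> QQ' [B BP]; exists B => p pp Bp; apply: QQ' => //; apply: BP. Qed.

Lemma large_primesT (Q : nat -> Prop) : (forall p, prime p -> Q p) -> for_large_primes Q.
Proof. by move=> QP; exists 0%N => p pp _; apply: QP. Qed.

Lemma large_primes_seq (T : eqType) (s : seq T) (Q : T -> nat -> Prop) :
  (forall x, for_large_primes (Q x)) ->
  for_large_primes (fun p => forall x, x \in s -> Q x p).
Proof.
move=> QP; elim: s => [|a s IH]; first exact: large_primesT.
apply: large_primes_impl (large_primes_and (QP a) IH) => p _ [Qa Qs] x.
by rewrite inE => /orP[/eqP->|/Qs].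
Qed.

Lemma large_primes_fin (T : finType) (Q : T -> nat -> Prop) :
  (forall x, for_large_primes (Q x)) -> for_large_primes (fun p => forall x, Q x p).
Proof.
move=> /(@large_primes_seq _ (enum T)); apply: large_primes_impl => p _ QP x.
by apply: QP; rewrite mem_enum.
Qed.

Lemma large_primes_false (Q : nat -> Prop) : for_large_primes Q ->
  exists p, prime p /\ Q p.
Proof.
by move=> [B BP]; have [p Bp pp] := prime_above B; exists p; split=> //; apply: BP.
Qed.

Lemma intr_rat_inj : injective (intr : int -> rat). Proof. exact: intr_inj. Qed.

Section LocalIntegers.
Variable p : nat.
Definition Zloc := locring (intr : int -> 'F_p) intr_rat_inj.
HB.instance Definition _ := GRing.ComNzRing.on Zloc.
Definition zlval : Zloc -> rat := @locval _ _ _ _ _ intr_rat_inj.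
Definition zlred : Zloc -> 'F_p := @locred _ _ _ _ _ intr_rat_inj.
HB.instance Definition _ := GRing.RMorphism.copy zlval (@locval _ _ _ _ _ intr_rat_inj).
HB.instance Definition _ := GRing.RMorphism.copy zlred (@locred _ _ _ _ _ intr_rat_inj).

Definition pint : {pred rat} :=
  loc_pred (intr : int -> rat) (intr : int -> 'F_p).
HB.instance Definition _ := GRing.isSubringClosed.Build rat pint
  (loc_subring_closed (intr : int -> 'F_p) intr_rat_inj).

Lemma zlval_inj : injective zlval. Proof. exact: locval_inj. Qed.

Lemma pintP x : reflect (exists y, zlval y = x) (x \in pint).
Proof.
apply: (iffP idP) => [xP|[y <-]]; last exact: (@locvalP _ _ _ _ _ _ y).
by apply: (locP intr_rat_inj); apply/asboolP.
Qed.

Lemma zlred0P (y : Zloc) : prime p -> zlred y = 0 -> exists z, y = p%:R * z.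
Proof.
move=> pp /locred_eq0[a [b [b0 /eqP a0 Ey]]]; move: a0.
rewrite intr_Fp_eq0// -(dvdzE p) => /dvdzP[a' Ea].
have [|z Ez] := @locP _ _ _ (intr : int -> rat) (intr : int -> 'F_p) intr_rat_inj (a'%:~R / b%:~R).
  by exists a', b.
exists z; apply: zlval_inj; rewrite rmorphM rmorph_nat.
transitivity (p%:R * (a'%:~R / b%:~R) : rat); last by rewrite -Ez.
by rewrite [LHS]Ey Ea rmorphM /= mulrA [p%:R * _]mulrC.
Qed.


Lemma zlred_natp : prime p -> zlred p%:R = 0.
Proof. by move=> pp; rewrite rmorph_nat pchar_Fp_0. Qed.

End LocalIntegers.

Lemma large_primes_pint (x : rat) : for_large_primes (fun p => x \in pint p).
Proof.
exists `|denq x|%N => p pp lt; apply/asboolP; exists (numq x), (denq x).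
rewrite divq_num_den intr_Fp_eq0//; split=> //; apply/negP => /dvdn_leq.
by rewrite absz_gt0 denq_neq0 leqNgt lt => /(_ isT).
Qed.

Lemma map_mx_exp (R R' : nzRingType) (f : {rmorphism R -> R'}) n (M : 'M[R]_n) k :
  map_mx f (M ^+ k) = map_mx f M ^+ k.
Proof.
by elim: k => [|k IH]; [rewrite !expr0 map_mx1|rewrite !exprS map_mxM IH].
Qed.

(** X^k = X^k - M^k is a multiple of X - M, so taking determinants shows that the characteristic
    polynomial divides a power of X. *)
Lemma mxtrace_nilpotent (F : fieldType) n (M : 'M[F]_n) k : M ^+ k = 0 -> \tr M = 0.
Proof.
case: n M => [|n] M Mk; first by rewrite /mxtrace big_ord0.
have cp : char_poly M %| 'X ^+ (k * n.+1).
  pose A : 'M[{poly F}]_n.+1 := 'X%:M; pose B := map_mx polyC M.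
  have AB : GRing.comm A B by rewrite /GRing.comm /A; apply: comm_scalar_mx.
  have := subrXX_comm k AB; rewrite -[B ^+ k]rmorphXn /= Mk map_mx0 subr0.
  have -> : A ^+ k = ('X ^+ k)%:M by rewrite /A -rmorphXn.
  move/(congr1 determinant); rewrite det_scalar det_mulmx -exprM => ->.
  exact: dvdp_mulr.
have := char_poly_trace M (ltn0Sn n); suff -> : char_poly M = 'X ^+ n.+1.
  by rewrite coefXn /= ltn_eqF// => /esym/eqP; rewrite oppr_eq0 => /eqP.
move: cp; rewrite -['X]subr0 -(polyC0 F) => /dvdp_exp_XsubCP[l _].
rewrite eqp_monic ?char_poly_monic ?monic_exp ?monicXsubC// => /eqP E.
have := size_char_poly M; rewrite E size_exp_XsubC => -[->].
by [].
Qed.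

Import VectorInternalTheory.

(** * The trace form and reducedness modulo large primes *)

Section NumberFieldLattice.
Variable L : fieldExtType rat.
Local Notation d := (dim L).

Definition mulr_mx (x : L) : 'M[rat]_d :=
  \matrix_(i, j) v2r (x * r2v (delta_mx 0 i)) 0 j.

Lemma v2rM x y : v2r (x * y) = v2r y *m mulr_mx x.
Proof.
rewrite -{1}[y]v2rK {1}[v2r y]row_sum_delta linear_sum mulr_sumr linear_sum.
apply/rowP => j; rewrite summxE !mxE; apply: eq_bigr => i _.
by rewrite linearZ -scalerAr linearZ !mxE.
Qed.

Lemma mulr_mxM x y : mulr_mx (x * y) = mulr_mx x *m mulr_mx y.
Proof.
apply/row_matrixP => i; rewrite row_mul !rowE.
have E z : delta_mx 0 i *m mulr_mx z = v2r (z * r2v (delta_mx 0 i)).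
  by rewrite v2rM r2vK.
by rewrite !E -v2rM mulrA [y * x]mulrC.
Qed.

Lemma mulr_mxX x k : mulr_mx (x ^+ k) = mulr_mx x ^+ k.
Proof.
elim: k => [|k IH]; last by rewrite !exprS mulr_mxM IH.
apply/row_matrixP => i; rewrite !expr0 !rowE mulmx1.
by rewrite -{1}(r2vK (delta_mx 0 i)) -v2rM mul1r r2vK.
Qed.

Lemma mulr_mx1 : mulr_mx 1 = 1%:M. Proof. by rewrite -(expr0 0) mulr_mxX. Qed.

Lemma mulr_mx_linear : linear mulr_mx.
Proof.
move=> a x y; apply/matrixP => i j; rewrite !mxE mulrDl linearD -scalerAl linearZ.
by rewrite !mxE.
Qed.
HB.instance Definition _ := GRing.isLinear.Build rat L 'M[rat]_d _ mulr_mx mulr_mx_linear.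

Lemma dim_fieldExt_gt0 : (0 < d)%N.
Proof.
rewrite lt0n; apply/negP => /eqP d0; have /eqP := oner_neq0 L; apply.
apply: (can_inj v2rK); apply/rowP => i; exfalso; move: i; rewrite d0.
by case.
Qed.

Definition trace_mx : 'M[rat]_d :=
  \matrix_(i, j) \tr (mulr_mx (r2v (delta_mx 0 i) * r2v (delta_mx 0 j))).

Lemma v2r_trace_mx x :
  v2r x *m trace_mx = \row_j \tr (mulr_mx (x * r2v (delta_mx 0 j))).
Proof.
apply/rowP => j; rewrite !mxE -{2}[x]v2rK {2}[v2r x]row_sum_delta.
rewrite linear_sum mulr_suml !linear_sum; apply: eq_bigr => i _.
by rewrite !mxE !linearZ -scalerAl !linearZ.
Qed.

(* tr (x * x^-1) = dim L is nonzero in characteristic 0. *)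
Lemma trace_mx_unit : trace_mx \in unitmx.
Proof.
rewrite -row_free_unit -kermx_eq0; apply/eqP/row_matrixP => i; rewrite row0.
set u := row i _; have u0 : u *m trace_mx = 0.
  by apply/eqP; rewrite -sub_kermx row_sub.
have ux0 y : \tr (mulr_mx (r2v u * y)) = 0.
  rewrite -[y]v2rK [v2r y]row_sum_delta linear_sum mulr_sumr !linear_sum big1// => j _.
  rewrite linearZ -scalerAr !linearZ.
  have := v2r_trace_mx (r2v u); rewrite r2vK u0 => /rowP/(_ j).
  by rewrite [in LHS]mxE [in RHS]mxE => E; rewrite /= -E mulr0.
have [x0|x0] := eqVneq (r2v u) 0; first by apply: (can_inj r2vK); rewrite x0 linear0.
have := ux0 (r2v u)^-1; rewrite divff// mulr_mx1 mxtrace1 => /eqP.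
by rewrite pnatr_eq0 -leqn0 leqNgt dim_fieldExt_gt0.
Qed.

(** The Z_(p)-span of a fixed basis of L over Q. For large p it is a ring and takes the place of the
    ring of integers localized at p. *)
Definition lattice (p : nat) : {pred L} := [pred x | [forall i, v2r x 0 i \in pint p]].

Lemma latticeP p x : reflect (forall i, v2r x 0 i \in pint p) (x \in lattice p).
Proof. exact: forallP. Qed.

Lemma large_primes_lattice x : for_large_primes (fun p => x \in lattice p).
Proof.
apply: large_primes_impl (@large_primes_fin _ (fun i p => v2r x 0 i \in pint p) _) => [p _ xP|i].
  exact/latticeP.
exact: large_primes_pint.
Qed.

Lemma lattice_zmod_closed p : zmod_closed (lattice p).
Proof.
split; first by apply/latticeP => i; rewrite linear0 mxE rpred0.
move=> x y /latticeP xP /latticeP yP; apply/latticeP => i.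
by rewrite linearB !mxE rpredB.
Qed.
HB.instance Definition _ p := GRing.isZmodClosed.Build L (lattice p) (lattice_zmod_closed p).

Definition pint_mx p m n (M : 'M[rat]_(m, n)) := forall i j, M i j \in pint p.

Lemma large_primes_pint_mx m n (M : 'M[rat]_(m, n)) : for_large_primes (fun p => pint_mx p M).
Proof.
apply: large_primes_impl (@large_primes_fin _ (fun ij p => M ij.1 ij.2 \in pint p) _) =>
  [p _ MP i j|ij].
  exact: (MP (i, j)).
exact: large_primes_pint.
Qed.

Lemma pint_mxM p m n l (M : 'M_(m, n)) (M' : 'M_(n, l)) :
  pint_mx p M -> pint_mx p M' -> pint_mx p (M *m M').
Proof. by move=> MP MP' i j; rewrite mxE rpred_sum// => k _; rewrite rpredM. Qed.

Lemma large_primes_lattice_mul :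
  for_large_primes (fun p => forall x, x \in lattice p -> pint_mx p (mulr_mx x)).
Proof.
have := @large_primes_fin _ _ (fun i => large_primes_pint_mx (mulr_mx (r2v (delta_mx 0 i)))).
apply: large_primes_impl => p _ eP x /latticeP xP i j.
rewrite -[x]v2rK [v2r x]row_sum_delta !linear_sum summxE rpred_sum// => k _.
by rewrite !linearZ mxE rpredM//; apply: eP.
Qed.

Lemma large_primes_lattice_subring :
  for_large_primes (fun p => subring_closed (lattice p)).
Proof.
apply: large_primes_impl (large_primes_and large_primes_lattice_mul (large_primes_lattice 1)).
move=> p _ [mulP oneP]; split=> //; first exact: rpredB.
move=> x y xP /latticeP yP; apply/latticeP => i; rewrite v2rM.
by apply: (@pint_mxM p _ _ _ (v2r y)) => [k l|]; rewrite ?ord1//; apply: mulP.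
Qed.

(** Large primes are unramified: if x is nilpotent modulo p, so is x z for each basis vector z,
    hence p divides the trace of x z. The Gram matrix of the trace form has a p-integral inverse for
    large p, which turns this into divisibility of the coordinates of x. *)
Lemma large_primes_lattice_reduced :
  for_large_primes (fun p => forall x k y, x \in lattice p -> y \in lattice p ->
    x ^+ k = p%:R * y -> exists2 z, z \in lattice p & x = p%:R * z).
Proof.
have eP := @large_primes_fin _ _ (fun i => large_primes_lattice (r2v (delta_mx 0 i))).
have tP := large_primes_pint_mx (invmx trace_mx).
apply: large_primes_impl (large_primes_and (large_primes_and eP tP)
  (large_primes_and large_primes_lattice_mul large_primes_lattice_subring)).
move=> p pp {eP tP} [[eP tP] [mulP sub]] x k y xP yP Exy.
have [_ _ subM] := sub.
have latX z m : z \in lattice p -> z ^+ m \in lattice p.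
  by move=> zP; elim: m => [|m IH]; [case: sub|rewrite exprS subM].
have trP i : exists2 t, t \in pint p & \tr (mulr_mx (x * r2v (delta_mx 0 i))) = p%:R * t.
  set z := r2v _; have zP : z \in lattice p := eP i.
  have [|M EM] := @map_mx_loc _ _ _ _ (intr : int -> 'F_p) intr_rat_inj _ _ (mulr_mx (x * z)).
    by apply: mulP; apply: subM.
  have [|M' EM'] := @map_mx_loc _ _ _ _ (intr : int ->
    'F_p) intr_rat_inj _ _ (mulr_mx (y * z ^+ k)).
    by apply: mulP; apply: subM => //; apply: latX.
  have Mk : M ^+ k = p%:R *: M'.
    have E : map_mx (@zlval p) (M ^+ k) = map_mx (@zlval p) (p%:R *: M').
      rewrite map_mx_exp map_mxZ rmorph_nat -[map_mx _ M]EM -[map_mx _ M']EM'.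
      by rewrite -mulr_mxX -linearZ exprMn Exy /= scaler_nat -mulrA mulr_natl.
    apply/matrixP => i1 i2; apply: (@zlval_inj p).
    by have /matrixP/(_ i1 i2) := E; rewrite !mxE.
  have redM : map_mx (@zlred p) M ^+ k = 0.
    by rewrite -map_mx_exp Mk map_mxZ rmorph_nat pchar_Fp_0// scale0r.
  have /mxtrace_nilpotent := redM; rewrite trace_map_mx => /(zlred0P pp)[t Et].
  exists (zlval t); first by apply/pintP; exists t.
  by rewrite EM trace_map_mx -/(@zlval p) Et rmorphM rmorph_nat.
have /choice[t tE] : forall i, exists t,
  t \in pint p /\ \tr (mulr_mx (x * r2v (delta_mx 0 i))) = p%:R * t.
  by move=> i; have [t ? ?] := trP i; exists t.
exists (r2v ((\row_i t i) *m invmx trace_mx)).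
  apply/latticeP => i; rewrite r2vK; apply: (@pint_mxM p _ _ _ (\row_i t i)) => // k' l.
  by rewrite mxE; case: (tE l).
apply: (can_inj v2rK); rewrite -[LHS](mulmxK trace_mx_unit) v2r_trace_mx.
have -> : p%:R * r2v (\row_i t i *m invmx trace_mx) = r2v (p%:R *: (\row_i t i *m invmx trace_mx)).
  by rewrite linearZ /= scaler_nat mulr_natl.
rewrite r2vK scalemxAl; congr (_ *m _); apply/rowP => i; rewrite !mxE.
by case: (tE i).
Qed.

End NumberFieldLattice.

Section RationalCoordinates.
Variables (L : fieldExtType rat) (n : nat).

Definition rat_coords (v : 'rV[L]_n) : 'rV[rat]_(n * dim L) :=
  mxvec (\matrix_(l, j) v2r (v 0 l) 0 j).

Lemma rat_coordsE v l j : rat_coords v 0 (mxvec_index l j) = v2r (v 0 l) 0 j.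
Proof. by rewrite mxvecE mxE. Qed.

Lemma rat_coords_eq0 v : rat_coords v = 0 -> v = 0.
Proof.
move=> v0; apply/rowP => l; rewrite mxE; apply: (can_inj v2rK); apply/rowP => j.
by rewrite -rat_coordsE v0 linear0 !mxE.
Qed.

Lemma rat_coords_sum r (a : 'I_r -> rat) (v : 'I_r -> 'rV[L]_n) :
  rat_coords (\sum_i (a i)%:A *: v i) = \sum_i a i *: rat_coords (v i).
Proof.
apply/rowP => k; case/mxvec_indexP: k => l j.
rewrite rat_coordsE !summxE linear_sum summxE; apply: eq_bigr => i _.
by rewrite !mxE -scalerAl mul1r linearZ mxE mxvecE mxE.
Qed.

End RationalCoordinates.

Lemma horner_mx_alg_poly (L : fieldExtType rat) n (C : 'M[L]_n.+1) (h : {poly rat}) r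
    (w : 'rV[L]_n.+1) : (size h <= r)%N ->
  w *m horner_mx C (map_poly (in_alg L) h) = \sum_(i < r) (h`_i)%:A *: (w *m C ^+ i).
Proof.
move=> hr; have szh : (size (map_poly (in_alg L) h) <= r)%N by rewrite (leq_trans (size_poly _ _)).
rewrite {1}(_ : map_poly _ h = \poly_(i < r) (h`_i)%:A); last first.
  apply/polyP => i; rewrite coef_map coef_poly /=; case: ltnP => // ri.
  by rewrite nth_default ?scale0r// (leq_trans hr).
rewrite poly_def linear_sum /= mulmx_sumr; apply: eq_bigr => i _.
by rewrite horner_mxZ rmorphXn /= horner_mx_X scalemxAr.
Qed.

Lemma minpoly_algC_coprime (g h : {poly rat}) (a : algC) :
  (forall q, root (map_poly ratr q) a = (g %| q)) -> h != 0 -> (size h < size g)%N ->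
  coprimep g h.
Proof.
move=> gP h0 lt; have /dvdpP[q Eg] := dvdp_gcdl g h.
have /orP[gq|gg] : (g %| q) || (g %| gcdp g h).
- by rewrite -!gP -rootM -rmorphM -Eg gP.
- have g0 : g != 0 by rewrite -size_poly_gt0 (leq_ltn_trans _ lt).
  have [q0 c0] : q != 0 /\ gcdp g h != 0.
    by apply/andP; rewrite -negb_or -mulf_eq0 -Eg.
  have := dvdp_leq q0 gq; have -> : size g = (size q + size (gcdp g h)).-1.
    by rewrite -size_mul// -Eg.
  move: q0 c0; rewrite /coprimep -!size_poly_gt0.
  move: (size q) (size (gcdp g h)) => x [|[|y]] // _ _.
  by rewrite !addnS /= => le; have := leq_trans le (leq_addr y x); rewrite ltnn.
have /dvdp_leq := dvdp_trans gg (dvdp_gcdr g h).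
by rewrite h0 leqNgt lt => /(_ isT).
Qed.

Lemma horner_mx_eigenvector (F : comNzRingType) n (A : 'M[F]_n.+1) (v : 'rV_n.+1) a p :
  v *m A = a *: v -> v *m horner_mx A p = p.[a] *: v.
Proof.
move=> vA; elim/poly_ind: p => [|p c IH]; first by rewrite rmorph0 mulmx0 horner0 scale0r.
rewrite rmorphD rmorphM /= horner_mx_X horner_mx_C mulmxDr mulmxA IH -scalemxAl vA.
by rewrite mul_mx_scalar hornerMXaddC scalerA scalerDl.
Qed.

(** Let g be the minimal polynomial of an irrational a, and w a nonzero vector over L killed by
    g(C). The vectors w C^i with i < deg g are independent over Q, and a left inverse [Y] of their
    coordinates is p-integral for large p. The remainder of X^p - X by g, evaluated at C and applied
    to w, is divisible by p, hence so are its coefficients. So g divides X^p - X modulo p and splits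
    with distinct roots for all large p. *)
Lemma eigenvalue_rational (L : fieldExtType rat) (LC : {rmorphism L -> algC}) n
    (C : 'M[L]_n.+1) (a : algC) :
  for_large_primes (fun p => forall i j,
    exists2 y : L, y \in lattice p & (C ^+ p - C) i j = p%:R * y) ->
  root (char_poly (map_mx LC C)) a -> a \in Crat.
Proof.
move=> CP rt; apply: contrapT => /negP aQ.
have [g [_ gm] gP] := minCpolyP a.
have LCQ h : map_poly LC (map_poly (in_alg L) h) = map_poly ratr h.
  rewrite -map_poly_comp; apply: eq_map_poly => x /=.
  by rewrite alg_num_field fmorph_rat.
have g0 : g != 0 := monic_neq0 gm.
have groot : root (map_poly ratr g) a by rewrite gP.
have gnr (q : rat) : ~~ root g q.
  apply: contra aQ => /factor_theorem[h Eh]; move: groot.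
  rewrite Eh rmorphM rootM !gP => /orP[gh|gx].
    have h0 : h != 0 by apply: contraNneq g0 => h0; rewrite Eh h0 mul0r.
    have := dvdp_leq h0 gh; rewrite Eh size_mul ?polyXsubC_eq0// size_XsubC addn2 /=.
    by rewrite ltnn.
  rewrite -gP in gx; move: gx; rewrite rmorphB /= map_polyX map_polyC root_XsubC => /eqP->.
  exact: Crat_rat.
(* g(C) kills an eigenvector over [algC], hence is singular, and singularity descends to L. *)
have [w w0 wC] : exists2 w : 'rV[L]_n.+1, w != 0 &
    w *m horner_mx C (map_poly (in_alg L) g) = 0.
  move: rt; rewrite -eigenvalue_root_char => /eigenvalueP[v va v0].
  set A := horner_mx C _; have vA : v *m map_mx LC A = 0.
    by rewrite map_horner_mx LCQ (horner_mx_eigenvector _ va) (rootP groot) scale0r.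
  have An : A \notin unitmx.
    apply: contraNN v0; rewrite -(map_unitmx LC) => Au.
    by rewrite -[v](mulmxK Au) vA mul0mx.
  have : kermx A != 0 by rewrite kermx_eq0 row_free_unit.
  case/rowV0Pn => w /sub_kermxP wA w0; by exists w.
set r := (size g).-1; have szg : size g = r.+1 by rewrite /r prednK// size_poly_gt0.
pose Mw : 'M[rat]_(r, n.+1 * dim L) := \matrix_(i < r) rat_coords (w *m C ^+ i).
have MwE (u : 'rV_r) : u *m Mw = rat_coords (\sum_i (u 0 i)%:A *: (w *m C ^+ i)).
  rewrite rat_coords_sum mulmx_sum_row; apply: eq_bigr => i _.
  by rewrite rowK.
have [Y MwY] : exists Y, Mw *m Y = 1%:M.
  apply/row_freeP; rewrite -kermx_eq0; apply/rowV0P => u /sub_kermxP.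
  rewrite MwE => /rat_coords_eq0; pose h := rVpoly u.
  have szh : (size h <= r)%N by apply: size_poly.
  move=> hw; have {}hw : w *m horner_mx C (map_poly (in_alg L) h) = 0.
    rewrite (horner_mx_alg_poly _ _ szh) -[RHS]hw; apply: eq_bigr => i _.
    by rewrite coef_rVpoly_ord.
  apply/eqP; apply: contraNT w0 => u0.
  have h0 : h != 0 by apply: contraNneq u0 => h0; rewrite -[u]rVpolyK -/h h0 linear0.
  have /Bezout_eq1_coprimepP[[s t] /= Est] :=
    minpoly_algC_coprime gP h0 (leq_ltn_trans szh (eq_leq (esym szg))).
  have -> : w = w *m horner_mx C (map_poly (in_alg L) (s * g + t * h)).
    by rewrite Est !rmorph1 mulmx1.
  rewrite [s * g]mulrC [t * h]mulrC !rmorphD !rmorphM /= mulmxDr !mulmxA wC hw.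
  by rewrite !mul0mx addr0.
have [G [c c0 EG]] := rat_poly_scale g.
have Gg : map_poly intr G = c%:~R *: g by rewrite EG scalerA divff ?scale1r// intr_eq0.
have c0' : c%:~R != 0 :> rat by rewrite intr_eq0.
have szG : size G = r.+1.
  by rewrite -szg -(size_scale g c0') -Gg (size_map_inj_poly intr_rat_inj).
have lG : lead_coef G = c.
  apply: intr_rat_inj; rewrite -(lead_coef_map_inj intr_rat_inj)// Gg.
  by rewrite lead_coefZ (monicP gm) mulr1.
have YP := large_primes_pint_mx Y.
have wP := @large_primes_fin _ _ (fun i => large_primes_lattice (w 0 i)).
have gP' := @large_primes_fin _ _ (fun i : 'I_r.+1 => large_primes_pint g`_i).
have [B0 BP] := large_primes_and (large_primes_and CP (large_primes_lattice_subring L))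
  (large_primes_and YP (large_primes_and wP gP')).
have sz1 : (1 < size G)%N.
  rewrite szG -szg -(size_map_poly (ratr : rat -> algC)) (root_size_gt1 _ groot)//.
  by rewrite map_poly_eq0.
apply: (@splits_mod_primes_absurd G B0) => // [x y hxy|].
  have Gi i : (G`_i)%:~R = c%:~R * g`_i :> rat by rewrite -coefZ -Gg coef_map.
  have E : \sum_(i < r.+1) c%:~R * g`_i * x%:~R ^+ i * y%:~R ^+ (r - i) = 0 :> rat.
    have := congr1 (intr : int -> rat) hxy; rewrite /homog rmorph_sum szG rmorph0 => E0.
    rewrite -[RHS]E0.
    by apply: eq_bigr => i _; rewrite !rmorphM !rmorphXn /= Gi.
  have [y0|y0] := eqVneq y 0.
    split=> //; move: E; rewrite big_ord_recr big1 /= => [|i _]; last first.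
      by rewrite y0 expr0n subn_eq0 leqNgt ltn_ord mulr0.
    rewrite add0r subnn mulr1 => /eqP.
    have -> : g`_r = 1 by rewrite -(monicP gm) lead_coefE szg.
    by rewrite mulr1 mulf_eq0 (negPf c0') expf_eq0 intr_eq0 => /andP[_ /eqP].
  have y0' : y%:~R != 0 :> rat by rewrite intr_eq0.
  have := gnr (x%:~R / y%:~R); rewrite /root horner_coef szg.
  suff -> : \sum_(i < r.+1) g`_i * (x%:~R / y%:~R) ^+ i = 0 by rewrite eqxx.
  apply: (mulfI c0'); apply: (mulfI (expf_neq0 r y0')); rewrite !mulr0 -[RHS]E.
  rewrite mulr_sumr mulr_sumr; apply: eq_bigr => i _; have ile : (i <= r)%N by rewrite -ltnS.
  by rewrite expr_div_n exprB ?unitfE//; ring.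
move=> p pp /(BP p pp)[[{}CP sub] [{}YP [{}wP {}gP']]].
have [|gp Egp] := @map_poly_loc _ _ _ _ (intr : int -> 'F_p) intr_rat_inj g.
  move=> i; have [lt|le] := ltnP i r.+1; first exact: (gP' (Ordinal lt)).
  by rewrite nth_default ?szg//; exact: (@rpred0 _ (pint p)).
have szgp : size gp = r.+1.
  by rewrite -szg Egp size_map_inj_poly ?rmorph0//; exact: (@zlval_inj p).
have gpm : gp \is monic.
  apply/eqP; apply: (@zlval_inj p); rewrite rmorph1.
  by rewrite -(lead_coef_map_inj (@zlval_inj p)) ?rmorph0// -[map_poly _ gp]Egp (monicP gm).
have redm : map_poly (@zlred p) gp \is monic by apply: monic_map.
have szred : size (map_poly (@zlred p) gp) = r.+1.
  by rewrite size_map_poly_id0// (monicP gpm) rmorph1 oner_neq0.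
have dv : map_poly (@zlred p) gp %| 'X^p - 'X.
  pose f : {poly Zloc p} := 'X^p - 'X.
  (* As g is monic, the division takes place over Z_(p) and can be reduced. *)
  have Ef := Pdiv.RingMonic.rdivp_eq gpm f.
  set q := Pdiv.CommonRing.rdivp f gp in Ef; set rm := Pdiv.CommonRing.rmodp f gp in Ef.
  have szrm : (size rm <= r)%N.
    by rewrite -ltnS -szgp Pdiv.CommonRing.ltn_rmodpN0// monic_neq0.
  suff rm0 : map_poly (@zlred p) rm = 0.
    have := congr1 (map_poly (@zlred p)) Ef; rewrite [RHS]rmorphD /= rm0 addr0 [RHS]rmorphM.
    rewrite rmorphB /= map_polyXn map_polyX => ->; exact: dvdp_mulIr.
  have [y yP Ey] : exists2 y : 'rV[L]_n.+1, (forall i, y 0 i \in lattice p) &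
      w *m (C ^+ p - C) = p%:R *: y.
    have [|yC yCP] := @choice ('I_n.+1 * 'I_n.+1)%type L (fun ij y => y \in lattice p /\
        (C ^+ p - C) ij.1 ij.2 = p%:R * y).
      by move=> ij; have [y yP Ey] := CP ij.1 ij.2; exists y.
    exists (\row_m \sum_l w 0 l * yC (l, m)).
      move=> m; rewrite mxE rpred_sum// => l _; have [_ _ subM] := sub.
      by apply: subM => //; case: (yCP (l, m)).
    apply/rowP => m; rewrite mxE [RHS]mxE mxE mulr_sumr; apply: eq_bigr => l _.
    by have [_ /= ->] := yCP (l, m); rewrite mulrCA.
  have Erm : w *m (C ^+ p - C) = \sum_(i < r) (zlval rm`_i)%:A *: (w *m C ^+ i).
    have szrm' : (size (map_poly (@zlval p) rm) <= r)%N by rewrite (leq_trans (size_poly _ _)).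
    under eq_bigr do rewrite -(coef_map (@zlval p)).
    rewrite -(horner_mx_alg_poly _ _ szrm').
    have := congr1 (map_poly (in_alg L) \o map_poly (@zlval p)) Ef => /=.
    rewrite [Pdiv.CommonRing.rdivp _ _ * _]mulrC !rmorphD !rmorphM /= !rmorphN /=.
    rewrite !map_polyXn !map_polyX => /(congr1 (horner_mx C)).
    rewrite !rmorphD !rmorphM /= rmorphN /= rmorphXn /= horner_mx_X => ->.
    by rewrite mulmxDr !mulmxA -Egp wC mul0mx add0r.
  have Erow : (\row_i zlval rm`_i) *m Mw = p%:R *: rat_coords y.
    rewrite MwE; under eq_bigr do rewrite mxE.
    rewrite -Erm Ey; apply/rowP => k; case/mxvec_indexP: k => l j.
    by rewrite rat_coordsE mxE [in RHS]mxE rat_coordsE mulr_natl linearMn mulr_natl mulmxnE.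
  apply/polyP => i; rewrite coef_map coef0 /=.
  have [lt|le] := ltnP i r; last by rewrite nth_default ?rmorph0// (leq_trans szrm).
  have : zlval rm`_i = p%:R * (rat_coords y *m Y) 0 (Ordinal lt).
    have := congr1 (fun v => (v *m Y) 0 (Ordinal lt)) Erow.
    by rewrite -mulmxA MwY mulmx1 -scalemxAl !mxE.
  have /pintP[z <-] : (rat_coords y *m Y) 0 (Ordinal lt) \in pint p.
    apply: pint_mxM => // i1; case/mxvec_indexP => l j; rewrite ord1 rat_coordsE.
    by have /latticeP := yP l.
  rewrite -(rmorph_nat (@zlval p)) -rmorphM => /(@zlval_inj p) ->.
  by rewrite rmorphM /= zlred_natp// mul0r.
have EX : 'X^p - 'X = \prod_(x : 'F_p) ('X - x%:P).
  by rewrite -finField_genPoly card_Fp.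
rewrite EX in dv; have [m] := dvdp_prod_XsubC dv.
rewrite eqp_monic ?monic_prod_XsubC// => /eqP Em.
exists (mask m (index_enum _)); split.
- by rewrite mask_uniq// index_enum_uniq.
- rewrite szG /=; have := size_prod_XsubC (mask m (index_enum 'F_p)) id.
  by rewrite -Em szred => -[].
rewrite lG -Em.
have -> : map_poly intr G = map_poly (@zlred p) (map_poly intr G).
  by rewrite -map_poly_comp; apply: eq_map_poly => x /=; rewrite rmorph_int.
have -> : map_poly intr G = c%:~R *: gp.
  apply: (map_inj_poly (@zlval_inj p)); first exact: rmorph0.
  rewrite -map_poly_comp map_polyZ /= rmorph_int -[map_poly _ gp]Egp -Gg.
  by apply: eq_map_poly => x /=; rewrite rmorph_int.
by rewrite map_polyZ /= rmorph_int.
Qed.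

(** * Prime ideals of finitely generated rings *)

Local Open Scope classical_set_scope.
Local Notation "x %:F" := (@FracField.tofrac _ x).

Section PrimeIdeals.
Variable S : comNzRingType.

Lemma mk_prime_ideal (A : set S) : A 0 -> ~ A 1 ->
  (forall a u v, A u -> A v -> A (a * u + v)) ->
  (forall u v, A (u * v) -> A u \/ A v) ->
  exists P : prime_idealr S, forall x, (x \in (P : {pred S})) <-> A x.
Proof.
move=> A0 A1 Alin Apr; pose Q : S -> bool := fun x => `[< A x >].
have Qid : idealr_closed Q.
  split; [exact/asboolP|exact/asboolPn|].
  by move=> a u v /asboolP Au /asboolP Av; apply/asboolP; apply: Alin.
have Qpr : prime_idealr_closed Q.
  by move=> u v /asboolP/Apr[Au|Av]; apply/orP; [left|right]; apply/asboolP.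
pose z := isIdealr.Build S Q Qid; pose w := isPrimeIdealrClosed.Build S Q Qpr.
pose P : prime_idealr S := HB.pack Q z w.
by exists P => x; split => [/asboolP|Ax]; [|apply/asboolP].
Qed.

(* Krull: an ideal maximal among those avoiding the powers of a is prime. *)
Lemma prime_avoiding (b a : S) : (forall i c, a ^+ i <> b * c) ->
  exists P : prime_idealr S, b \in (P : {pred S}) /\ a \notin (P : {pred S}).
Proof.
move=> abN; pose ideal (A : set S) :=
  [/\ A 0, A b, forall x u v, A u -> A v -> A (x * u + v) & forall i, ~ A (a ^+ i)].
have [|A [+ Amax]] := @Zorn_bigcup S (fun A => A = set0 \/ ideal A).
  move=> F FP Ftot; have [[B FB /eqP B0]|nB] := pselect (exists2 B, F B & B != set0); last first.
    left; apply/seteqP; split=> // x [X FX Xx]; exfalso; apply: nB; exists X => //.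
    by apply/eqP => X0; rewrite X0 in Xx.
  have idF X x : F X -> X x -> ideal X by move=> /FP[->|].
  have [B'|[Bz Bb Blin Ba]] := FP _ FB; first by case: B0.
  right; split; [by exists B|by exists B| |].
    move=> x u v [X FX Xu] [Y FY Yv].
    have [XY|YX] := Ftot _ _ FX FY.
      by exists Y => //; have [_ _ l _] := idF _ _ FY Yv; apply: l => //; apply: XY.
    by exists X => //; have [_ _ l _] := idF _ _ FX Xu; apply: l => //; apply: YX.
  by move=> i [X FX Xa]; have [_ _ _ /(_ i)] := idF _ _ FX Xa.
have idb : ideal [set x | exists c, x = b * c].
  split; [by exists 0; rewrite mulr0|by exists 1; rewrite mulr1| |].
    by move=> x u v [c ->] [c' ->]; exists (x * c + c'); ring.
  by move=> i [c]; apply: abN.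
case=> [A0|[Az Ab Alin Aa]].
  case: (Amax [set x | exists c, x = b * c]); last by right.
  rewrite A0; split=> // /(_ b); apply; exists 1; by rewrite mulr1.
have ext u : ~ A u -> exists i c y, A y /\ a ^+ i = u * c + y.
  move=> Au; apply: contrapT => nex.
  case: (Amax [set x | exists c y, A y /\ x = u * c + y]).
    split; first by move=> x Ax; exists 0, x; rewrite mulr0 add0r.
    by move=> le; apply: Au; apply: le; exists 1, 0; rewrite mulr1 addr0; split.
  right; split.
  - by exists 0, 0; rewrite mulr0 addr0.
  - by exists 0, b; rewrite mulr0 add0r.
  - move=> x v w [c [y [Ay ->]]] [c' [y' [Ay' ->]]].
    by exists (x * c + c'), (x * y + y'); split; [exact: Alin|ring].
  - by move=> i [c [y [Ay E]]]; apply: nex; exists i, c, y.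
have Amul x u : A u -> A (x * u) by move=> Au; rewrite -[_ * _]addr0; apply: Alin.
have Apr u v : A (u * v) -> A u \/ A v.
  move=> Auv; apply: contrapT => /not_orP[/ext[i [c [y [Ay Ei]]]] /ext[k [c' [y' [Ay' Ek]]]]].
  apply: (Aa (i + k)%N); rewrite exprD Ei Ek.
  have -> : (u * c + y) * (v * c' + y') =
    (c * c') * (u * v) + ((u * c + y) * y' + (v * c') * y) by ring.
  by apply: (Alin) => //; apply: (Alin); [|exact: Amul].
have [P PE] := mk_prime_ideal Az (Aa 0%N) Alin Apr.
by exists P; split; [apply/PE|apply/negP => /PE; apply: (Aa 1%N)].
Qed.

End PrimeIdeals.

Lemma comap_prime_ideal (O S : comNzRingType) (i : {rmorphism O -> S}) (Q : prime_idealr S) :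
  exists P : prime_idealr O, forall x, (x \in (P : {pred O})) = (i x \in (Q : {pred S})).
Proof.
have [||||P PE] := @mk_prime_ideal O (fun x => i x \in (Q : {pred S})).
- by rewrite rmorph0 idealr0.
- by rewrite rmorph1 idealr1.
- by move=> a u v uQ vQ; rewrite rmorphD rmorphM rpredD// idealMr.
- by move=> u v; rewrite rmorphM prime_idealrM => /orP.
by exists P => x; apply/idP/idP => /PE.
Qed.

Lemma prime_ideal_natr (O : comNzRingType) (P : prime_idealr O) (p q : nat) :
  prime p -> prime q -> p%:R \in (P : {pred O}) -> q%:R \in (P : {pred O}) -> p = q.
Proof.
move=> pp pq pP qP; apply/eqP; apply: contraT => npq.
have cop : coprime p q by rewrite prime_coprime// dvdn_prime2.
have [u v E _] := egcdnP q (prime_gt0 pp).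
have E1 : u%:R * p%:R - v%:R * q%:R = 1 :> O.
  by rewrite -!natrM E (eqP cop) natrD addrAC subrr add0r.
have := idealr1 P; rewrite -E1 rpredB ?idealMr//.
Qed.

(** A prime ideal contains at most one prime number, so finitely many exceptional ideals exclude
    finitely many p. That p is nonzero in O matters because [almost_all_primes] speaks of nonzero
    ideals only. *)
Lemma almost_all_large_primes (O : comNzRingType) (Q : prime_idealr O -> Prop) :
  (forall p : nat, prime p -> p%:R != 0 :> O) -> almost_all_primes Q ->
  for_large_primes (fun p => forall P : prime_idealr O, p%:R \in (P : {pred O}) -> Q P).
Proof.
move=> O0 /finite_seqP[s Es].
have [B BP] : for_large_primes (fun p => forall X, X \in s ->
    forall P : prime_idealr O, X = [set x | x \in (P : {pred O})] -> p%:R \notin (P : {pred O})).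
  apply: large_primes_seq => X.
  have [[p [P [pp EX pP]]]|nex] := pselect (exists p (P : prime_idealr O), 
      [/\ prime p, X = [set x | x \in (P : {pred O})] & p%:R \in (P : {pred O})]).
    exists p => q pq lt P' EX'; apply/negP => qP'.
    have qP : q%:R \in (P : {pred O}).
      by have : [set x | x \in (P : {pred O})] q%:R by rewrite -EX EX'.
    by move: lt; rewrite (prime_ideal_natr pp pq pP qP) ltnn.
  apply: large_primesT => p pp P EX; apply/negP => pP; apply: nex; by exists p, P.
exists B => p pp lt P pP; apply: contrapT => nQ.
pose X : set O := [set x | x \in (P : {pred O})].
have Xs : X \in s.
  have : [set` s] X; last by [].
  rewrite -Es; exists P; split=> //; by exists p%:R; rewrite ?O0.
by have := BP p pp lt X Xs P erefl; rewrite pP.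
Qed.

Section ResidueMap.
Variables (S : idomainType) (P : prime_idealr S).

Definition res (x : S) : residue_field P := (residue_class P x)%:F.

Lemma res_zmod : zmod_morphism res.
Proof.
move=> x y; rewrite /res -rmorphB; congr (_%:F).
exact: (rmorphB (\pi_({ideal_quot P})%qT)).
Qed.

Lemma res_monoid : monoid_morphism res.
Proof.
split; first by rewrite /res -tofrac1; congr (_%:F); exact: (rmorph1 (\pi_({ideal_quot P})%qT)).
move=> x y; rewrite /res -rmorphM; congr (_%:F).
exact: (rmorphM (\pi_({ideal_quot P})%qT)).
Qed.

HB.instance Definition _ := GRing.isZmodMorphism.Build S (residue_field P) res res_zmod.
HB.instance Definition _ := GRing.isMonoidMorphism.Build S (residue_field P) res res_monoid.

Lemma res_eq0 x : (res x == 0) = (x \in (P : {pred S})).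
Proof.
rewrite /res tofrac_eq0 /residue_class -(residue_class0 P) /residue_class.
by rewrite -(Quotient.idealrBE P) subr0.
Qed.

Lemma tofrac_inj : injective (@FracField.tofrac S).
Proof. by move=> x y /eqP; rewrite tofrac_eq => /eqP. Qed.

Lemma reductionE (a b : S) : b \notin (P : {pred S}) ->
  reduction P (a%:F / b%:F) = res a / res b.
Proof.
move=> bP; rewrite /reduction; case: xgetP => [[c d] _ /= [dP E]|/(_ (a, b))]; last first.
  by case.
have d0 : d != 0 by apply: contraNneq dP => ->; rewrite rpred0.
have b0 : b != 0 by apply: contraNneq bP => ->; rewrite rpred0.
have /tofrac_inj Eadbc : (a * d)%:F = (c * b)%:F.
  by apply/eqP; rewrite !rmorphM -eqr_div ?tofrac_eq0// E.
apply/eqP; rewrite -!/(res _) eqr_div ?res_eq0//.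
by rewrite -!rmorphM Eadbc.
Qed.

End ResidueMap.

Lemma frac_repr (S : idomainType) (x : {fraction S}) :
  exists a b, b != 0 /\ x = a%:F / b%:F.
Proof.
elim/quotW: x => x; exists (\n_x), (\d_x); have d0 := denom_ratioP x; split=> //.
have -> : (\n_x)%:F / (\d_x)%:F =
    \pi_{fraction S}%qT (FracField.mulf (Ratio (\n_x) 1) (FracField.invf (Ratio (\d_x) 1))).
  by rewrite FracField.pi_mul FracField.pi_inv; unlock FracField.tofrac.
apply/eqmodP; rewrite /= FracField.equivfE /FracField.mulf /FracField.invf.
by rewrite !numden_Ratio ?mulr1 ?mul1r ?oner_neq0//= mulrC.
Qed.

Lemma number_field_factor (S : idomainType) (psi : {rmorphism S -> algC}) :
  finitely_generated_ring S ->
  exists (L : fieldExtType rat) (LC : {rmorphism L -> algC}) (psi' : {rmorphism S -> L}),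
    forall x, LC (psi' x) = psi x.
Proof.
case=> gs gsP; have [L [LC [s1 Es _]]] := num_field_exists [seq psi g | g <- gs].
have im x : exists y, LC y = psi x.
  pose U : {pred S} := fun s => `[< exists y, LC y = psi s >].
  suff : x \in U by move/asboolP.
  apply: gsP => [|g /(map_f psi)]; last first.
    by rewrite -Es => /mapP[y _ E]; apply/asboolP; exists y; rewrite E.
  split; first by apply/asboolP; exists 1; rewrite !rmorph1.
    move=> y z /asboolP[a Ea] /asboolP[b Eb]; apply/asboolP; exists (a - b).
    by rewrite !rmorphB Ea Eb.
  move=> y z /asboolP[a Ea] /asboolP[b Eb]; apply/asboolP; exists (a * b).
  by rewrite !rmorphM Ea Eb.
have /choice[f fE] := im.
have fB : zmod_morphism f by move=> x y; apply: (fmorph_inj LC); rewrite !rmorphB !fE rmorphB.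
have fM : monoid_morphism f.
  split; first by apply: (fmorph_inj LC); rewrite fE !rmorph1.
  by move=> x y; apply: (fmorph_inj LC); rewrite !rmorphM !fE rmorphM.
pose z := GRing.isZmodMorphism.Build _ _ f fB.
pose m := GRing.isMonoidMorphism.Build _ _ f fM.
pose f' : {rmorphism S -> L} := HB.pack f z m.
by exists L, LC, f'.
Qed.

(** * Elements lying in all good primes above p *)

Section GoodPrimes.
Variables (S : idomainType) (S_fg : finitely_generated_ring S).
Hypothesis int_inj : injective (intr : int -> S).
(** Good primes need only lie below every prime Q above a large p; they will be extended from the
    intersections of Q with O. *)
Variable good : prime_idealr S -> Prop.
Hypothesis good_below : for_large_primes (fun p => forall Q : prime_idealr S,
  p%:R \in (Q : {pred S}) -> exists P : prime_idealr S,
    [/\ good P, p%:R \in (P : {pred S}) & {subset (P : {pred S}) <= (Q : {pred S})}]).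

(** If p divided no power of a, some prime Q above p would avoid a, and with it the good prime
    inside Q. *)
Lemma large_primes_nilpotent : for_large_primes (fun p => forall a : S,
  (forall P : prime_idealr S, good P -> p%:R \in (P : {pred S}) -> a \in (P : {pred S})) ->
  exists i c, a ^+ i = p%:R * c).
Proof.
apply: large_primes_impl good_below => p pp gP a aP; apply: contrapT => nex.
have [|Q [pQ /negP aQ]] := @prime_avoiding S p%:R a.
  by move=> i c E; apply: nex; exists i, c.
have [P [Pg pP PQ]] := gP Q pQ; apply: aQ; apply: PQ; exact: aP.
Qed.

Lemma large_primes_fg_lattice (L : fieldExtType rat) (psi : {rmorphism S -> L}) :
  for_large_primes (fun p => forall x, psi x \in lattice p).
Proof.
have [gs gsP] := S_fg.
have := large_primes_seq gs (fun g => large_primes_lattice (psi g)).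
move=> /(large_primes_and (large_primes_lattice_subring L)).
apply: large_primes_impl => p _ [[l1 lB lM] gsL] x.
pose U : {pred S} := fun s => psi s \in lattice p.
suff : x \in U by [].
apply: gsP => // ; split.
- by change (psi 1 \in lattice p); rewrite rmorph1.
- by move=> y z yU zU; change (psi (y - z) \in lattice p); rewrite rmorphB; apply: lB.
- by move=> y z yU zU; change (psi (y * z) \in lattice p); rewrite rmorphM; apply: lM.
Qed.

(** Nilpotence modulo p passes through psi and the lattice modulo p is reduced; no prime of L has to
    be matched with a prime of S. *)
Lemma large_primes_divides (L : fieldExtType rat) (psi : {rmorphism S -> L}) :
  for_large_primes (fun p => forall a : S,
  (forall P : prime_idealr S, good P -> p%:R \in (P : {pred S}) -> a \in (P : {pred S})) ->
  exists2 z, z \in lattice p & psi a = p%:R * z).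
Proof.
apply: large_primes_impl (large_primes_and large_primes_nilpotent (large_primes_and
  (large_primes_fg_lattice psi) (large_primes_lattice_reduced L))).
move=> p pp [nil [latt red]] a /nil[i [c E]].
have /(red _ _ (psi c)) := latt a; move=> /(_ i); apply => //.
by rewrite -rmorphXn E rmorphM rmorph_nat.
Qed.

(** Otherwise, for some large p, the image of s under a specialization that does not kill it would
    be divisible by p in the lattice, where its inverse also lies. A nonzero coordinate of 1 then
    makes 1 divisible by p in Z_(p). *)
Lemma good_prime_avoiding (s : S) (B : nat) : s != 0 -> exists p (P : prime_idealr S),
  [/\ prime p, (B < p)%N, good P, p%:R \in (P : {pred S}) & s \notin (P : {pred S})].
Proof.
move=> s0; apply: contrapT => nex.
have K_inj : injective (intr : int -> {fraction S}).
  by move=> x y; rewrite -!(rmorph_int (@FracField.tofrac S)) => /tofrac_inj/int_inj.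
have [psi psis] := specialize_neq0 S_fg (@tofrac_inj S) K_inj s0.
have [L [LC [psi' psiE]]] := number_field_factor psi S_fg.
have s'0 : psi' s != 0.
  by apply: contra_neq psis => E; rewrite -psiE E rmorph0.
have large : for_large_primes (fun p => (B < p)%N) by exists B.
have [p [pp [[Bp div] [sV [l1 [_ _ lM]]]]]] := large_primes_false (large_primes_and
  (large_primes_and large (large_primes_divides psi'))
  (large_primes_and (large_primes_lattice (psi' s)^-1)
    (large_primes_and (@large_primes_fin _ _ (fun i => large_primes_pint (v2r (1 : L) 0 i)^-1))
      (large_primes_lattice_subring L)))).
have [P Pg pP|z zP Ez] := div s.
  by apply: contrapT => /negP sP; apply: nex; exists p, P.
have E1 : 1 = p%:R * (z * (psi' s)^-1) by rewrite mulrA -Ez divff.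
have /latticeP yP := lM _ _ zP sV; move: (z / _) yP E1 => y yP E1.
have [i i0] : exists i, v2r (1 : L) 0 i != 0.
  apply: contrapT => nex2; have /eqP := oner_neq0 L; apply.
  apply: (can_inj v2rK); apply/rowP => i; rewrite linear0 mxE; apply: contrapT => /eqP i0.
  by apply: nex2; exists i.
have /pintP[t1 Et1] := yP i; have /pintP[t2 Et2] := l1 i.
have : (1 : Zloc p) = p%:R * (t1 * t2).
  apply: (@zlval_inj p); rewrite rmorph1 !rmorphM rmorph_nat /= Et1 Et2 mulrA.
  have -> : p%:R * v2r y 0 i = v2r (1 : L) 0 i by rewrite [in RHS]E1 mulr_natl mulr_natl linearMn
    mulmxnE.
  by rewrite divff.
move/(congr1 (@zlred p)); rewrite rmorph1 rmorphM rmorph_nat pchar_Fp_0// mul0r => /eqP.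
Qed.

End GoodPrimes.

(* The minimal polynomial divides the separable polynomial X^p - X. *)
Lemma frobenius_fixed_semisimple (k : fieldType) p n (E : 'M[k]_n.+1) (xs : seq k) :
  p \in [pchar k] -> E ^+ p = E ->
  horner_mx E (\prod_(x <- xs) ('X - x%:P)) = 0 ->
  forall q : {poly k}, (forall x, x \in xs -> root q x) -> horner_mx E q = 0.
Proof.
move=> pk Ep Exs q qxs.
have p0 : p%:R = 0 :> k := pcharf0 pk.
have sep : separable_poly ('X^p - 'X : {poly k}).
  rewrite unlock derivB derivXn derivX -mulr_natl -(rmorph_nat (@polyC k)) p0 rmorph0 mul0r sub0r.
  by rewrite coprimep_sym -scaleN1r coprimepZl ?oppr_eq0 ?oner_eq0// coprime1p.
have mX : mxminpoly E %| 'X^p - 'X.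
  by apply: mxminpoly_min; rewrite rmorphB rmorphXn /= horner_mx_X Ep subrr.
have mP : mxminpoly E %| \prod_(x <- xs) ('X - x%:P) by apply: mxminpoly_min.
have [m] := dvdp_prod_XsubC mP.
rewrite eqp_monic ?mxminpoly_monic ?monic_prod_XsubC// => /eqP Em.
have um : uniq (mask m xs).
  by rewrite -separable_prod_XsubC -Em; apply: dvdp_separable sep.
have : mxminpoly E %| q.
  rewrite Em; apply: uniq_roots_dvdp; last by rewrite uniq_rootsE.
  by apply/allP => x /mem_mask/qxs.
case/dvdpP => r ->; by rewrite rmorphM /= mx_root_minpoly mulr0.
Qed.

Lemma rat_seq_common_denominator (s : seq rat) :
  exists (m : nat) (ls : seq int), (0 < m)%N /\ s = [seq l%:~R / m%:R | l <- ls].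
Proof.
elim: s => [|q s [m [ls [m0 ->]]]]; first by exists 1%N, [::].
exists (m * `|denq q|)%N, (numq q * m%:Z :: [seq l * denq q | l <- ls]).
have d0 : (0 < `|denq q|)%N by rewrite absz_gt0 denq_neq0.
have dE : (`|denq q|%:R : rat) = (denq q)%:~R by rewrite pmulrn -[in RHS]absz_denq.
split; first by rewrite muln_gt0 m0.
have m0' : m%:R != 0 :> rat by rewrite pnatr_eq0 -lt0n.
have d0' : (denq q)%:~R != 0 :> rat by rewrite intr_eq0 denq_neq0.
rewrite /= natrM dE; congr (_ :: _).
  rewrite rmorphM /= -pmulrn -[LHS]divq_num_den; field; exact/andP.
rewrite -map_comp; apply: eq_map => l /=; rewrite rmorphM; field; exact/andP.
Qed.

Lemma prod_scaled_XsubC (F : fieldType) (m : nat) (ls : seq int) : m%:R != 0 :> F ->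
  \prod_(l <- ls) (m%:R *: 'X - l%:~R%:P) =
  m%:R ^+ size ls *: \prod_(x <- [seq l%:~R / m%:R | l <- ls]) ('X - x%:P) :> {poly F}.
Proof.
move=> m0; elim: ls => [|l ls IH]; first by rewrite !big_nil scale1r.
rewrite /= !big_cons IH exprS -!mul_polyC !polyCM mulrACA; congr (_ * _).
by rewrite mulrBr mulrCA -!polyCM divff// mulr1.
Qed.

(** With denominators cleared the polynomial comes from Z, so it can be carried to K, to residue
    fields and to [algC] alike. *)
Lemma map_prod_scaled_XsubC (F : nzRingType) (m : nat) (ls : seq int) :
  map_poly intr (\prod_(l <- ls) (m%:R *: 'X - l%:P)) =
  \prod_(l <- ls) (m%:R *: 'X - l%:~R%:P) :> {poly F}.
Proof.
rewrite rmorph_prod; apply: eq_bigr => l _ /=.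
by rewrite rmorphB /= map_polyZ map_polyX map_polyC /= rmorph_nat.
Qed.

(** * Semisimplicity of a matrix with C^p = C modulo good primes *)

Section ConstantMatrix.
Variables (S : idomainType) (S_fg : finitely_generated_ring S).
Hypothesis int_inj : injective (intr : int -> S).
Variable good : prime_idealr S -> Prop.
Hypothesis good_below : for_large_primes (fun p => forall Q : prime_idealr S,
  p%:R \in (Q : {pred S}) -> exists P : prime_idealr S,
    [/\ good P, p%:R \in (P : {pred S}) & {subset (P : {pred S}) <= (Q : {pred S})}]).
Variables (n : nat) (D : 'M[S]_n.+1) (f : S).
Hypothesis f0 : f != 0.

(** C is kept as D / f with D over S, so that one formula gives its image under every homomorphism
    that does not kill f. *)
Definition frac_mx (F : fieldType) (r : S -> F) : 'M[F]_n.+1 :=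
  (r f)^-1 *: map_mx r D.

Hypothesis frob : forall p (P : prime_idealr S), prime p -> good P ->
  p%:R \in (P : {pred S}) -> f \notin (P : {pred S}) ->
  frac_mx (res P) ^+ p = frac_mx (res P).

Local Notation K := {fraction S}.
Local Notation j := (@FracField.tofrac S).
Local Notation C := (frac_mx j).

Let K_inj : injective (intr : int -> K).
Proof. by move=> x y; rewrite -!(rmorph_int j) => /tofrac_inj/int_inj. Qed.

Lemma frac_mx_loc (F : fieldType) (r : {rmorphism S -> F}) : r f != 0 ->
  exists M : 'M[locring r (@tofrac_inj S)]_n.+1,
    map_mx locval M = C /\ map_mx locred M = frac_mx r.
Proof.
move=> rf; have [|M EM] := @map_mx_loc _ _ _ j r (@tofrac_inj S) _ _ C.
  move=> i l; rewrite !mxE; apply/asboolP; exists (D i l), f.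
  by rewrite mulrC.
exists M; split=> //; apply/matrixP => i l; rewrite !mxE.
rewrite (@locredE _ _ _ _ _ _ _ (D i l) f) //; first by rewrite mulrC.
by have := congr1 (fun A : 'M_n.+1 => A i l) EM; rewrite !mxE => <-; rewrite mulrC.
Qed.

Lemma eigenvalue_frac_mx (psi : {rmorphism S -> algC}) (a : algC) : psi f != 0 ->
  root (char_poly (frac_mx psi)) a -> a \in Crat.
Proof.
move=> psif; have [L [LC [psi' psiE]]] := number_field_factor psi S_fg.
have f'0 : psi' f != 0 by apply: contra_neq psif => E; rewrite -psiE E rmorph0.
have -> : frac_mx psi = map_mx LC (frac_mx psi').
  by apply/matrixP => i l; rewrite !mxE rmorphM fmorphV !psiE.
apply: eigenvalue_rational.
apply: large_primes_impl (large_primes_and (large_primes_divides S_fg good_below psi')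
  (large_primes_and (large_primes_lattice (psi' f)^-1) (large_primes_lattice_subring L))).
move=> p pp [div [fV [l1 _ lM]]] i l.
have fVX k : (psi' f)^-1 ^+ k \in lattice p.
  by elim: k => [|k IH]; rewrite ?expr0// exprS lM.
(* The factor f puts the entries of X also into the good primes containing f, about which [frob]
   says nothing. *)
pose X := f *: (D ^+ p - f ^+ p.-1 *: D).
have [P Pg pP|z zP Ez] := div (X i l).
  have [fP|fP] := boolP (f \in (P : {pred S})); first by rewrite mxE mulrC idealMr.
  have fr0 : res P f != 0 by rewrite res_eq0.
  rewrite mxE idealMr// -res_eq0; have := frob pp Pg pP fP.
  rewrite /frac_mx exprZn => /(congr1 (fun A : 'M_n.+1 => (res P f ^+ p *: A) i l)).
  rewrite scalerA -exprMn divff// expr1n scale1r -map_mx_exp scalerA.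
  have -> : res P f ^+ p / res P f = res P (f ^+ p.-1).
    by rewrite -{1}(prednK (prime_gt0 pp)) exprSr mulfK// rmorphXn.
  by rewrite !mxE => E; rewrite rmorphB rmorphM E subrr.
exists ((psi' f)^-1 ^+ p.+1 * z); first by apply: lM => //; apply: fVX.
rewrite mulrCA -Ez /frac_mx exprZn -map_mx_exp !mxE rmorphM rmorphB rmorphM rmorphXn /=.
have E1 : (psi' f)^-1 ^+ p.+1 * psi' f = (psi' f)^-1 ^+ p by rewrite exprSr mulfVK.
have E2 : (psi' f)^-1 ^+ p * psi' f ^+ p.-1 = (psi' f)^-1.
  by rewrite -{1}(prednK (prime_gt0 pp)) exprS -mulrA -exprMn mulVf// expr1n mulr1.
by rewrite mulrA E1 mulrBr [X in _ = _ - X]mulrA E2.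
Qed.

(** An irrational coefficient can be specialized to an irrational number, whereas the specialized
    polynomial has rational roots and hence rational coefficients. *)
Lemma char_poly_rational i : exists a b : int, b != 0 /\ (char_poly C)`_i * b%:~R = a%:~R.
Proof.
apply: contrapT => nex.
have [|psi [z [psif zQ zE]]] := specialize_irrational S_fg (@tofrac_inj S) K_inj f0 (c :=
  (char_poly C)`_i).
  by move=> a b b0; apply/negP => /eqP E; apply: nex; exists a, b.
have [M [EM Er]] := frac_mx_loc psif.
have Ec : (char_poly C)`_i = locval (char_poly M)`_i.
  by rewrite -EM -map_char_poly coef_map.
have [u [v [v0 Euv]]] := locE (char_poly M)`_i.
have zE' : z = (char_poly (frac_mx psi))`_i.
  rewrite -Er -map_char_poly coef_map /= (locredE v0 Euv).
  apply: (canRL (mulfK v0)); apply: zE; rewrite Ec Euv mulfVK// tofrac_eq0.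
  by apply: contra_neq v0 => ->; rewrite rmorph0.
have [s Es] := closed_field_poly_normal (char_poly (frac_mx psi)).
rewrite (monicP (char_poly_monic _)) scale1r in Es.
have sQ x : x \in s -> x \in Crat.
  by move=> xs; apply: (eigenvalue_frac_mx psif); rewrite Es root_prod_XsubC.
move: zQ; rewrite zE' Es => /negP; apply.
have : \prod_(x <- s) ('X - x%:P) \is a polyOver Crat.
  rewrite big_seq rpred_prod// => x xs; rewrite rpredB ?polyOverX// polyOverC.
  exact: sQ.
by move/polyOverP.
Qed.

(** As its coefficients are rational, the characteristic polynomial is unchanged by specialization,
    and after specialization its roots are known to be rational. *)
Lemma char_poly_frac_mx : exists (m : nat) (ls : seq int), (0 < m)%N /\
  m%:R ^+ n.+1 *: char_poly C = map_poly intr (\prod_(l <- ls) (m%:R *: 'X - l%:P)).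
Proof.
have K0 (a : int) : (a%:~R == 0 :> K) = (a == 0).
  by rewrite -(inj_eq K_inj).
have [psi psif] := specialize_neq0 S_fg (@tofrac_inj S) K_inj f0.
have [M [EM Er]] := frac_mx_loc psif.
have EcK i : (char_poly C)`_i = locval (char_poly M)`_i.
  by rewrite -EM -map_char_poly coef_map.
have EcA i : (char_poly (frac_mx psi))`_i = locred (char_poly M)`_i.
  by rewrite -Er -map_char_poly coef_map.
have [s Es] := closed_field_poly_normal (char_poly (frac_mx psi)).
rewrite (monicP (char_poly_monic _)) scale1r in Es.
have szs : size s = n.+1.
  by have := size_char_poly (frac_mx psi); rewrite Es size_prod_XsubC => -[].
have sQ x : x \in s -> exists q : rat, x = ratr q.
  move=> xs; apply/CratP; apply: (eigenvalue_frac_mx psif).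
  by rewrite Es root_prod_XsubC.
have [qs Eqs] : exists qs : seq rat, s = map ratr qs.
  elim: s {Es szs} sQ => [|x s IH] sQ; first by exists [::].
  have [q Eq] := sQ x (mem_head _ _); have [|qs Eqs] := IH.
    by move=> y ys; apply: sQ; rewrite inE ys orbT.
  by exists (q :: qs); rewrite /= -Eq -Eqs.
have [m [ls [m0 Els]]] := rat_seq_common_denominator qs.
exists m, ls; split=> //.
have /choice[ab abP] : forall i, exists ab : int * int,
  ab.2 != 0 /\ (char_poly C)`_i * ab.2%:~R = ab.1%:~R.
  by move=> i; have [a [b ?]] := char_poly_rational i; exists (a, b).
pose b := \prod_(i < n.+2) (ab i).2.
have b0 : b != 0 by apply/prodf_neq0 => i _; case: (abP i).
pose H : {poly int} := \poly_(i < n.+2) ((ab i).1 * \prod_(i' < n.+2 | i' != inord i) (ab i').2).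
have bE i : (i < n.+2)%N -> b = (ab i).2 * \prod_(i' < n.+2 | i' != inord i) (ab i').2.
  by move=> lt; rewrite /b (bigD1 (inord i))//= inordK.
have HK : b%:~R *: char_poly C = map_poly intr H.
  apply/polyP => i; rewrite coefZ coef_map_id0// coef_poly; case: ltnP => lt.
    have [_ abE] := abP i; rewrite (bE _ lt) !rmorphM /= -abE; ring.
  by rewrite nth_default ?mulr0// size_char_poly.
have HA : b%:~R *: char_poly (frac_mx psi) = map_poly intr H.
  apply/polyP => i; rewrite coefZ coef_map_id0// EcA.
  have : b%:~R * (char_poly M)`_i = (H`_i)%:~R.
    apply: (@locval_inj _ _ _ _ psi (@tofrac_inj S)); rewrite rmorphM /= !rmorph_int -EcK.
    by rewrite -coefZ HK coef_map_id0.
  by move/(congr1 locred); rewrite rmorphM /= !rmorph_int.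
have E : (m%:R ^+ n.+1 : int) *: H = b *: \prod_(l <- ls) (m%:R *: 'X - l%:P).
  apply: (map_inj_poly (intr_inj : injective (intr : int -> algC))) => //.
  rewrite [in LHS]map_polyZ -HA Es Eqs Els map_polyZ /= scalerA mulrC -scalerA.
  congr (_ *: _); rewrite map_prod_scaled_XsubC prod_scaled_XsubC ?pnatr_eq0 -?lt0n//.
  rewrite rmorphXn /= rmorph_nat -szs Eqs Els !size_map; congr (_ *: _).
  rewrite -map_comp !big_map; apply: eq_bigr => l _; congr (_ - _%:P) => /=.
  by rewrite fmorph_div /= ratr_int ratr_nat.
apply: (@scalerI _ _ b%:~R); first by rewrite K0.
rewrite scalerA mulrC -scalerA HK.
by have := congr1 (map_poly (intr : int -> K)) E;
  rewrite !map_polyZ /= rmorphXn /= rmorph_nat => ->.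
Qed.

(** Cayley-Hamilton gives the product with multiplicities. Modulo a good prime above p > m the
    relation C^p = C makes the squarefree product vanish already, while a nonzero entry over K would
    survive modulo one of these primes. *)
Theorem frac_mx_semisimple : exists (m : nat) (ls : seq int), [/\ (0 < m)%N, uniq ls &
  horner_mx C (\prod_(l <- ls) (m%:R *: 'X - l%:~R%:P)) = 0].
Proof.
have [m [ls0 [m0 Ech]]] := char_poly_frac_mx.
pose ls := undup ls0; exists m, ls; split; rewrite ?undup_uniq//.
pose pK (F : fieldType) (ls : seq int) : {poly F} := \prod_(l <- ls) (m%:R *: 'X - l%:~R%:P).
have pKE (F : fieldType) (r : {rmorphism S -> F}) : r f != 0 ->
   forall ls1 i l, exists x : locring r (@tofrac_inj S),
     locval x = horner_mx C (pK _ ls1) i l /\ locred x = horner_mx (frac_mx r) (pK _ ls1) i l.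
  move=> rf ls1 i l; have [M [EM Er]] := frac_mx_loc rf.
  pose L := locring r (@tofrac_inj S).
  pose pL : {poly L} := \prod_(l <- ls1) (m%:R *: 'X - l%:~R%:P).
  have pLE (F' : fieldType) (h : {rmorphism L -> F'}) : map_poly h pL = pK F' ls1.
    rewrite rmorph_prod; apply: eq_bigr => l' _ /=.
    by rewrite rmorphB /= map_polyZ map_polyX map_polyC /= rmorph_nat rmorph_int.
  exists (horner_mx M pL i l); split.
    by rewrite -EM -(pLE _ (locval : L -> K)) -map_horner_mx mxE.
  by rewrite -Er -(pLE _ (locred : L -> F)) -map_horner_mx mxE.
have CH : horner_mx C (pK _ ls0) = 0.
  rewrite /pK -map_prod_scaled_XsubC.
  by rewrite -Ech linearZ /= Cayley_Hamilton scaler0.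
apply/matrixP => i l; rewrite [RHS]mxE; apply: contrapT => /eqP x0.
have [a [b [b0 Ex]]] := frac_repr (horner_mx C (pK _ ls) i l).
have a0 : a != 0 by apply: contraNneq x0 => a0; rewrite [X in X == _]Ex a0 rmorph0 mul0r.
have s0 : f * (a * b) != 0 by rewrite !mulf_neq0.
have [p [P [pp mp Pg pP]]] := good_prime_avoiding S_fg int_inj good_below m s0.
rewrite !prime_idealrM !negb_or => /and3P[fP aP bP].
have fr0 : res P f != 0 by rewrite res_eq0.
have pk : p \in [pchar (residue_field P)].
  by rewrite inE pp -(rmorph_nat (res P)) res_eq0.
have red0 : horner_mx (frac_mx (res P)) (pK _ ls0) = 0.
  apply/matrixP => i' l'; have [x [Ex1 Ex2]] := pKE _ (res P) fr0 ls0 i' l'.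
  rewrite -Ex2 mxE; have -> : x = 0 by apply: locval_inj; rewrite Ex1 CH mxE rmorph0.
  exact: rmorph0.
have mk0 : m%:R != 0 :> residue_field P.
  by rewrite -(dvdn_pcharf pk); apply/negP => /(dvdn_leq m0); rewrite leqNgt mp.
have pKs ls1 := prod_scaled_XsubC ls1 mk0.
have redls : horner_mx (frac_mx (res P)) (pK _ ls) = 0.
  apply: (frobenius_fixed_semisimple pk (frob pp Pg pP fP) (xs := [seq l%:~R / m%:R | l <- ls0])).
    move/eqP: red0; rewrite /pK pKs linearZ /= scaler_eq0 expf_eq0 (negPf mk0) andbF => /eqP.
    by [].
  move=> x /mapP[l' l'ls ->]; rewrite /pK pKs (rootZ _ _ (expf_neq0 _ mk0)) root_prod_XsubC.
  by apply: map_f; rewrite mem_undup.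
have [x [Ex1 Ex2]] := pKE _ (res P) fr0 ls i l.
move: Ex2; rewrite redls mxE (@locredE _ _ _ _ _ _ _ a b) ?res_eq0//; last by rewrite Ex1.
by move/eqP; rewrite mulf_eq0 invr_eq0 !res_eq0 (negPf aP) (negPf bP).
Qed.
End ConstantMatrix.

(** * Functions on the annulus *)

Section AnnulusCoefficients.
Variables (F : fieldType) (a1 a2 : rat).
Local Notation A := (annulus F a1 a2).
Implicit Types (f g : A) (x y z : int * int).

Definition coef f x : F := f x.1 x.2.

Lemma coef_inj f g : (forall x, coef f x = coef g x) -> f = g.
Proof. by move=> fg; apply: annulus_inj => k j; apply: (fg (k, j)). Qed.

Lemma coefM f g : coef (f * g) = conv (coef f) (coef g).
Proof. by apply/funext => -[k j]; apply: annulus_mulE. Qed.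

Lemma coefAD f g x : coef (f + g) x = coef f x + coef g x. Proof. by []. Qed.
Lemma coefAN f x : coef (- f) x = - coef f x. Proof. by []. Qed.
Lemma coefAB f g x : coef (f - g) x = coef f x - coef g x. Proof. by []. Qed.
Lemma coefA0 x : coef 0 x = 0. Proof. by []. Qed.

Lemma coefA_sum (I : Type) (r : seq I) (P : pred I) (f : I -> A) x :
  coef (\sum_(i <- r | P i) f i) x = \sum_(i <- r | P i) coef (f i) x.
Proof.
by apply: (big_morph (fun f => coef f x)) => [u v|]; rewrite ?coefAD ?coefA0.
Qed.

Lemma coef_tddt f x : coef (tddt f) x = x.1%:~R * coef f x. Proof. by []. Qed.

Lemma coef_monomial c k j x :
  coef (monomial a1 a2 c k j) x = if x == (k, j) then c else 0.
Proof. by case: x => k' j'; rewrite /coef /= /monomial_coefs -pair_eqE. Qed.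

Lemma conv_delta (c : F) (s : int * int) (u : int * int -> F) z :
  conv (fun x => if x == s then c else 0) u z = c * u (z - s).
Proof.
rewrite /conv -(fsbig_widen [set s] setT) //=; last first.
  by move=> x [_ /= /eqP]; rewrite /preimage /= => /negPf->; rewrite mul0r.
by rewrite fsbig_set1 eqxx.
Qed.

Lemma coef_monomialM c s f z :
  coef (monomial a1 a2 c s.1 s.2 * f) z = c * coef f (z - s).
Proof.
rewrite coefM -conv_delta; congr (conv _ _ _); apply/funext => x.
Qed.

Definition scalar (c : F) : A := monomial a1 a2 c 0 0.

Lemma coef_scalar c x : coef (scalar c) x = if x == 0 then c else 0.
Proof. exact: coef_monomial. Qed.

Lemma coef_scalarM c f x : coef (scalar c * f) x = c * coef f x.
Proof. by rewrite (@coef_monomialM c (0, 0)) subr0. Qed.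

Lemma scalar_zmod : zmod_morphism scalar.
Proof.
move=> c d; apply: coef_inj => x; rewrite coefAB !coef_scalar.
by case: ifP => // _; rewrite subr0.
Qed.
Lemma scalar_monoid : monoid_morphism scalar.
Proof.
split=> // c d; apply: coef_inj => x; rewrite coef_scalarM !coef_scalar.
by case: ifP => // _; rewrite mulr0.
Qed.
HB.instance Definition _ := GRing.isZmodMorphism.Build F A scalar scalar_zmod.
HB.instance Definition _ := GRing.isMonoidMorphism.Build F A scalar scalar_monoid.

Lemma tddtD : {morph @tddt F a1 a2 : f g / f + g}.
Proof. by move=> f g; apply: coef_inj => x; rewrite !coef_tddt !coefAD mulrDr. Qed.

Lemma tddt_scalarM c f : tddt (scalar c * f) = scalar c * tddt f.
Proof.
by apply: coef_inj => x; rewrite coef_tddt !coef_scalarM coef_tddt mulrCA.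
Qed.

Lemma tddtM f g : tddt (f * g) = tddt f * g + f * tddt g.
Proof.
apply: coef_inj => x; rewrite coef_tddt coefAD !coefM /conv.
have fs (u v : A) := conv_terms x (annulus_sum1 u) (annulus_sum1 v).
rewrite (@mulr_fsumT F (int * int)%type).
rewrite -(@fsumD_T F (int * int)%type
  ([set y | coef (tddt f) y * coef g (x - y) <> 0] `|`
   [set y | coef f y * coef (tddt g) (x - y) <> 0])).
- refine (@eq_fsumT F (int * int)%type _ _ _) => y; rewrite !coef_tddt.
  by rewrite rmorphB /=; ring.
- by rewrite finite_setU; split; apply: fs.
- by move=> y; left.
- by move=> y; right.
Qed.

Definition supp_in (P : int * int -> Prop) f := forall x, coef f x <> 0 -> P x.

Lemma supp_inP P f : supp_in P f <-> forall x, ~ P x -> coef f x = 0.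
Proof.
split=> fP x; first by apply: contra_notP => /fP.
by apply: contra_notP => /fP.
Qed.

Lemma supp_in0 P : supp_in P 0. Proof. by move=> x; rewrite coefA0. Qed.

Lemma supp_inD P f g : supp_in P f -> supp_in P g -> supp_in P (f + g).
Proof.
by move=> /supp_inP fP /supp_inP gP; apply/supp_inP => x nP; rewrite coefAD fP// gP// addr0.
Qed.

Lemma supp_inN P f : supp_in P f -> supp_in P (- f).
Proof. by move=> /supp_inP fP; apply/supp_inP => x nP; rewrite coefAN fP// oppr0. Qed.

Lemma supp_in_sum P (I : Type) (r : seq I) (Q : pred I) (f : I -> A) :
  (forall i, Q i -> supp_in P (f i)) -> supp_in P (\sum_(i <- r | Q i) f i).
Proof.
by move=> fP; apply: (big_ind (supp_in P)) fP; [exact: supp_in0|move=> u v; exact: supp_inD].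
Qed.

Lemma supp_inM (P Q R : int * int -> Prop) f g :
  (forall x y, P x -> Q y -> R (x + y)) ->
  supp_in P f -> supp_in Q g -> supp_in R (f * g).
Proof.
move=> PQR fP gQ z; rewrite coefM => /conv_supp[x [y [-> /fP Px /gQ Qy]]].
exact: PQR.
Qed.

Lemma supp_in_tddt P f : supp_in P f -> supp_in P (tddt f).
Proof.
by move=> /supp_inP fP; apply/supp_inP => x nP; rewrite coef_tddt fP// mulr0.
Qed.

Lemma supp_in_impl (P Q : int * int -> Prop) f : (forall x, P x -> Q x) ->
  supp_in P f -> supp_in Q f.
Proof. by move=> PQ fP x /fP/PQ. Qed.

Lemma supp_in_scalar (P : int * int -> Prop) c : P 0 -> supp_in P (scalar c).
Proof. by move=> P0 x; rewrite coef_scalar; case: eqP => // ->. Qed.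

Definition mx_supp_in (P : int * int -> Prop) m n (M : 'M[A]_(m, n)) :=
  forall i j, supp_in P (M i j).

Lemma mx_supp_inM (P Q R : int * int -> Prop) m n l (M : 'M[A]_(m, n)) (M' : 'M[A]_(n, l)) :
  (forall x y, P x -> Q y -> R (x + y)) ->
  mx_supp_in P M -> mx_supp_in Q M' -> mx_supp_in R (M *m M').
Proof.
move=> PQR MP MQ i j; rewrite mxE; apply: supp_in_sum => k _;
  exact: (supp_inM PQR (MP i k) (MQ k j)).
Qed.

Lemma mx_supp_inD P m n (M M' : 'M[A]_(m, n)) :
  mx_supp_in P M -> mx_supp_in P M' -> mx_supp_in P (M + M').
Proof. by move=> MP MP' i j; rewrite mxE; apply: supp_inD. Qed.

Lemma mx_supp_inN P m n (M : 'M[A]_(m, n)) : mx_supp_in P M -> mx_supp_in P (- M).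
Proof. by move=> MP i j; rewrite mxE; apply: supp_inN. Qed.

Lemma mx_supp_in_tddt P m n (M : 'M[A]_(m, n)) :
  mx_supp_in P M -> mx_supp_in P (map_mx (@tddt F a1 a2) M).
Proof. by move=> MP i j; rewrite mxE; apply: supp_in_tddt. Qed.

Lemma mx_supp_in_impl (P Q : int * int -> Prop) m n (M : 'M[A]_(m, n)) :
  (forall x, P x -> Q x) -> mx_supp_in P M -> mx_supp_in Q M.
Proof. by move=> PQ MP i j; apply: supp_in_impl (MP i j). Qed.

Lemma weight_lb f : exists c, supp_in (fun x => c <= weight a1 x /\ c <= weight a2 x) f.
Proof.
have [c1 c1P] := summable_bound (annulus_sum1 f).
have [c2 c2P] := summable_bound (annulus_sum2 f).
exists (Num.min c1 c2) => x fx; rewrite !ge_min.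
by rewrite (c1P _ fx) (c2P _ fx) orbT.
Qed.

(** All entries have Gauss norm at most |q|^c at both radii. *)
Definition mx_ge c := mx_supp_in (fun x => c <= weight a1 x /\ c <= weight a2 x).

Lemma mx_ge_trans c d m n (M : 'M[A]_(m, n)) : d <= c -> mx_ge c M -> mx_ge d M.
Proof.
by move=> dc; apply: mx_supp_in_impl => x [? ?]; split; apply: le_trans dc _.
Qed.

Lemma mx_weight_lb m n (M : 'M[A]_(m, n)) : exists c, mx_ge c M.
Proof.
have /choice[c cP] := fun ij : 'I_m * 'I_n => weight_lb (M ij.1 ij.2).
exists (- \sum_ij `|c ij|) => i j; apply: supp_in_impl (cP (i, j)) => x /= [w1 w2].
have le : - \sum_ij `|c ij| <= c (i, j).
  rewrite lerNl (le_trans (ler_norm _))// normrN (bigD1 (i, j))//= lerDl.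
  by apply: sumr_ge0.
by split; apply: le_trans le _.
Qed.

(* Banach's fixed point theorem for the two Gauss norms. *)
Lemma contraction_fixpoint m n (Psi : 'M[A]_(m, n) -> 'M[A]_(m, n)) (d : rat) : 0 < d ->
  (forall u v c, mx_ge c (u - v) -> mx_ge (c + d) (Psi u - Psi v)) ->
  exists u, Psi u = u.
Proof.
move=> d0 PsiP; pose u i := iter i Psi 0.
have [c0 c0P] := mx_weight_lb (u 1%N - u 0%N).
pose b i : rat := c0 + i%:R * d.
have step i : mx_ge (b i) (u i.+1 - u i).
  elim: i => [|i IH]; first by rewrite /b mul0r addr0.
  by rewrite /b -natr1 mulrDl mul1r addrA; apply: PsiP.
have bm i i' : (i <= i')%N -> b i <= b i' by move=> ii'; rewrite lerD2l ler_pM2r// ler_nat.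
have stab i i' : (i <= i')%N -> mx_ge (b i) (u i' - u i).
  move=> /subnK <-; elim: (i' - i)%N => [|k IH].
    by rewrite add0n subrr => r s; rewrite mxE; apply: supp_in0.
  rewrite addSn -[u _](subrK (u (k + i)%N)) -addrA; apply: mx_supp_inD => //.
  by apply: mx_ge_trans (step _); apply: bm; apply: leq_addl.
have big (y : rat) : exists i, y < b i.
  exists (Num.bound (`|y - c0| / d)); rewrite /b -ltrBlDl -ltr_pdivrMr//.
  apply: le_lt_trans (archi_boundP _); last by rewrite divr_ge0// ltW.
  by rewrite ler_pM2r ?invr_gt0// ler_norm.
have /choice[N NP] : forall x : int * int, exists i, weight a1 x < b i by move=> x; apply: big.
(* The coefficient at x is the same in all iterates u i for which b i exceeds one of the two weights
   of x; the limit reads it off there. *)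
pose v r s x := coef (u (N x) r s) x.
have vE i r s x : weight a1 x < b i \/ weight a2 x < b i -> v r s x = coef (u i r s) x.
  move=> H; have E1 := stab _ _ (leq_maxl (N x) i) r s x.
  have E2 := stab _ _ (leq_maxr (N x) i) r s x.
  have F1 : coef (u (maxn (N x) i) r s) x = coef (u (N x) r s) x.
    apply/eqP; rewrite -subr_eq0 -coefAB; apply/eqP; apply: contrapT.
    move: E1; rewrite !mxE => E1 /E1[+ _]; by rewrite leNgt NP.
  have F2 : coef (u (maxn (N x) i) r s) x = coef (u i r s) x.
    apply/eqP; rewrite -subr_eq0 -coefAB; apply/eqP; apply: contrapT.
    move: E2; rewrite !mxE => E2 /E2[w1 w2].
    by case: H; rewrite ltNge ?w1 ?w2.
  by rewrite /v -F1 F2.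
have vP r s : on_annulus a1 a2 (fun k j => v r s (k, j)).
  apply/on_annulusP; split => M; have [i iM] := big M.
    apply: sub_finite_set (annulus_sum1 (u i r s) M) => -[k j] /= [wM vx]; split=> //.
    by move: vx; rewrite (vE i)//; left; apply: lt_trans iM.
  apply: sub_finite_set (annulus_sum2 (u i r s) M) => -[k j] /= [wM vx]; split=> //.
  by move: vx; rewrite (vE i)//; right; apply: lt_trans iM.
pose V : 'M[A]_(m, n) := \matrix_(r, s) mk_annulus (vP r s).
have VE r s x : coef (V r s) x = v r s x by rewrite mxE; case: x.
exists V; apply/matrixP => r s; apply: coef_inj => x; have [i ix] := big (weight a1 x).
have ge : mx_ge (b i) (V - u i).
  move=> r' s' x'; rewrite !mxE coefAB => nz; apply: contrapT => /not_andP H.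
  apply: nz; rewrite -[coef (mk_annulus _) x']/(v r' s' (x'.1, x'.2)) -surjective_pairing.
  rewrite (vE i) ?subrr//; by case: H => /negP; rewrite -ltNge; [left|right].
have H := PsiP _ _ _ ge r s x; rewrite mxE [X in coef (_ + X)]mxE in H.
rewrite VE (vE i.+1); last by left; apply: lt_le_trans ix (bm _ _ _).
apply/eqP; rewrite -subr_eq0; apply/eqP; apply: contrapT => nz.
have [w _] := H nz; move: w; rewrite leNgt => /negP; apply.
by apply: lt_le_trans ix _; rewrite lerDl ltW.
Qed.

End AnnulusCoefficients.

Lemma seq_argmin (T : eqType) (le : T -> T -> Prop) (s : seq T) :
  (forall x y z, le x y -> le y z -> le x z) -> (forall x y, le x y \/ le y x) ->
  s != [::] -> exists2 x, x \in s & forall y, y \in s -> le x y.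
Proof.
move=> le_trans le_total; have le_refl x : le x x by case: (le_total x x).
elim: s => // a [|b s] IH _.
  by exists a; rewrite ?mem_head// => y; rewrite inE => /eqP->.
have [//|x xs xmin] := IH; have [ax|xa] := le_total a x.
  exists a; first exact: mem_head.
  by move=> y; rewrite inE => /orP[/eqP->|/xmin]//; apply: le_trans.
exists x; first by rewrite inE xs orbT.
by move=> y; rewrite inE => /orP[/eqP->|/xmin].
Qed.

(** * Total orders on the exponents *)

Section MonomialOrder.
Variables (al : rat) (eps : rat).

(* An exponent that is >= 0 for eps = 1 and for eps = -1 is 0 or has positive weight. *)
Definition mle (x y : int * int) : Prop :=
  weight al x < weight al y \/ weight al x = weight al y /\ eps * x.1%:~R <= eps * y.1%:~R.

Lemma mle_refl x : mle x x. Proof. by right. Qed.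

Lemma mle_trans x y z : mle x y -> mle y z -> mle x z.
Proof.
rewrite /mle; move: (weight al x) (weight al y) (weight al z) => u v w.
by move: (eps * _) (eps * _) (eps * _) => u' v' w' [?|[? ?]] [?|[? ?]];
  [left|left|left|right]; lra.
Qed.

Lemma mle_total x y : mle x y \/ mle y x.
Proof.
rewrite /mle; move: (weight al x) (weight al y) => u v.
move: (eps * _) (eps * _) => u' v'.
have [?|?|->] := ltgtP u v; [by left; left|by right; left|].
by have [?|/ltW ?] := leP v' u'; [left; right|right; right].
Qed.

Lemma mle_add x y z t : mle x y -> mle z t -> mle (x + z) (y + t).
Proof.
rewrite /mle !weightD /= !rmorphD /= !mulrDr.
move: (weight al x) (weight al y) (weight al z) (weight al t) => u v w s.
move: (eps * _) (eps * _) (eps * _) (eps * _) => u' v' w' s' [?|[? ?]] [?|[? ?]];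
  [left|left|left|right]; lra.
Qed.

Hypothesis eps0 : eps != 0.

Lemma mle_anti x y : mle x y -> mle y x -> x = y.
Proof.
move=> xy yx; have [E1 E2] : weight al x = weight al y /\ eps * x.1%:~R = eps * y.1%:~R.
  move: xy yx; rewrite /mle; move: (weight al x) (weight al y) => u v.
  by move: (eps * _) (eps * _) => u' v' [?|[? ?]] [?|[? ?]]; split; lra.
have E3 : x.1 = y.1 by apply: (@intr_inj rat); apply: (mulfI eps0).
apply/eqP; rewrite [X in X == _]surjective_pairing [X in _ == X]surjective_pairing -pair_eqE
  /pair_eq /=.
rewrite E3 eqxx /= -(eqr_int rat); apply/eqP.
by move: E1; rewrite /weight E3 => /addIr.
Qed.

Lemma mle_add_eq x y z t : mle x y -> mle z t -> x + z = y + t -> x = y /\ z = t.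
Proof.
move=> xy zt E; have yx : mle y x.
  have := mle_add (mle_refl (- z - x)) zt.
  have -> : - z - x + z = - x by rewrite addrAC addNr add0r.
  move=> /(mle_add (mle_refl (x + y))).
  have -> : x + y - x = y by rewrite addrAC subrr add0r.
  have -> : x + y + (- z - x + t) = x; last by [].
  have -> : x + y + (- z - x + t) = (y + t) - z by ring.
  by rewrite -E addrK.
have E2 := mle_anti xy yx; split=> //; move: E; rewrite E2; exact: addrI.
Qed.

Lemma mle_opp x y : mle x y -> mle (- y) (- x).
Proof.
move=> /(mle_add (mle_refl (- x - y))).
by rewrite addrAC addNr add0r -addrA addNr addr0.
Qed.

Lemma mle_muln n x y : mle x y -> mle (x *+ n) (y *+ n).
Proof.
move=> xy; elim: n => [|n IH]; first exact: mle_refl.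
by rewrite !mulrS; apply: mle_add.
Qed.

Lemma mle_mulz (r : int * int) (i i' : int) : mle 0 r -> i <= i' -> mle (r *~ i) (r *~ i').
Proof.
move=> r0 ii'; have -> : i' = i + (i' - i) by rewrite addrC subrK.
rewrite mulrzDr; have /mle_add : mle 0 (r *~ (i' - i)); last first.
  by move=> /(_ _ _ (mle_refl (r *~ i))); rewrite add0r addrC.
have : 0 <= i' - i by rewrite subr_ge0.
case: (i' - i) => // n _; rewrite -pmulrn; have := mle_muln n r0.
by rewrite mul0rn.
Qed.

Lemma summable_argmin (F : fieldType) (u : int * int -> F) x0 : summable al u -> u x0 <> 0 ->
  exists2 x, u x <> 0 & forall y, u y <> 0 -> mle x y.
Proof.
move=> su ux0; have /finite_seqP[s Es] := su (weight al x0 + 1).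
have sE y : weight al y < weight al x0 + 1 -> u y <> 0 -> y \in s.
  move=> wy uy; have : [set` s] y by rewrite -Es.
  by [].
have x0s : x0 \in s by apply: sE => //; rewrite ltrDl.
have [|x xs xmin] := seq_argmin mle_trans mle_total (s := s).
  by apply: contraTneq x0s => ->.
have [_ ux] : [set y | weight al y < weight al x0 + 1 /\ u y <> 0] x by rewrite Es.
exists x => // y uy; have [/sE/(_ uy)/xmin//|le] := ltP (weight al y) (weight al x0 + 1).
apply: mle_trans (xmin _ x0s) _; left; apply: lt_le_trans le; by rewrite ltrDl.
Qed.

End MonomialOrder.

(** * Newton slopes of companion connections *)

Lemma mulrn_pair_inj n : (0 < n)%N -> injective (fun x : int * int => x *+ n).
Proof.
move=> n0 u v /eqP; rewrite -subr_eq0 -mulrnBl => /eqP E; apply/eqP; rewrite -subr_eq0.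
move: (u - v) E => [u1 u2] E; move: (congr1 fst E) (congr1 snd E).
rewrite !raddfMn /= => /eqP; rewrite mulrn_eq0 (gtn_eqF n0) /= => /eqP->.
by move=> /eqP; rewrite mulrn_eq0 (gtn_eqF n0) /= => /eqP->.
Qed.

Section LeadingCoefficient.
Variables (F : fieldType) (a1 a2 al eps : rat) (L : nat).
Hypotheses (eps0 : eps != 0) (L0 : (0 < L)%N).
Local Notation A := (annulus F a1 a2).
Local Notation le := (mle al eps).

(** Slopes are fractional, so exponents are scaled by L: this is the coefficient at z / L, and 0 if
    z / L is not an exponent. *)
Definition coef_div (f : A) (z : int * int) : F :=
  if pselect (exists x, x *+ L = z) is left e then coef f (projT1 (cid e)) else 0.

Lemma coef_divE f z x : x *+ L = z -> coef_div f z = coef f x.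
Proof.
move=> Exz; rewrite /coef_div; case: pselect => [e|[]]; last by exists x.
by case: (cid e) => y /= Eyz; congr coef; apply: (mulrn_pair_inj L0); rewrite Eyz.
Qed.

Lemma coef_div_out f z : ~ (exists x, x *+ L = z) -> coef_div f z = 0.
Proof. by rewrite /coef_div; case: pselect. Qed.

Lemma coef_divD f g z : coef_div (f + g) z = coef_div f z + coef_div g z.
Proof. by rewrite /coef_div; case: pselect => [e|_]; rewrite ?addr0. Qed.

Definition supp_ge (z : int * int) := supp_in (fun x => le z (x *+ L)) : A -> Prop.

Lemma coef_div_lt f y z : supp_ge y f -> le z y -> z <> y -> coef_div f z = 0.
Proof.
move=> fy zy nzy; have [[x Ex]|nx] := pselect (exists x, x *+ L = z); last exact: coef_div_out.
rewrite (coef_divE _ Ex); apply: contrapT => /fy; rewrite Ex => yz.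
by apply: nzy; apply: mle_anti zy yz.
Qed.

Lemma supp_ge_le f y z : le z y -> supp_ge y f -> supp_ge z f.
Proof. by move=> zy; apply: supp_in_impl => x; apply: mle_trans. Qed.

Lemma supp_geM f g y z : supp_ge y f -> supp_ge z g -> supp_ge (y + z) (f * g).
Proof. by apply: supp_inM => u v yu zv; rewrite mulrnDl; apply: mle_add. Qed.

(** Leading coefficients multiply because the order is total and additive: a single pair of
    exponents contributes to y + z. With weights alone several pairs could tie. *)
Lemma coef_divM f g y z : supp_ge y f -> supp_ge z g ->
  coef_div (f * g) (y + z) = coef_div f y * coef_div g z.
Proof.
move=> fy gz; have [[w Ew]|nw] := pselect (exists w, w *+ L = y + z); last first.
  rewrite coef_div_out//; have [[u Eu]|nu] := pselect (exists u, u *+ L = y); last first.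
    by rewrite (coef_div_out _ nu) mul0r.
  have [[v Ev]|nv] := pselect (exists v, v *+ L = z); last by rewrite (coef_div_out _ nv) mulr0.
  by case: nw; exists (u + v); rewrite mulrnDl Eu Ev.
rewrite (coef_divE _ Ew) coefM /conv.
have term u : coef f u * coef g (w - u) <> 0 -> u *+ L = y /\ (w - u) *+ L = z.
  move=> nz; have [fu gu] : coef f u <> 0 /\ coef g (w - u) <> 0.
    by split=> E; apply: nz; rewrite E ?mul0r ?mulr0.
  have [|-> ->//] := mle_add_eq eps0 (fy _ fu) (gz _ gu).
  by rewrite -mulrnDl addrC subrK Ew.
have [[u Eu]|nu] := pselect (exists u, u *+ L = y); last first.
  rewrite (coef_div_out _ nu) mul0r fsbig1// => u _; apply: contrapT => /term[Eu _].
  by apply: nu; exists u.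
have Ev : (w - u) *+ L = z by rewrite mulrnBl Ew Eu addrAC subrr add0r.
rewrite (coef_divE _ Eu) (coef_divE _ Ev) -(fsbig_widen [set u] setT) ?fsbig_set1//=.
move=> u' [_ /= nuu']; apply: contrapT => /term[Eu' _]; apply: nuu'.
by apply: (mulrn_pair_inj L0); rewrite Eu Eu'.
Qed.

End LeadingCoefficient.

Section CompanionSlopes.
Variables (k : fieldType) (a1 a2 al eps : rat) (n p : nat).
Local Notation A := (annulus k a1 a2).
Hypotheses (eps0 : eps != 0) (al_summable : forall f : A, summable al (coef f)).
Variable N : 'M[A]_n.+1.
Hypothesis companion : forall i j : 'I_n.+1, (j < n)%N -> N i j = (i == j.+1 :> nat)%:R.
Hypotheses (p2 : (1 < p)%N)
  (fixp : forall v, iter p (connection_of (@tddt k a1 a2) N) v = connection_of (@tddt k a1 a2) N v).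
Local Notation le := (mle al eps).
Local Notation b i := (N i ord_max).

Let nabla := connection_of (@tddt k a1 a2) N.
Let c m (i : 'I_n.+1) : A := iter m nabla (delta_mx 0 0) i 0.

Lemma companion_rec m (i : 'I_n.+1) : c m.+1 i =
  tddt (c m i) + ((if (0 < i)%N then c m (inord i.-1) else 0) + b i * c m ord_max).
Proof.
rewrite /c iterS /nabla /connection_of; move: (iter m _ _) => v.
rewrite !mxE; congr (_ + _); rewrite big_ord_recr /=; congr (_ + _ * v _ _).
  under eq_bigr => j _ do rewrite companion ?ltn_ord//=.
  case: i => -[|i] lti /=.
    by rewrite big1// => j _; rewrite mul0r.
  rewrite (bigD1 (Ordinal (lti : (i < n)%N)))//= eqxx mul1r big1 ?addr0.
    by congr (v _ _); apply: val_inj; rewrite /= inordK// ltnW.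
  by move=> j /eqP nj; rewrite eqSS eq_sym; case: eqP => [E|_]; rewrite ?mul0r//; case: nj;
    apply: val_inj.
Qed.

(* Let rho be the steepest slope, in units of 1 / L. The leading coefficients of nabla^m e_0 at
   slope rho are those of X^m modulo chi = X^(n+1) - sum_i beta_i X^i, where beta_i is the one of
   b i. As nabla^p e_0 = nabla e_0 is not that steep, chi divides X^p, whence beta = 0. *)
Lemma companion_supp i x : coef (b i) x <> 0 -> le 0 x.
Proof.
move=> bx; apply: contrapT => nle; pose L := (n.+1)`!.
have L0 : (0 < L)%N by apply: fact_gt0.
(* The slope of a monomial x of [b i] is x / (n.+1 - i); scaled by L it becomes x times [q i]. *)
pose q (i : 'I_n.+1) := (L %/ (n.+1 - i))%N.
have qE (i' : 'I_n.+1) : (q i' * (n.+1 - i') = L)%N.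
  by rewrite divnK// dvdn_fact// subn_gt0 ltn_ord leq_subr.
have q0 (i' : 'I_n.+1) : (0 < q i')%N by have := qE i'; case: (q i') => //; rewrite mul0n => E;
  rewrite -E ltnn in L0.
have [[i1 x1] /= b1 min1] : exists2 ix : 'I_n.+1 * (int * int), coef (b ix.1) ix.2 <> 0 &
    forall i' y, coef (b i') y <> 0 -> le (ix.2 *+ q ix.1) (y *+ q i').
  have /choice[xm xmP] : forall i', exists x, (exists y, coef (b i') y <> 0) ->
      coef (b i') x <> 0 /\ forall y, coef (b i') y <> 0 -> le x y.
    move=> i'; have [[y by0]|ny] := pselect (exists y, coef (b i') y <> 0); last by exists 0.
    by have [x' ? ?] := summable_argmin eps (al_summable (b i')) by0; exists x'.
  pose le' (i' i'' : 'I_n.+1) := le (xm i' *+ q i') (xm i'' *+ q i'').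
  have [|||i1 i1s i1min] := @seq_argmin _ le' [seq i' <- enum 'I_n.+1 | `[< exists y,
    coef (b i') y <> 0 >]].
  - by move=> ? ? ?; apply: mle_trans.
  - by move=> ? ?; apply: mle_total.
  - rewrite -size_eq0 -lt0n size_filter -has_count; apply/hasP; exists i.
      by rewrite mem_enum.
    by apply/asboolP; exists x.
  move: i1s; rewrite mem_filter => /andP[/asboolP/xmP[b1 _] _].
  exists (i1, xm i1) => //= i' y by0.
  have [_ min'] := xmP i' (ex_intro _ y by0).
  apply: mle_trans (mle_muln _ (min' _ by0)); apply: i1min.
  by rewrite mem_filter mem_enum andbT; apply/asboolP; exists y.
(* Minus the least slope, positive because x is negative. *)
pose rho := - (x1 *+ q i1).
have lt0x : le (x *+ q i) 0.
  have [//|] := mle_total al eps x 0; last by move/nle.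
  by move=> /(mle_muln (q i)); rewrite mul0rn.
have rho0 : le 0 rho.
  by rewrite -oppr0; apply: mle_opp; apply: mle_trans (min1 _ _ bx) lt0x.
have rhon0 : rho <> 0.
  move=> E; have E1 : x1 *+ q i1 = 0 by rewrite -[LHS]opprK -/rho E oppr0.
  have := min1 _ _ bx; rewrite E1 => /(mle_anti eps0 lt0x) => E2.
  apply: nle; have -> : x = 0; last exact: mle_refl.
  by apply: (mulrn_pair_inj (q0 i)); rewrite E2 mul0rn.
have xqL (i' : 'I_n.+1) (y : int * int) : y *+ L = y *+ q i' *+ (n.+1 - i').
  by rewrite -mulrnA qE.
have bsupp (i' : 'I_n.+1) : supp_ge al eps L (- (rho *+ (n.+1 - i'))) (b i').
  move=> y by0; rewrite (xqL i') /rho mulNrn opprK; apply: mle_muln; exact: min1.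
(* The support bound of the product of [b i] with the last entry of [c m] is exactly the one wanted
   for entry i of [c m.+1]. *)
have sig (i' : 'I_n.+1) m : - (rho *+ (n.+1 - i')) + rho *~ (n%:Z - m%:Z) =
  rho *~ (i'%:Z - m.+1%:Z).
  rewrite pmulrn -mulrNz -mulrzDr; congr (_ *~ _); have := ltn_ord i'; lia.
have strict (u v : int) : u < v -> le (rho *~ u) (rho *~ v) /\ rho *~ u <> rho *~ v.
  move=> uv; split; first by apply: mle_mulz => //; apply: ltW.
  move=> E; have : rho *~ (v - u) = 0 by rewrite mulrzBr E subrr.
  have : 0 < v - u by rewrite subr_gt0.
  case: (v - u) => // d d0; rewrite -pmulrn => Ed; apply: rhon0.
  by apply: (mulrn_pair_inj (d0 : (0 < d)%N)); rewrite Ed mul0rn.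
have csupp m (i' : 'I_n.+1) : supp_ge al eps L (rho *~ (i'%:Z - m%:Z)) (c m i').
  elim: m i' => [|m IH] i'.
    move=> y; rewrite /c /= mxE andbT; case: eqP => [->|_]; last by case.
    move=> y0; suff -> : y = 0 by rewrite subrr mulr0z mul0rn; apply: mle_refl.
    by move: y0; rewrite (coef_scalar a1 a2 1); case: eqP.
  rewrite companion_rec; apply: supp_inD; last apply: supp_inD.
  - apply: supp_in_tddt; apply: supp_ge_le (IH i').
    by have [] := strict (i'%:Z - m.+1%:Z) (i'%:Z - m%:Z) ltac:(lia).
  - case: ifP => [i'0|_]; last exact: supp_in0.
    have := IH (inord i'.-1); rewrite inordK; last by have := ltn_ord i'; lia.
    by have -> : (i'.-1%:Z - m%:Z) = i'%:Z - m.+1%:Z by lia.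
  - by rewrite -sig; apply: supp_geM => //; apply: (IH ord_max).
pose beta (i' : 'I_n.+1) := coef_div L (b i') (- (rho *+ (n.+1 - i'))).
pose gam m (i' : 'I_n.+1) := coef_div L (c m i') (rho *~ (i'%:Z - m%:Z)).
(* The derivative drops out: it is supported above rho (i - m), strictly beyond rho (i - m - 1). *)
have gamS m (i' : 'I_n.+1) : gam m.+1 i' =
    (if (0 < i')%N then gam m (inord i'.-1) else 0) + beta i' * gam m ord_max.
  rewrite /gam companion_rec !coef_divD.
  have [le1 ne1] := strict (i'%:Z - m.+1%:Z) (i'%:Z - m%:Z) ltac:(lia).
  have -> : coef_div L (tddt (c m i')) (rho *~ (i'%:Z - m.+1%:Z)) = 0.
    exact: (coef_div_lt eps0 L0 (supp_in_tddt (csupp m i')) le1 ne1).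
  rewrite add0r; congr (_ + _); last first.
    by rewrite -sig; apply: (coef_divM eps0 L0) => //; apply: (csupp m ord_max).
  case: ifP => i'0; last by rewrite -(subrr (0 : A)) /coef_div; case: pselect => // e;
    rewrite coefAB subrr.
  congr (coef_div _ _ (_ *~ _)); rewrite inordK; last by have := ltn_ord i'; lia.
  by lia.
pose chi : {poly k} := 'X^(n.+1) - \poly_(i' < n.+1) beta (inord i').
pose g m : {poly k} := \poly_(i' < n.+1) gam m (inord i').
have gS m : g m * 'X = g m.+1 + (gam m ord_max)%:P * chi.
  apply/polyP => i'; rewrite coefMX coefD coefCM coefB coefXn !coef_poly.
  case: i' => [|i'] /=; first by rewrite gamS inordK//=; ring.
  rewrite eqSS !ltnS; have [lt|lt|->] := ltngtP i' n.
  - by rewrite gamS inordK//=; ring.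
  - by rewrite subr0 mulr0 addr0.
  - by rewrite subr0 mulr1 add0r; congr (gam m _); apply: val_inj; rewrite /= inordK.
have g0 : g 0%N = 1.
  apply/polyP => i'; rewrite coef_poly coef1; case: ltnP => lt; last by case: i' lt.
  rewrite /gam /c /= mxE andbT inordK// subr0 -val_eqE /= inordK//.
  have [->|ne] := eqVneq i' 0%N.
    by rewrite mulr0z (coef_divE L0 _ (mul0rn _ L)) (coef_scalar a1 a2 1) eqxx.
  by rewrite /coef_div; case: pselect.
have gX m : exists h, 'X^m = g m + h * chi.
  elim: m => [|m [h E]]; first by exists 0; rewrite g0 mul0r addr0.
  exists (h * 'X + (gam m ord_max)%:P); rewrite exprSr E mulrDl gS; ring.
have gp0 : g p = 0.
  apply/polyP => i'; rewrite coef_poly coef0; case: ltnP => // lt; rewrite /gam.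
  have -> : c p (inord i') = c 1%N (inord i') by rewrite /c fixp.
  have [le1 ne1] := strict ((inord i' : 'I_n.+1)%:Z - p%:Z) ((inord i' : 'I_n.+1)%:Z - 1%:Z)
    ltac:(lia).
  exact: (coef_div_lt eps0 L0 (csupp _ _) le1 ne1).
have chim : chi \is monic.
  rewrite monicE /chi lead_coefDl ?lead_coefXn// size_polyN size_polyXn ltnS.
  exact: size_poly.
have [h] := gX p; rewrite gp0 add0r => Xp.
have : chi %| ('X - 0%:P) ^+ p by rewrite polyC0 subr0 Xp dvdp_mull.
case/dvdp_exp_XsubCP => l _; rewrite polyC0 subr0 eqp_monic ?monicXn// => /eqP Echi.
have lE : l = n.+1.
  have : size chi = n.+2.
    rewrite /chi size_polyDl ?size_polyXn// size_polyN ltnS; exact: size_poly.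
  by rewrite Echi size_polyXn => -[].
have : beta i1 = 0.
  have := congr1 (fun h : {poly k} => h`_i1) Echi.
  rewrite lE /chi coefB coef_poly ltn_ord inord_val => /eqP.
  by rewrite -subr_eq0 addrAC subrr sub0r oppr_eq0 => /eqP.
rewrite /beta (coef_divE L0 _ (x := x1)) //.
by rewrite (xqL i1) /rho mulNrn opprK.
Qed.

End CompanionSlopes.

(** * Reduction modulo primes *)

(** One finite list of exponents serves both u, v and their images under any coefficientwise
    reduction, so a coefficient of a product and of its reduction are the same finite sum. *)
Lemma conv_seq (F : fieldType) (al : rat) (u v : int * int -> F) z :
  summable al u -> summable al v -> exists s : seq (int * int),
  forall (F' : fieldType) (u' v' : int * int -> F'),
    (forall x, u x = 0 -> u' x = 0) -> (forall x, v x = 0 -> v' x = 0) ->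
    conv u' v' z = \sum_(x <- s) u' x * v' (z - x).
Proof.
move=> su sv; have Tfin := conv_terms z su sv.
exists (finmap.enum_fset (fset_set [set x | u x * v (z - x) <> 0])) => F' u' v' uu' vv'.
rewrite -fsbig_finite// -[LHS](fsbig_widen [set x | u x * v (z - x) <> 0] setT) //=.
move=> x [_ /= /contrapT /eqP]; rewrite mulf_eq0 => /orP[/eqP/uu'->|/eqP/vv'->].
  by rewrite mul0r.
by rewrite mulr0.
Qed.

Section Reduction.
Variables (S : idomainType) (P : prime_idealr S).
Local Notation K := {fraction S}.
Local Notation k := (residue_field P).
Local Notation h := (reduction P).

Definition integral_at : {pred K} := loc_pred (@FracField.tofrac S) (res P).
HB.instance Definition _ := GRing.isSubringClosed.Build K integral_at
  (loc_subring_closed (res P) (@tofrac_inj S)).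

Local Notation LP := (locring (res P) (@tofrac_inj S)).

Lemma integral_atP x : reflect (exists a b, b \notin (P : {pred S}) /\ x = a%:F / b%:F)
  (x \in integral_at).
Proof.
apply: (iffP (asboolP _)) => -[a [b [b0 Ex]]]; exists a, b; split=> //.
  by rewrite -res_eq0.
by rewrite res_eq0.
Qed.

Lemma integral_lift x : x \in integral_at -> exists y : LP, locval y = x.
Proof. by move=> xP; apply: locP; apply/asboolP. Qed.

Lemma integral_locval (y : LP) : locval y \in integral_at. Proof. exact: locvalP. Qed.

Lemma reduction_locval (y : LP) : h (locval y) = locred y.
Proof.
have [a [b [b0 E]]] := locE y; rewrite (locredE b0 E) E reductionE//.
by rewrite -res_eq0.
Qed.

Lemma reductionD : {in integral_at &, {morph h : x y / x + y}}.
Proof.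
move=> _ _ /integral_lift[x <-] /integral_lift[y <-].
by rewrite -rmorphD !reduction_locval rmorphD.
Qed.

Lemma reductionM : {in integral_at &, {morph h : x y / x * y}}.
Proof.
move=> _ _ /integral_lift[x <-] /integral_lift[y <-].
by rewrite -rmorphM !reduction_locval rmorphM.
Qed.

Lemma reduction_int (a : int) : h a%:~R = a%:~R.
Proof. by rewrite -(rmorph_int (locval : LP -> K)) reduction_locval rmorph_int. Qed.

Lemma reduction1 : h 1 = 1. Proof. exact: (reduction_int 1). Qed.

Lemma integral_reduction_neq0 (a b : S) : a \notin (P : {pred S}) -> b \notin (P : {pred S}) ->
  h (a%:F / b%:F) != 0.
Proof. by move=> aP bP; rewrite reductionE// mulf_neq0 ?invr_eq0 ?res_eq0. Qed.

(** A rational number reduces into the prime field. *)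
Lemma integral_frobenius p (y : K) (l : int) (m : nat) : p \in [pchar k] ->
  y * m%:R = l%:~R -> m%:R != 0 :> k -> y \in integral_at -> h y ^+ p = h y.
Proof.
move=> pk Ey m0 yP; have E : h y = l%:~R / m%:R.
  apply: (canRL (mulfK m0)); rewrite -(reduction_int l) -Ey reductionM//; last first.
    by rewrite rpred_nat.
  by rewrite [m%:R in RHS]pmulrn reduction_int.
have Fint (a : int) : (a%:~R : k) ^+ p = a%:~R.
  rewrite -(pFrobenius_autE pk); case: a => a.
    by rewrite -pmulrn rmorph_nat.
  by rewrite NegzE mulrNz rmorphN -pmulrn rmorph_nat.
by rewrite E expr_div_n Fint [m%:R]pmulrn Fint.
Qed.

Variables (a1 a2 : rat).
Local Notation A := (annulus K a1 a2).
Local Notation Ak := (annulus k a1 a2).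

Definition integral_fun (f : A) := forall x, coef f x \in integral_at.
Definition red (f : A) : Ak := annulus_map (reduction0 P) f.

Lemma coef_red f x : coef (red f) x = h (coef f x). Proof. by []. Qed.

Lemma redD f g : integral_fun f -> integral_fun g -> red (f + g) = red f + red g.
Proof.
move=> fP gP; apply: coef_inj => x; rewrite coefAD !coef_red coefAD.
exact: reductionD.
Qed.

Lemma integral_funD f g : integral_fun f -> integral_fun g -> integral_fun (f + g).
Proof. by move=> fP gP x; rewrite coefAD rpredD. Qed.

Lemma integral_funN f : integral_fun f -> integral_fun (- f).
Proof. by move=> fP x; rewrite coefAN rpredN. Qed.

Lemma integral_fun0 : integral_fun 0. Proof. by move=> x; rewrite coefA0 rpred0. Qed.

Lemma red0 : red 0 = 0.
Proof. by apply: coef_inj => x; rewrite coef_red reduction0. Qed.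

Lemma redM f g : integral_fun f -> integral_fun g ->
  red (f * g) = red f * red g /\ integral_fun (f * g).
Proof.
move=> fP gP.
have /choice[f' f'E] : forall x, exists y : LP, locval y = coef f x.
  by move=> x; apply: integral_lift.
have /choice[g' g'E] : forall x, exists y : LP, locval y = coef g x.
  by move=> x; apply: integral_lift.
have E x : exists y : LP, coef (f * g) x = locval y /\ coef (red f * red g) x = locred y.
  have [s sP] := conv_seq x (annulus_sum1 f) (annulus_sum1 g).
  exists (\sum_(y <- s) f' y * g' (x - y)); split.
    rewrite coefM (sP _ (coef f) (coef g))// rmorph_sum; apply: eq_bigr => y _.
    by rewrite rmorphM /= f'E g'E.
  rewrite coefM (sP _ (coef (red f)) (coef (red g))); last first.
  - by move=> y E; rewrite coef_red [coef g y]E reduction0.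
  - by move=> y E; rewrite coef_red [coef f y]E reduction0.
  rewrite rmorph_sum; apply: eq_bigr => y _.
  by rewrite rmorphM !coef_red -f'E -g'E !reduction_locval.
split; last by move=> x; have [y [-> _]] := E x; apply: integral_locval.
apply: coef_inj => x; have [y [E1 E2]] := E x.
by rewrite coef_red E1 E2 reduction_locval.
Qed.

Lemma red_tddt f : integral_fun f -> red (tddt f) = tddt (red f) /\ integral_fun (tddt f).
Proof.
move=> fP; split=> [|x]; last by rewrite coef_tddt rpredM// rpred_int.
apply: coef_inj => x; rewrite coef_red !coef_tddt reductionM ?rpred_int//.
by rewrite reduction_int.
Qed.

Lemma red_scalar c : red (scalar a1 a2 c) = scalar a1 a2 (h c).
Proof.
apply: coef_inj => x; rewrite coef_red !coef_scalar; case: ifP => // _.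
exact: reduction0.
Qed.

Lemma integral_scalar c : c \in integral_at -> integral_fun (scalar a1 a2 c).
Proof. by move=> cP x; rewrite coef_scalar; case: ifP => // _; rewrite rpred0. Qed.

Lemma red_sum (I : Type) (s : seq I) (f : I -> A) : (forall i, integral_fun (f i)) ->
  red (\sum_(i <- s) f i) = \sum_(i <- s) red (f i) /\ integral_fun (\sum_(i <- s) f i).
Proof.
move=> fP; elim: s => [|i s [IH1 IH2]]; first by rewrite !big_nil red0; split=> //;
  exact: integral_fun0.
by rewrite !big_cons redD// IH1; split=> //; apply: integral_funD.
Qed.

Definition integral_mx m n (M : 'M[A]_(m, n)) := forall i j, integral_fun (M i j).

Lemma integral_mxD m n (M M' : 'M[A]_(m, n)) :
  integral_mx M -> integral_mx M' -> integral_mx (M + M').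
Proof. by move=> MP MP' i j; rewrite mxE; apply: integral_funD. Qed.

Lemma integral_mxN m n (M : 'M[A]_(m, n)) : integral_mx M -> integral_mx (- M).
Proof. by move=> MP i j; rewrite mxE; apply: integral_funN. Qed.

Lemma red_mxD m n (M M' : 'M[A]_(m, n)) : integral_mx M -> integral_mx M' ->
  map_mx red (M + M') = map_mx red M + map_mx red M'.
Proof. by move=> MP MP'; apply/matrixP => i j; rewrite !mxE redD. Qed.

Lemma red_mxM m n l (M : 'M[A]_(m, n)) (M' : 'M[A]_(n, l)) : integral_mx M -> integral_mx M' ->
  map_mx red (M *m M') = map_mx red M *m map_mx red M' /\ integral_mx (M *m M').
Proof.
move=> MP MP'; have E i j s := @red_sum 'I_n s (fun r => M i r * M' r j)
  (fun r => (redM (MP i r) (MP' r j)).2).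
split; last by move=> i j; rewrite mxE; apply: (E i j _).2.
apply/matrixP => i j; rewrite !mxE (E i j _).1; apply: eq_bigr => r _.
by rewrite (redM (MP i r) (MP' r j)).1 !mxE.
Qed.

Lemma red_connection n (N : 'M[A]_n) (v : 'cV[A]_n) : integral_mx N -> integral_mx v ->
  map_mx red (connection_of (@tddt K a1 a2) N v) = reduced_connection P N (map_mx red v) /\
  integral_mx (connection_of (@tddt K a1 a2) N v).
Proof.
move=> NP vP; have [E1 I1] := red_mxM NP vP.
have I2 : integral_mx (map_mx (@tddt K a1 a2) v).
  by move=> i j; rewrite mxE; apply: (red_tddt (vP i j)).2.
rewrite /connection_of red_mxD// E1; split; last exact: integral_mxD.
rewrite /reduced_connection /connection_of; congr (_ + _).
by apply/matrixP => i j; rewrite !mxE (red_tddt (vP i j)).1.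
Qed.

End Reduction.

Lemma common_denominator (S : idomainType) (xs : seq {fraction S}) :
  exists2 s : S, s != 0 & forall P : prime_idealr S, s \notin (P : {pred S}) ->
    forall x, x \in xs -> x \in integral_at P.
Proof.
elim: xs => [|x xs [s s0 sP]]; first by exists 1; rewrite ?oner_neq0.
have [a [b [b0 Ex]]] := frac_repr x; exists (b * s); first exact: mulf_neq0.
move=> P; rewrite prime_idealrM negb_or => /andP[bP {}/sP sP] y.
by rewrite inE => /orP[/eqP->|/sP//]; apply/integral_atP; exists a, b.
Qed.

(** * Formal solutions *)

Lemma weight0 (al : rat) : weight al 0 = 0.
Proof. by rewrite /weight /= mulr0 addr0. Qed.

(** Weights are multiples of 1 / [denq al]. This gap is what makes multiplication by a matrix of
    positive weight a contraction. *)
Lemma weight_pos_lb (al : rat) x : 0 < weight al x -> (denq al)%:~R^-1 <= weight al x.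
Proof.
have d0 : 0 < (denq al)%:~R :> rat by rewrite ltr0z denq_gt0.
move=> w0; rewrite -(ler_pM2r d0) mulVf ?gt_eqF//.
have E : weight al x * (denq al)%:~R = (x.2 * denq al + numq al * x.1)%:~R.
  have Eal : al * (denq al)%:~R = (numq al)%:~R.
    by rewrite -[al in al * _]divq_num_den divfK// gt_eqF.
  by rewrite /weight rmorphD !rmorphM /= -Eal; ring.
have : 0 < weight al x * (denq al)%:~R by rewrite mulr_gt0.
by rewrite E ltr0z -[X in X <= _](rmorph1 (intr : int -> rat)) ler_int.
Qed.

Section FormalSolution.
Variables (F : fieldType) (a1 a2 : rat) (n : nat).
Local Notation A := (annulus F a1 a2).
Local Notation scal := (map_mx (scalar a1 a2 : F -> A)).

Definition coefv m l (u : 'M[A]_(m, l)) x : 'M[F]_(m, l) := map_mx (fun f => coef f x) u.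

Lemma coefvD m l (u v : 'M[A]_(m, l)) x : coefv (u + v) x = coefv u x + coefv v x.
Proof. by apply/matrixP => i j; rewrite !mxE. Qed.

Lemma coefvN m l (u : 'M[A]_(m, l)) x : coefv (- u) x = - coefv u x.
Proof. by apply/matrixP => i j; rewrite !mxE. Qed.

Lemma coefv_scalM m l s (C : 'M[F]_(m, l)) (u : 'M[A]_(l, s)) x :
  coefv (scal C *m u) x = C *m coefv u x.
Proof.
apply/matrixP => i j; rewrite !mxE coefA_sum; apply: eq_bigr => t _.
by rewrite !mxE coef_scalarM.
Qed.

Lemma coefvZ m l c (u : 'M[A]_(m, l)) x : coefv (scalar a1 a2 c *: u) x = c *: coefv u x.
Proof. by apply/matrixP => i j; rewrite !mxE coef_scalarM. Qed.

Lemma coefv_tddt m l (u : 'M[A]_(m, l)) x :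
  coefv (map_mx (@tddt F a1 a2) u) x = x.1%:~R *: coefv u x.
Proof. by apply/matrixP => i j; rewrite !mxE coef_tddt. Qed.

Lemma coefv_scal m l (C : 'M[F]_(m, l)) x :
  coefv (scal C) x = if x == 0 then C else 0.
Proof. by apply/matrixP => i j; rewrite !mxE coef_scalar; case: ifP; rewrite ?mxE. Qed.

Lemma coefv_inj m l (u v : 'M[A]_(m, l)) : (forall x, coefv u x = coefv v x) -> u = v.
Proof.
move=> uv; apply/matrixP => i j; apply: coef_inj => x.
by have /matrixP/(_ i j) := uv x; rewrite !mxE.
Qed.

Lemma mx_supp_inE P m l (u : 'M[A]_(m, l)) :
  mx_supp_in P u <-> forall x, ~ P x -> coefv u x = 0.
Proof.
split=> [uP x nP|uP i j]; last first.
  by apply/supp_inP => x /uP/matrixP/(_ i j); rewrite !mxE.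
apply/matrixP => i j; rewrite !mxE; by have /supp_inP := uP i j; apply.
Qed.

Definition pos_weight (x : int * int) := 0 < weight a1 x /\ 0 < weight a2 x.

Definition pos_gap : rat := Num.min (denq a1)%:~R^-1 (denq a2)%:~R^-1.

Lemma pos_gap_gt0 : 0 < pos_gap.
Proof. by rewrite lt_min !invr_gt0 !ltr0z !denq_gt0. Qed.

Lemma pos_weight_gap m l (u : 'M[A]_(m, l)) : mx_supp_in pos_weight u -> mx_ge pos_gap u.
Proof.
apply: mx_supp_in_impl => x [w1 w2].
by split; rewrite ge_min weight_pos_lb ?orbT.
Qed.

Lemma mx_geM c d m l s (u : 'M[A]_(m, l)) (v : 'M[A]_(l, s)) :
  mx_ge c u -> mx_ge d v -> mx_ge (c + d) (u *m v).
Proof.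
by apply: mx_supp_inM => x y [? ?] [? ?]; rewrite !weightD; split; apply: lerD.
Qed.

Lemma mx_ge_scal m l (C : 'M[F]_(m, l)) : mx_ge 0 (scal C).
Proof. by move=> i j; rewrite mxE; apply: supp_in_scalar; rewrite !weight0. Qed.

Lemma rescale_subproof (r : int -> F) (f : A) : on_annulus a1 a2 (fun k j => r k * f k j : F).
Proof.
apply: (@on_annulus_sub _ _ a1 a2 f); last exact/on_annulusP/annulusP.
by move=> k j ->; rewrite mulr0.
Qed.

Definition rescale r f : A := mk_annulus (rescale_subproof r f).

(** Applies [R k] to the coefficient of t^k. There is no loss of norm, as nonzero elements of F have
    absolute value 1, so dividing by k + C - lam meets no small divisors. *)
Definition rescale_mx (R : int -> 'M[F]_n) l (u : 'M[A]_(n, l)) : 'M[A]_(n, l) :=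
  \matrix_(i, j) \sum_t rescale (fun k => R k i t) (u t j).

Lemma coefv_rescale R l (u : 'M[A]_(n, l)) x :
  coefv (rescale_mx R u) x = R x.1 *m coefv u x.
Proof.
by apply/matrixP => i j; rewrite !mxE coefA_sum; apply: eq_bigr => t _; rewrite !mxE.
Qed.

Lemma rescaleB R l (u v : 'M[A]_(n, l)) :
  rescale_mx R (u - v) = rescale_mx R u - rescale_mx R v.
Proof.
apply: coefv_inj => x; rewrite coefvD coefvN !coefv_rescale coefvD coefvN.
by rewrite mulmxBr.
Qed.

Lemma mx_supp_in_rescale P R l (u : 'M[A]_(n, l)) :
  mx_supp_in P u -> mx_supp_in P (rescale_mx R u).
Proof.
by rewrite !mx_supp_inE => uP x /uP ux; rewrite coefv_rescale ux mulmx0.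
Qed.

Variables (C : 'M[F]_n) (Np : 'M[A]_n).
Hypothesis NpP : mx_supp_in pos_weight Np.
Local Notation N := (scal C + Np).
Local Notation nabla := (connection_of (@tddt F a1 a2) N).

Lemma coefv_nabla (u : 'cV[A]_n) x :
  coefv (nabla u) x = (x.1%:~R%:M + C) *m coefv u x + coefv (Np *m u) x.
Proof.
rewrite /connection_of mulmxDl addrA !coefvD coefv_tddt coefv_scalM.
by rewrite mulmxDl mul_scalar_mx.
Qed.

(** The gain of Np makes the right-hand side a contraction. The fixed point has some lower weight
    bound c, and each use of the equation raises it by [pos_gap] until it reaches 0. *)
Lemma formal_solution (R : int -> 'M[F]_n) (v0 : 'cV[F]_n) : exists v : 'cV[A]_n,
  [/\ v = scal v0 - rescale_mx R (Np *m v), mx_ge 0 v & mx_ge pos_gap (Np *m v)].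
Proof.
have gap0 := pos_gap_gt0; have NpG := pos_weight_gap NpP.
have [|v Ev] := @contraction_fixpoint F a1 a2 n 1 (fun v =>
  scal v0 - rescale_mx R (Np *m v)) _ gap0.
  move=> u v c uv.
  have -> : scal v0 - rescale_mx R (Np *m u) - (scal v0 - rescale_mx R (Np *m v)) =
     - rescale_mx R (Np *m (u - v)) by rewrite mulmxBr rescaleB !opprB addrC addrA subrK.
  by apply: mx_supp_inN; apply: mx_supp_in_rescale; rewrite addrC; apply: mx_geM.
have [c cP] := mx_weight_lb v.
have vP i : mx_ge (Num.min 0 (c + i%:R * pos_gap)) v.
  elim: i => [|i IH].
    by apply: mx_ge_trans cP; rewrite mul0r addr0 ge_min lexx orbT.
  set m := Num.min 0 _; have G1 : mx_ge m (scal v0).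
    by apply: mx_ge_trans (@mx_ge_scal _ _ v0); rewrite /m ge_min lexx.
  have G2 : mx_ge m (Np *m v).
    apply: mx_ge_trans (mx_geM NpG IH); rewrite /m -natr1 mulrDl mul1r addrA.
    move: gap0 (_ + _ * _) => g y.
    by rewrite /Num.min; case: ifP; case: ifP; lra.
  by rewrite -Ev; apply: mx_supp_inD => //; apply: mx_supp_inN; apply: mx_supp_in_rescale.
have v0P : mx_ge 0 v.
  have := vP (Num.bound (`|c| / pos_gap)).
  have : `|c| / pos_gap < (Num.bound (`|c| / pos_gap))%:R.
    by apply: archi_boundP; rewrite divr_ge0// ltW.
  rewrite ltr_pdivrMr// => lt; apply: mx_ge_trans; rewrite le_min lexx /=.
  by have := ler_norm (- c); rewrite normrN; move: lt; lra.
by exists v; split=> //; rewrite -[pos_gap]addr0; apply: mx_geM.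
Qed.

(** [R k] inverts k + C - lam up to the error [E k], whose values lie in the kernel; this error is
    all that the fixed point equation leaves. *)
Lemma residual_resonant (R E : int -> 'M[F]_n) (lam : F) (v0 : 'cV[F]_n) (v : 'cV[A]_n) :
  C *m v0 = lam *: v0 ->
  (forall k, (k%:~R%:M + C - lam%:M) *m R k = 1%:M - E k) ->
  (forall k, (k%:~R%:M + C - lam%:M) *m E k = 0) ->
  v = scal v0 - rescale_mx R (Np *m v) ->
  forall x, coefv (nabla v - scalar a1 a2 lam *: v) x = E x.1 *m coefv (Np *m v) x /\
    (x.1%:~R%:M + C - lam%:M) *m coefv (nabla v - scalar a1 a2 lam *: v) x = 0.
Proof.
move=> Cv0 RP EP Ev x; set T := _ - lam%:M.
have Tv0 : T *m coefv (scal v0) x = 0.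
  rewrite coefv_scal /T; case: eqP => [->|_]; last by rewrite mulmx0.
  by rewrite /= mulr0z raddf0 add0r mulmxBl Cv0 mul_scalar_mx subrr.
have E1 : coefv (nabla v - scalar a1 a2 lam *: v) x = E x.1 *m coefv (Np *m v) x.
  rewrite coefvD coefvN coefvZ coefv_nabla addrAC -mul_scalar_mx -mulmxBl -/T.
  rewrite {1}Ev coefvD coefvN coefv_rescale mulmxBr Tv0 sub0r mulmxA /T RP.
  by rewrite mulmxBl mul1mx opprB subrK.
by split=> //; rewrite E1 mulmxA /T EP mul0mx.
Qed.

Definition truncate_at (al w : rat) (f : A) k j : F := if weight al (k, j) <= w then f k j else 0.

Lemma truncate_subproof al w f : on_annulus a1 a2 (truncate_at al w f).
Proof.
apply: (@on_annulus_sub _ _ a1 a2 f); last exact/on_annulusP/annulusP.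
by move=> k j fkj; rewrite /truncate_at fkj if_same.
Qed.

Definition truncate al w f : A := mk_annulus (truncate_subproof al w f).

Lemma coefv_truncate al w m l (u : 'M[A]_(m, l)) x :
  coefv (map_mx (truncate al w) u) x = if weight al x <= w then coefv u x else 0.
Proof.
apply/matrixP => i j; rewrite !mxE /coef /= /truncate_at -surjective_pairing.
by case: ifP; rewrite ?mxE.
Qed.

End FormalSolution.

(** Write q = (X - mu) h, or take h = q if mu is not a root. By separability h and X - mu are
    coprime; in a Bezout relation evaluated at C, R is the cofactor of X - mu and E the term
    divisible by h. *)
Lemma pseudo_inverse (F : fieldType) n (C : 'M[F]_n.+1) (q : {poly F}) (mu : F) :
  separable_poly q -> horner_mx C q = 0 ->
  exists R E, (C - mu%:M) *m R = 1%:M - E /\ (C - mu%:M) *m E = 0.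
Proof.
move=> sep qC; have [h [cop hC]] : exists h, coprimep h ('X - mu%:P) /\
    horner_mx C (('X - mu%:P) * h) = 0.
  have [/factor_theorem[h Eq]|nr] := boolP (root q mu); last first.
    by exists q; rewrite coprimep_XsubC rmorphM /= qC mulr0.
  exists h; rewrite mulrC -Eq; split=> //; rewrite Eq in sep.
  by apply: (separable_coprime sep); rewrite dvdpp.
have /Bezout_eq1_coprimepP[[s t] /= Est] := cop.
have CE : horner_mx C ('X - mu%:P) = C - mu%:M.
  by rewrite rmorphB /= horner_mx_X horner_mx_C.
exists (horner_mx C t), (horner_mx C (s * h)); rewrite -CE; split.
  have := congr1 (horner_mx C) Est; rewrite rmorphD rmorph1 [t * _]mulrC [X in _ + X]rmorphM /=.
  by move=> E; rewrite -[1%:M]/(1 : 'M[F]_n.+1) -E addrAC subrr add0r.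
rewrite -[LHS](rmorphM (horner_mx C)) mulrCA rmorphM /= hC; exact: mulr0.
Qed.

(** * Iterating the connection up to terms of higher weight *)

Section ModuloP.
Variables (k : fieldType) (a1 a2 : rat) (n : nat) (N : 'M[annulus k a1 a2]_n).
Local Notation A := (annulus k a1 a2).
Local Notation nabla := (connection_of (@tddt k a1 a2) N).
Hypothesis N_ge : mx_supp_in (fun x => 0 <= weight a1 x) N.

Definition above w (v : 'cV[A]_n) := mx_supp_in (fun x => w < weight a1 x) v.

Lemma above_nabla w v : above w v -> above w (nabla v).
Proof.
move=> vw; apply: mx_supp_inD; first exact: mx_supp_in_tddt.
by apply: mx_supp_inM N_ge vw => x y; rewrite weightD => ? ?; lra.
Qed.

Lemma nablaD (u v : 'cV[A]_n) : nabla (u + v) = nabla u + nabla v.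
Proof.
rewrite /connection_of mulmxDr addrACA; congr (_ + _).
by apply/matrixP => i j; rewrite !mxE tddtD.
Qed.

Lemma nablaZ c (u : 'cV[A]_n) : nabla (scalar a1 a2 c *: u) = scalar a1 a2 c *: nabla u.
Proof.
rewrite /connection_of scalerDr scalemxAr; congr (_ + _).
by apply/matrixP => i j; rewrite !mxE tddt_scalarM.
Qed.

Lemma aboveD w u v : above w u -> above w v -> above w (u + v).
Proof. exact: mx_supp_inD. Qed.

Lemma aboveZ w c v : above w v -> above w (scalar a1 a2 c *: v).
Proof.
move=> vw i j x; rewrite mxE coef_scalarM => cv; apply: (vw i j x) => E.
by apply: cv; rewrite E mulr0.
Qed.

(** Up to higher weight, u and r span a Jordan block with eigenvalue lam; the coefficient of r
    carries the factor m, which dies for m = p. *)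
Lemma iter_nabla w (u r h1 h2 : 'cV[A]_n) (lam : k) : above w h1 -> above w h2 ->
  nabla u = scalar a1 a2 lam *: u + r + h1 -> nabla r = scalar a1 a2 lam *: r + h2 ->
  forall m, exists2 h, above w h & iter m nabla u = 
    scalar a1 a2 (lam ^+ m) *: u + scalar a1 a2 (m%:R * lam ^+ m.-1) *: r + h.
Proof.
move=> h1w h2w Eu Er; elim=> [|m [h hw IH]].
  exists 0; first by move=> i j; rewrite mxE; apply: supp_in0.
  by rewrite expr0 rmorph1 scale1r mul0r rmorph0 scale0r !addr0.
rewrite iterS IH !nablaD !nablaZ Eu Er.
exists (scalar a1 a2 (lam ^+ m) *: h1 + (scalar a1 a2 (m%:R * lam ^+ m.-1) *: h2 + nabla h)).
  by apply: aboveD; [apply: aboveZ|apply: aboveD; [apply: aboveZ|apply: above_nabla]].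
have -> : m.+1%:R * lam ^+ m = lam ^+ m + m%:R * lam ^+ m.-1 * lam.
  rewrite -natr1 mulrDl mul1r addrC -mulrA -exprSr; congr (_ + _).
  by case: m {IH hw h} => [|m]; rewrite ?mul0r.
rewrite !scalerDr !scalerA -!rmorphM /= rmorphD /= scalerDl exprSr.
set X1 := _ *: u; set X2 := _ *: r; set X3 := _ *: h1; set X4 := _ *: r; set X5 := _ *: h2.
by rewrite -!addrA; congr (_ + (_ + _)); rewrite addrCA.
Qed.

Lemma flat_mod_p w (u r h1 h2 : 'cV[A]_n) (lam : k) p : above w h1 -> above w h2 ->
  nabla u = scalar a1 a2 lam *: u + r + h1 -> nabla r = scalar a1 a2 lam *: r + h2 ->
  p \in [pchar k] -> lam ^+ p = lam -> iter p nabla u = nabla u -> above w r.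
Proof.
move=> h1w h2w Eu Er pk lamp; have [h hw ->] := iter_nabla h1w h2w Eu Er p.
rewrite (pcharf0 pk) mul0r rmorph0 scale0r addr0 lamp Eu -addrA => /addrI E.
have -> : r = h - h1 by rewrite E addrK.
by apply: aboveD => //; apply: mx_supp_inN.
Qed.

End ModuloP.

(** The inverse is the Neumann series of H, obtained as a fixed point. *)
Lemma unit_perturbation (F : fieldType) (a1 a2 : rat) n (H : 'M[annulus F a1 a2]_n) c : 0 < c ->
  mx_ge c H -> 1%:M + H \in unitmx.
Proof.
move=> c0 Hc; have [|X EX] := @contraction_fixpoint F a1 a2 n n (fun X => 1%:M - H *m X) _ c0.
  move=> u v d uv; have -> : 1%:M - H *m u - (1%:M - H *m v) = - (H *m (u - v)).
    by rewrite mulmxBr !opprB addrC addrA subrK.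
  by apply: mx_supp_inN; rewrite addrC; apply: mx_geM.
have E : (1%:M + H) *m X = 1%:M by rewrite mulmxDl mul1mx -{1}EX subrK.
by have [] := mulmx1_unit E.
Qed.

Lemma constant_part (F : fieldType) (a1 a2 : rat) m n (N : 'M[annulus F a1 a2]_(m, n)) :
  mx_supp_in (fun x => x = 0 \/ pos_weight a1 a2 x) N ->
  mx_supp_in (pos_weight a1 a2) (N - map_mx (scalar a1 a2) (coefv N 0)).
Proof.
rewrite !mx_supp_inE => NP x nx; rewrite coefvD coefvN coefv_scal.
case: eqP => [->|x0]; first by rewrite subrr.
by rewrite subr0; apply: NP => -[].
Qed.

Lemma frac_mx_repr (S : idomainType) n (C : 'M[{fraction S}]_n.+1) :
  exists (D : 'M[S]_n.+1) (f : S), f != 0 /\ C = frac_mx D f (@FracField.tofrac S).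
Proof.
have /choice[ab abP] : forall ij : 'I_n.+1 * 'I_n.+1, exists ab : S * S,
    ab.2 != 0 /\ C ij.1 ij.2 = ab.1%:F / ab.2%:F.
  by move=> ij; have [a [b ?]] := frac_repr (C ij.1 ij.2); exists (a, b).
pose f := \prod_ij (ab ij).2.
have f0 : f != 0 by apply/prodf_neq0 => ij _; case: (abP ij).
exists (\matrix_(i, j) ((ab (i, j)).1 * \prod_(ij | ij != (i, j)) (ab ij).2)), f; split=> //.
apply/matrixP => i j; rewrite !mxE rmorphM; have [b0 /= ->] := abP (i, j).
have Ef : f%:F = (ab (i, j)).2%:F * (\prod_(ij | ij != (i, j)) (ab ij).2)%:F.
  by rewrite -rmorphM /f (bigD1 (i, j)).
have : f%:F != 0 by rewrite tofrac_eq0.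
rewrite Ef mulf_eq0 negb_or => /andP[u0 v0].
by rewrite invfM mulrACA (mulVf v0) mulr1 mulrC.
Qed.

(** * Support and constant term of the connection matrix *)

Section StructureTheorem.
Variables (S : idomainType) (S_fg : finitely_generated_ring S).
Hypothesis int_inj : injective (intr : int -> S).
Local Notation K := {fraction S}.
Variables (a1 a2 : rat) (n : nat) (N : 'M[annulus K a1 a2]_n.+1).
Local Notation A := (annulus K a1 a2).
Local Notation nabla := (connection_of (@tddt K a1 a2) N).

(** The second clause is the vanishing of the p-curvature: D^p t = t, so nabla(D^p) = nabla(D). *)
Definition good (P : prime_idealr S) := integral_mx P N /\
  exists2 p, p \in [pchar (residue_field P)] & forall v,
    iter p (reduced_connection P N) v = reduced_connection P N v.

Hypothesis good_below : for_large_primes (fun p => forall Q : prime_idealr S,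
  p%:R \in (Q : {pred S}) -> exists P : prime_idealr S,
    [/\ good P, p%:R \in (P : {pred S}) & {subset (P : {pred S}) <= (Q : {pred S})}]).

Hypothesis companion : forall i j : 'I_n.+1, (j < n)%N -> N i j = (i == j.+1 :> nat)%:R.

Lemma good_frobenius p (P : prime_idealr S) : prime p -> good P -> p%:R \in (P : {pred S}) ->
  p \in [pchar (residue_field P)] /\
  forall v, iter p (reduced_connection P N) v = reduced_connection P N v.
Proof.
move=> pp [_ [q qk qP]] pP.
have pk : p \in [pchar (residue_field P)].
  by rewrite inE pp -(rmorph_nat (res P)) res_eq0.
by have := pcharf_eq pk q; rewrite qk => /esym/eqP E; rewrite -E in qP *.
Qed.

Lemma red_companion P (i j : 'I_n.+1) : (j < n)%N ->
  map_mx (red P (a1 := a1) (a2 := a2)) N i j = (i == j.+1 :> nat)%:R.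
Proof.
move=> jn; rewrite mxE companion//; case: eqP => _; last exact: red0.
rewrite -(rmorph1 (scalar a1 a2 : K -> A)) red_scalar reduction1.
exact: (rmorph1 (scalar a1 a2)).
Qed.

Lemma red_supp p (P : prime_idealr S) : prime p -> good P -> p%:R \in (P : {pred S}) ->
  mx_supp_in (fun x => x = 0 \/ pos_weight a1 a2 x) (map_mx (red P (a1 := a1) (a2 := a2)) N).
Proof.
move=> pp Pg pP; have [pk fixp] := good_frobenius pp Pg pP.
set M := map_mx _ N; have Mc : forall i j : 'I_n.+1, (j < n)%N -> M i j = (i == j.+1 :> nat)%:R.
  by move=> i j jn; apply: red_companion.
have one0 : (1 : rat) != 0 by exact: oner_neq0.
have mone0 : (-1 : rat) != 0 by rewrite oppr_eq0.
have supp1 al : (forall f : annulus (residue_field P) a1 a2, summable al (coef f)) ->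
  forall i x, coef (M i ord_max) x <> 0 -> x = 0 \/ 0 < weight al x.
  move=> sum_al i x nz.
  have le1 := companion_supp one0 sum_al Mc (prime_gt1 pp) fixp nz.
  have le2 := companion_supp mone0 sum_al Mc (prime_gt1 pp) fixp nz.
  move: le1 le2; rewrite /mle weight0 /= !mulr0 => -[?|[E1 k1]] [?|[E2 k2]]; try by right.
  left; have x1 : x.1%:~R = 0 :> rat by lra.
  have x2 : x.2%:~R = 0 :> rat by move: E1; rewrite /weight x1; lra.
  apply/eqP; rewrite [x]surjective_pairing -pair_eqE /pair_eq /=.
  by rewrite -(eqr_int rat) x1 eqxx -(eqr_int rat) x2 eqxx.
move=> i j x; have [jn|jn] := ltnP j n.
  rewrite Mc//; case: eqP => _; last by rewrite coefA0.
  by rewrite (coef_scalar a1 a2 1); case: eqP => // ->; left.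
have -> : j = ord_max by apply: val_inj; apply/eqP; rewrite eqn_leq jn -ltnS ltn_ord.
move=> nz; have [//|w1] := supp1 a1 (@annulus_sum1 _ _ _) i x nz; first by left.
by have [//|w2] := supp1 a2 (@annulus_sum2 _ _ _) i x nz; [left|right].
Qed.

(** A nonzero coefficient survives modulo some good prime, where [red_supp] locates its exponent. *)
Lemma N_supp : mx_supp_in (fun x => x = 0 \/ pos_weight a1 a2 x) N.
Proof.
move=> i j x /eqP nz; have [a [b [b0 Ex]]] := frac_repr (coef (N i j) x).
have a0 : a != 0 by apply: contraNneq nz => a0; rewrite [X in X == _]Ex a0 rmorph0 mul0r.
have [p [P [pp _ Pg pP]]] := good_prime_avoiding S_fg int_inj good_below 0 (mulf_neq0 a0 b0).
rewrite prime_idealrM negb_or => /andP[aP bP].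
apply: (red_supp pp Pg pP (i := i) (j := j)).
by rewrite mxE coef_red Ex; apply/eqP; apply: integral_reduction_neq0.
Qed.

Local Notation C := (coefv N 0).
Local Notation Np := (N - map_mx (scalar a1 a2) C).

Lemma NpP : mx_supp_in (pos_weight a1 a2) Np. Proof. exact: constant_part N_supp. Qed.

(** On vectors of nonnegative weight, nabla acts on the coefficient at exponent 0 through C alone: D
    kills it and Np raises weights. *)
Lemma constant_frobenius p (P : prime_idealr S) : prime p -> good P -> p%:R \in (P : {pred S}) ->
  map_mx (reduction P) C ^+ p = map_mx (reduction P) C.
Proof.
move=> pp Pg pP; have [pk fixp] := good_frobenius pp Pg pP.
set M := map_mx (red P (a1 := a1) (a2 := a2)) N.
have MP := constant_part (red_supp pp Pg pP); rewrite -/M in MP.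
have CE : coefv M 0 = map_mx (reduction P) C by apply/matrixP => i j; rewrite !mxE.
have nablaE v : reduced_connection P N v =
    connection_of (@tddt _ a1 a2) (map_mx (scalar a1 a2) (coefv M 0) +
      (M - map_mx (scalar a1 a2) (coefv M 0))) v.
  by rewrite addrC subrK.
have step v : mx_ge 0 v -> mx_ge 0 (reduced_connection P N v) /\
    coefv (reduced_connection P N v) 0 = coefv M 0 *m coefv v 0.
  move=> v0; have E := mx_geM (pos_weight_gap MP) v0; rewrite addr0 in E.
  have E0 : coefv ((M - map_mx (scalar a1 a2) (coefv M 0)) *m v) 0 = 0.
    have /mx_supp_inE EE := E; apply: EE; rewrite !weight0; case=> + _.
    by rewrite leNgt pos_gap_gt0.
  split; last by rewrite nablaE coefv_nabla E0 /= mulr0z raddf0 add0r addr0.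
  rewrite nablaE /connection_of; apply: mx_supp_inD; first exact: mx_supp_in_tddt.
  rewrite mulmxDl; apply: mx_supp_inD.
    by rewrite -[0]addr0; apply: mx_geM => //; apply: mx_ge_scal.
  by apply: mx_ge_trans E; apply: ltW; apply: pos_gap_gt0.
have iterE v m : mx_ge 0 v -> mx_ge 0 (iter m (reduced_connection P N) v) /\
    coefv (iter m (reduced_connection P N) v) 0 = coefv M 0 ^+ m *m coefv v 0.
  move=> v0; elim: m => [|m [IH1 IH2]]; first by rewrite expr0 mul1mx.
  have [E1 E2] := step _ IH1; split=> //=.
  by rewrite E2 IH2 mulmxA exprS.
apply/matrixP => i j; rewrite -CE.
have v0 := @mx_ge_scal (residue_field P) a1 a2 _ _ (delta_mx j 0 : 'cV_n.+1).
have [_ E] := iterE _ p v0; have [_ E'] := step _ v0.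
move: E; rewrite fixp E' coefv_scal eqxx -!colE => /matrixP/(_ i 0).
by rewrite !mxE.
Qed.

Lemma constant_semisimple : exists (m : nat) (ls : seq int), [/\ (0 < m)%N, uniq ls &
  horner_mx C (\prod_(l <- ls) (m%:R *: 'X - l%:~R%:P)) = 0].
Proof.
have [D [f [f0 CE]]] := frac_mx_repr C.
have frob p (P : prime_idealr S) : prime p -> good P -> p%:R \in (P : {pred S}) ->
    f \notin (P : {pred S}) -> frac_mx D f (res P) ^+ p = frac_mx D f (res P).
  move=> pp Pg pP fP; have E : frac_mx D f (res P) = map_mx (reduction P) C.
    apply/matrixP => i j; rewrite CE !mxE mulrC [_^-1 * _]mulrC reductionE//.
  by rewrite E constant_frobenius.
rewrite CE; exact: (frac_mx_semisimple S_fg int_inj good_below f0 frob).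
Qed.

End StructureTheorem.

(** Finitely many values have a common denominator, so a truncation reduces at every prime avoiding
    it; the full series need not be integral at any prime. *)
Lemma truncate_values (F : fieldType) (a1 a2 w : rat) n (v : 'cV[annulus F a1 a2]_n) :
  exists xs : seq F, forall i x, coef (map_mx (truncate a1 w) v i 0) x \in 0 :: xs.
Proof.
have H (i : 'I_n) : exists xs : seq F, forall x, coef (map_mx (truncate a1 w) v i 0) x \in 0 :: xs.
  have /finite_seqP[s Es] := annulus_sum1 (v i 0) (w + 1).
  exists [seq coef (v i 0) x | x <- s] => x; rewrite mxE /coef /= /truncate_at -surjective_pairing.
  case: ifP => wx; last exact: mem_head.
  have [->|nz] := eqVneq (v i 0 x.1 x.2) 0; first exact: mem_head.
  rewrite inE; apply/orP; right; apply/mapP; exists x => //.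
  have : [set` s] x by rewrite -Es; split; [apply: le_lt_trans wx _; rewrite ltrDl|exact/eqP].
  by [].
have /choice[f fP] := H; exists (flatten [seq f i | i <- enum 'I_n]) => i x.
have := fP i x; rewrite !inE => /orP[->//|fx]; apply/orP; right.
by apply/flatten_mapP; exists i; rewrite ?mem_enum.
Qed.

Section ReduceVectors.
Variables (S : idomainType) (P : prime_idealr S) (a1 a2 : rat) (n : nat).
Local Notation A := (annulus {fraction S} a1 a2).
Local Notation mred := (map_mx (red P (a1 := a1) (a2 := a2))).

Lemma red_mxZ c (u : 'cV[A]_n) : c \in integral_at P -> integral_mx P u ->
  mred (scalar a1 a2 c *: u) = scalar a1 a2 (reduction P c) *: mred u /\
  integral_mx P (scalar a1 a2 c *: u).
Proof.
move=> cP uP; have cu i j := redM (integral_scalar a1 a2 cP) (uP i j).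
split; last by move=> i j; rewrite mxE; apply: (cu i j).2.
by apply/matrixP => i j; rewrite !mxE (cu i j).1 red_scalar.
Qed.

Lemma mx_supp_in_red Q m l (u : 'M[A]_(m, l)) : mx_supp_in Q u -> mx_supp_in Q (mred u).
Proof.
move=> uQ i j x; rewrite mxE coef_red => nz; apply: (uQ i j) => E; apply: nz.
by rewrite E reduction0.
Qed.

End ReduceVectors.

(** * A basis with rational exponents *)

Section EigenSections.
Variables (S : idomainType) (S_fg : finitely_generated_ring S).
Hypothesis int_inj : injective (intr : int -> S).
Local Notation K := {fraction S}.
Variables (a1 a2 : rat) (n : nat) (N : 'M[annulus K a1 a2]_n.+1).
Local Notation A := (annulus K a1 a2).
Local Notation nabla := (connection_of (@tddt K a1 a2) N).
Hypothesis good_below : for_large_primes (fun p => forall Q : prime_idealr S,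
  p%:R \in (Q : {pred S}) -> exists P : prime_idealr S,
    [/\ good N P, p%:R \in (P : {pred S}) & {subset (P : {pred S}) <= (Q : {pred S})}]).
Hypothesis companion : forall i j : 'I_n.+1, (j < n)%N -> N i j = (i == j.+1 :> nat)%:R.
Local Notation C := (coefv N 0).
Local Notation Np := (N - map_mx (scalar a1 a2) C).
Local Notation scal := (map_mx (scalar a1 a2 : K -> A)).

Lemma N_weight_ge0 : mx_supp_in (fun x => 0 <= weight a1 x) N.
Proof.
apply: mx_supp_in_impl (N_supp S_fg int_inj good_below companion) => x [->|[w1 _]].
  by rewrite weight0.
exact: ltW.
Qed.

(* Where r has lowest weight, nabla^p u = lam^p u + p lam^(p-1) r = lam u modulo P up to higher
   weights, whereas nabla u = lam u + r: the lowest part of r vanishes modulo P. *)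
Lemma residual_eq0 (lam : K) (l : int) (m : nat) (v r : 'cV[A]_n.+1) : (0 < m)%N ->
  lam * m%:R = l%:~R -> r = nabla v - scalar a1 a2 lam *: v ->
  (forall x, (x.1%:~R%:M + C - lam%:M) *m coefv r x = 0) -> r = 0.
Proof.
move=> m0 Elam Er rR; apply: contrapT => rn0.
(* The indicator of the support of r, which finds an exponent of least weight for all entries at
   once. *)
pose u x : K := if coefv r x == 0 then 0 else 1.
have uE x : u x <> 0 <-> coefv r x <> 0.
  rewrite /u; case: eqP => [->|nz]; split=> // _; apply/eqP; exact: oner_neq0.
have [x1 ux1] : exists x, u x <> 0.
  apply: contrapT => nex; apply: rn0; apply: coefv_inj => x.
  rewrite [RHS](_ : _ = 0); last by apply/matrixP => i j; rewrite !mxE.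
  by apply: contrapT => nz; apply: nex; exists x; apply/uE.
have su : summable a1 u.
  move=> M; have : finite_set (\bigcup_(i in [set: 'I_n.+1]) [set x | weight a1 x < M /\
    coef (r i 0) x <> 0]).
    by apply: bigcup_finite => // i _; apply: annulus_sum1.
  apply: sub_finite_set => x /= [wx /uE nz]; apply: contrapT => nex; apply: nz.
  apply/matrixP => i j; rewrite !mxE ord1; apply: contrapT => nz; apply: nex.
  by exists i.
(* With [eps] = 0 the order compares weights only; ties are harmless here. *)
have [x0 /uE r0 x0min] := summable_argmin 0 su ux1.
pose w := weight a1 x0.
have rw : mx_supp_in (fun x => w <= weight a1 x) r.
  apply/mx_supp_inE => x nw; apply: contrapT => /uE/x0min; rewrite /mle => H; apply: nw.
  by rewrite /w; case: H => [/ltW//|[-> _]].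
pose u' := map_mx (truncate a1 w) v; pose r' := map_mx (truncate a1 w) r.
(* Errors of weight above w: [h1] comes from cutting off v, [h2] from the action of Np on r, since D
   + C acts on r by lam. *)
pose h1 := nabla u' - scalar a1 a2 lam *: u' - r'.
pose h2 := nabla r' - scalar a1 a2 lam *: r'.
have NpP' := NpP S_fg int_inj good_below companion.
have trE (y : 'cV[A]_n.+1) : above w (map_mx (truncate a1 w) y - y).
  apply/mx_supp_inE => x /negP; rewrite -leNgt => le.
  by rewrite coefvD coefvN coefv_truncate le subrr.
have nablaE y : nabla y = connection_of (@tddt K a1 a2) (scal C + Np) y by rewrite addrC subrK.
have h1w : above w h1.
  have := above_nabla N_weight_ge0 (trE v) => E.
  apply/mx_supp_inE => x nx; have /mx_supp_inE/(_ x nx) := E.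
  have le : weight a1 x <= w by rewrite leNgt; apply/negP.
  have -> : nabla (u' - v) = nabla u' - nabla v.
    by apply: (canRL (addrK _)); rewrite -nablaD subrK.
  rewrite coefvD coefvN => /eqP; rewrite subr_eq0 => /eqP E1.
  have rx : coefv r x = coefv (nabla v) x - lam *: coefv v x.
    by rewrite Er [LHS]coefvD coefvN coefvZ.
  rewrite /h1 [LHS]coefvD [X in X + _]coefvD !coefvN coefvZ E1 !coefv_truncate le rx.
  by rewrite subrr.
have h2w : above w h2.
  apply/mx_supp_inE => x nx; have le : weight a1 x <= w by rewrite leNgt; apply/negP.
  rewrite /h2 coefvD coefvN coefvZ nablaE coefv_nabla.
  have -> : coefv (Np *m r') x = 0.
    have : above w (Np *m r').
      apply: (mx_supp_inM (P := pos_weight a1 a2) (Q := fun x => w <= weight a1 x)) NpP' _.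
        by move=> y z [w1 _] wz; rewrite weightD; lra.
      apply/mx_supp_inE => y ny; rewrite coefv_truncate; case: ifP => // _.
      by have /mx_supp_inE := rw; apply.
    by move/mx_supp_inE; apply.
  by rewrite addr0 coefv_truncate le -mul_scalar_mx -mulmxBl rR.
have [xs1 xs1P] := truncate_values w v; have [xs2 xs2P] := truncate_values w r.
have [s s0 sP] := common_denominator (lam :: 0 :: xs1 ++ xs2).
have [i0 ri0] : exists i, coef (r i 0) x0 != 0.
  apply: contrapT => nex; apply: r0; apply/matrixP => i j; rewrite !mxE ord1.
  by apply: contrapT => /eqP nz; apply: nex; exists i.
have [a [b [b0 Eab]]] := frac_repr (coef (r i0 0) x0).
have a0 : a != 0 by apply: contraNneq ri0 => a0; rewrite [X in X == _]Eab a0 rmorph0 mul0r.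
(* P avoids s, so that lam, u' and r' reduce, and a b, so that the chosen coefficient of r stays
   nonzero; p > m keeps lam in the prime field. *)
have [p [P [pp mp Pg pP]]] :=
  good_prime_avoiding S_fg int_inj good_below m (mulf_neq0 s0 (mulf_neq0 a0 b0)).
rewrite !prime_idealrM !negb_or => /and3P[/sP{}sP aP bP].
have [pk fixp] := good_frobenius pp Pg pP.
have NP : integral_mx P N by case: Pg.
have lamP : lam \in integral_at P by apply: sP; rewrite mem_head.
have u'P : integral_mx P u'.
  move=> i j x; rewrite ord1; apply: sP; have := xs1P i x.
  by rewrite !inE mem_cat => /orP[->|->]; rewrite ?orbT.
have r'P : integral_mx P r'.
  move=> i j x; rewrite ord1; apply: sP; have := xs2P i x.
  by rewrite !inE mem_cat => /orP[->|->]; rewrite ?orbT.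
have [Zu IZu] := red_mxZ lamP u'P; have [Zr IZr] := red_mxZ lamP r'P.
have [Nu INu] := red_connection NP u'P; have [Nr INr] := red_connection NP r'P.
have h1P : integral_mx P h1.
  exact: integral_mxD (integral_mxD INu (integral_mxN IZu)) (integral_mxN r'P).
have h2P : integral_mx P h2 := integral_mxD INr (integral_mxN IZr).
have N0 := mx_supp_in_red (P := P) N_weight_ge0.
have mk0 : m%:R != 0 :> residue_field P.
  by rewrite -(dvdn_pcharf pk); apply/negP => /(dvdn_leq m0); rewrite leqNgt mp.
have : above w (map_mx (red P (a1 := a1) (a2 := a2)) r').
  apply: (flat_mod_p N0 (mx_supp_in_red (P := P) h1w) (mx_supp_in_red (P := P) h2w)
     _ _ pk (integral_frobenius pk Elam mk0 lamP) (fixp (map_mx (red P (a1 := a1) (a2 := a2)) u'))).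
    rewrite -[LHS]Nu -Zu -!red_mxD//; last exact: integral_mxD.
    by congr map_mx; rewrite /h1 addrC -[_ - _ - r']addrA -opprD subrK.
  rewrite -[LHS]Nr -Zr -!red_mxD//.
  by congr map_mx; rewrite /h2 addrC subrK.
move=> /(_ i0 0 x0); rewrite /w ltxx => H; suff : false by []; apply: H.
have -> : coef (map_mx (red P (a1 := a1) (a2 := a2)) r' i0 0) x0 = reduction P (coef (r i0 0) x0).
  by rewrite mxE coef_red mxE /coef /= /truncate_at -surjective_pairing lexx.
rewrite Eab; apply/eqP; exact: integral_reduction_neq0.
Qed.

(** Semisimplicity of C provides partial inverses also at the resonant exponents, and the remainder
    they leave vanishes by [residual_eq0]. *)
Lemma eigen_solution (q : {poly K}) (lam : K) (l : int) (m : nat) (v0 : 'cV[K]_n.+1) :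
  separable_poly q -> horner_mx C q = 0 -> (0 < m)%N -> lam * m%:R = l%:~R ->
  C *m v0 = lam *: v0 -> exists v : 'cV[A]_n.+1,
    nabla v = scalar a1 a2 lam *: v /\ mx_ge (pos_gap a1 a2) (v - scal v0).
Proof.
move=> sep qC m0 Elam Cv0.
have /choice[RE REP] : forall k : int, exists RE : 'M[K]_n.+1 * 'M[K]_n.+1,
    (k%:~R%:M + C - lam%:M) *m RE.1 = 1%:M - RE.2 /\ (k%:~R%:M + C - lam%:M) *m RE.2 = 0.
  move=> k; have [R [E RE]] := pseudo_inverse (lam - k%:~R) sep qC.
  have -> : k%:~R%:M + C - lam%:M = C - (lam - k%:~R)%:M.
    by rewrite raddfB /= opprB addrCA addrA.
  by exists (R, E).
have [v [Ev _ vP]] := formal_solution (NpP S_fg int_inj good_below companion)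
  (fun k => (RE k).1) v0.
exists v; split; last first.
  rewrite {1}Ev addrAC subrr add0r; apply: mx_supp_inN; exact: mx_supp_in_rescale.
apply/eqP; rewrite -subr_eq0; apply/eqP; apply: (residual_eq0 m0 Elam (erefl _)) => x.
have NE : scal C + Np = N by rewrite addrC subrK.
have := residual_resonant Cv0 (fun k => (REP k).1) (fun k => (REP k).2) Ev x.
by rewrite NE => -[].
Qed.

(** The eigenvectors of C are the columns of the inverse of P, and G differs from this matrix by
    positive weight only, hence is invertible. *)
Lemma eigen_basis : exists (m : nat) (ls : 'I_n.+1 -> int) (G : 'M[A]_n.+1),
  [/\ (0 < m)%N, G \in unitmx &
      forall i, nabla (col i G) = scalar a1 a2 ((ls i)%:~R / m%:R) *: col i G].
Proof.
have [m [ls [m0 uls qC]]] := constant_semisimple S_fg int_inj good_below companion.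
have K0 (a b : int) : (a%:~R == b%:~R :> K) = (a == b).
  apply/eqP/eqP => [|->//]; rewrite -!(rmorph_int (@FracField.tofrac S)).
  by move/tofrac_inj/int_inj.
have mK0 : m%:R != 0 :> K by rewrite pmulrn (K0 _ 0) -lt0n.
rewrite prod_scaled_XsubC// linearZ /= in qC.
move/eqP: qC; rewrite scaler_eq0 expf_eq0 (negPf mK0) andbF /= => /eqP.
set q := \prod_(x <- _) _ => qC.
have uq : uniq [seq l%:~R / m%:R : K | l <- ls].
  rewrite map_inj_uniq// => l l' /(mulIf (invr_neq0 mK0))/eqP.
  by rewrite K0 => /eqP.
have sep : separable_poly q by rewrite /q separable_prod_XsubC.
have /diagonalizableP : exists2 rs, uniq rs & mxminpoly C %| \prod_(x <- rs) ('X - x%:P).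
  by exists [seq l%:~R / m%:R : K | l <- ls] => //; apply: mxminpoly_min.
move=> [P Pu /diagonalizable_forPex[D /(simmxP Pu) PCD]].
have CQ i : C *m col i (invmx P) = D 0 i *: col i (invmx P).
  have -> : C = invmx P *m diag_mx D *m P by rewrite -mulmxA -PCD mulKmx.
  rewrite colE !mulmxA mulmxK// -mulmxA -[diag_mx D *m _]colE.
  have -> : col i (diag_mx D) = D 0 i *: delta_mx i 0.
    apply/matrixP => j j'; rewrite !mxE (ord1 j') eqxx andbT mulr_natr.
    by case: eqP => [->|].
  by rewrite -scalemxAr.
have qv (g : {poly K}) i : horner_mx C g *m col i (invmx P) = g.[D 0 i] *: col i (invmx P).
  elim/poly_ind: g => [|g c IH]; first by rewrite rmorph0 mul0mx horner0 scale0r.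
  rewrite rmorphD rmorphM /= horner_mx_X horner_mx_C mulmxDl -[_ * C]/(_ *m C) -mulmxA CQ.
  by rewrite -scalemxAr IH mul_scalar_mx !hornerE scalerDl scalerA mulrC.
have Q0 i : col i (invmx P) != 0.
  apply: contraTneq Pu => E; have : P *m col i (invmx P) = 0 by rewrite E mulmx0.
  rewrite colE mulmxA.
  case: (boolP (P \in unitmx)) => // Pu; rewrite mulmxV// mul1mx => /matrixP/(_ i 0)/eqP.
  by rewrite !mxE !eqxx oner_eq0.
have Dl i : exists l : int, D 0 i = l%:~R / m%:R.
  have := qv q i; rewrite qC mul0mx => /esym/eqP; rewrite scaler_eq0 (negPf (Q0 i)) orbF.
  by rewrite -[_ == 0]/(root q _) /q root_prod_XsubC => /mapP[l _ ->]; exists l.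
have /choice[l lE] := Dl.
have /choice[v vP] : forall i, exists v : 'cV[A]_n.+1,
    nabla v = scalar a1 a2 (D 0 i) *: v /\ mx_ge (pos_gap a1 a2) (v - scal (col i (invmx P))).
  move=> i; apply: (eigen_solution (l := l i) sep qC m0 _ (CQ i)).
  by rewrite lE divfK.
pose G := \matrix_(i, j) v j i 0.
have colG i : col i G = v i by apply/matrixP => j j'; rewrite !mxE ord1.
exists m, l, G; split=> // [|i]; last by rewrite colG (vP i).1 lE.
pose H := G - scal (invmx P).
have HP : mx_ge (pos_gap a1 a2) H.
  move=> i j x; have := (vP j).2 i 0 x; by rewrite !mxE.
have -> : G = scal (invmx P) *m (1%:M + scal P *m H).
  rewrite mulmxDr mulmx1 mulmxA -map_mxM mulVmx// map_mx1 mul1mx addrC.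
  by rewrite subrK.
rewrite unitmx_mul; apply/andP; split.
  have QP : scal (invmx P) *m scal P = 1%:M by rewrite -map_mxM mulVmx// map_mx1.
  exact: (mulmx1_unit QP).1.
apply: (@unit_perturbation _ _ _ _ _ _ (pos_gap_gt0 a1 a2)).
rewrite -[pos_gap _ _]add0r; apply: mx_geM HP; exact: mx_ge_scal.
Qed.

End EigenSections.

(** * Kummer covers *)

Section KummerCover.
Variables (F : fieldType) (a1 a2 : rat) (m : nat).
Hypothesis m0 : m.+1%:R != 0 :> F.
Local Notation A := (annulus F a1 a2).
Local Notation B := (annulus F (a1 / m.+1%:R) (a2 / m.+1%:R)).
Local Notation M := (Posz m.+1).

(** The exponent map of t = s^M. As |s| is the M-th root of |t|, the radii exponents are divided by
    M and weights are preserved. *)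
Definition raise (x : int * int) : int * int := (M * x.1, x.2).

Lemma raiseB x y : raise (x - y) = raise x - raise y.
Proof. by rewrite /raise [in LHS]/= mulrBr. Qed.

Lemma raise0 : raise 0 = 0. Proof. by rewrite /raise mulr0. Qed.

Lemma weight_raise al x : weight (al / m.+1%:R) (raise x) = weight al x.
Proof.
rewrite /weight /raise /= rmorphM /= mulrA -pmulrn divfK//.
by rewrite pnatr_eq0.
Qed.

Definition kummer_coefs (f : int -> int -> F) k j : F :=
  if (M %| k)%Z then f (k %/ M)%Z j else 0.

Lemma kummer_coefs_raise f x : kummer_coefs f (raise x).1 (raise x).2 = f x.1 x.2.
Proof. by rewrite /kummer_coefs /raise /= dvdz_mulr// mulKz. Qed.

Lemma kummer_coefs_supp f x : kummer_coefs f x.1 x.2 <> 0 -> exists y, x = raise y.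
Proof.
rewrite /kummer_coefs; case: ifP => // /dvdzP[k E] _.
by exists (k, x.2); rewrite [x]surjective_pairing /raise /= {1}E mulrC.
Qed.

Lemma kummer_subproof (f : A) : on_annulus (a1 / m.+1%:R) (a2 / m.+1%:R) (kummer_coefs f).
Proof.
have sum al : summable al (coef f) ->
    summable (al / m.+1%:R) (fun x => kummer_coefs f x.1 x.2).
  move=> fs N; apply: sub_finite_set (finite_image raise (fs N)) => x /= [wx nz].
  have [y Ey] := kummer_coefs_supp nz; move: wx nz; rewrite Ey weight_raise kummer_coefs_raise.
  by move=> wy nz; exists y.
by apply/on_annulusP; split; apply: sum; [exact: annulus_sum1|exact: annulus_sum2].
Qed.

Definition kummer (f : A) : B := mk_annulus (kummer_subproof f).

Lemma coef_kummer_raise f x : coef (kummer f) (raise x) = coef f x.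
Proof. exact: kummer_coefs_raise. Qed.

Lemma coef_kummer_supp f x : coef (kummer f) x <> 0 -> exists y, x = raise y.
Proof. exact: kummer_coefs_supp. Qed.

Lemma coef_kummer_nraise f x : (forall y, x <> raise y) -> coef (kummer f) x = 0.
Proof. by move=> nx; apply: contrapT => /coef_kummer_supp[y /nx]. Qed.

Lemma kummer_ext (g h : B) : (forall x, coef g (raise x) = coef h (raise x)) ->
  (forall x, (forall y, x <> raise y) -> coef g x = coef h x) -> g = h.
Proof.
move=> gh1 gh2; apply: coef_inj => x.
by have [[y ->]|nx] := pselect (exists y, x = raise y); [|apply: gh2 => y E; apply: nx; exists y].
Qed.

Lemma kummer_zmod : zmod_morphism kummer.
Proof.
move=> f g; apply: kummer_ext => [x|x nx].
  by rewrite coefAB !coef_kummer_raise coefAB.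
by rewrite coefAB !coef_kummer_nraise// subrr.
Qed.

Lemma raise_inj : injective raise.
Proof.
by move=> [k j] [k' j'] [] /(mulfI (isT : M != 0)) -> ->.
Qed.

Lemma kummer_monoid : monoid_morphism kummer.
Proof.
split.
  apply: kummer_ext => [x|x nx]; rewrite ?coef_kummer_raise ?coef_kummer_nraise//.
    rewrite !(coef_scalar _ _ 1) -{2}raise0.
    by rewrite (inj_eq raise_inj).
  by rewrite (coef_scalar _ _ 1); case: eqP => // x0; case: (nx 0); rewrite raise0.
move=> f g; apply: kummer_ext => [x|x nx].
  rewrite coef_kummer_raise !coefM /conv.
  rewrite -[RHS](fsbig_widen (range raise) setT) //; last first.
    move=> y [_ nr]; change (coef (kummer f) y * coef (kummer g) (raise x - y) = 0).
    by rewrite coef_kummer_nraise ?mul0r// => z E; apply: nr; exists z.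
  rewrite [RHS](@reindex_fsbig _ _ _ _ _ raise setT); last first.
    by split=> // y z _ _ /raise_inj.
  by apply: eq_fsbigr => y _; rewrite -raiseB !coef_kummer_raise.
rewrite coef_kummer_nraise// coefM; apply/esym; apply: contrapT.
move=> /conv_supp[y [z [E /coef_kummer_supp[y' Ey] /coef_kummer_supp[z' Ez]]]].
apply: (nx (y' - (- z'))); rewrite raiseB E Ey Ez; congr (_ + _).
by rewrite /raise /= mulrN -[- (_, _)]/(- _, - _) /= !opprK.
Qed.

HB.instance Definition _ := GRing.isZmodMorphism.Build A B kummer kummer_zmod.
HB.instance Definition _ := GRing.isMonoidMorphism.Build A B kummer kummer_monoid.

(** On the cover, t d/dt is (1 / M) s d/ds. *)
Definition kummer_tddt (f : B) : B := scalar _ _ m.+1%:R^-1 * tddt f.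

Lemma kummer_tddt_derivation : is_derivation kummer_tddt.
Proof.
split=> f g; rewrite /kummer_tddt; first by rewrite tddtD mulrDr.
by rewrite tddtM mulrDr mulrA mulrCA.
Qed.

Lemma kummer_tddtE f : kummer_tddt (kummer f) = kummer (tddt f).
Proof.
apply: kummer_ext => [x|x nx]; rewrite /kummer_tddt coef_scalarM coef_tddt.
  rewrite !coef_kummer_raise coef_tddt /raise /= mulrA rmorphM /= -pmulrn.
  by rewrite mulKf.
by rewrite !coef_kummer_nraise// !mulr0.
Qed.

Definition spow (l : int) : B := monomial _ _ 1 l 0.

Lemma coef_spowM l f x : coef (spow l * f) x = coef f (x - (l, 0)).
Proof. by rewrite (coef_monomialM 1 (l, 0)) mul1r. Qed.

Lemma spowD k l : spow (k + l) = spow k * spow l.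
Proof.
apply: coef_inj => x; rewrite coef_spowM !coef_monomial subr_eq.
by rewrite -[(l, 0) + (k, 0)]/(l + k, 0 : int) addrC.
Qed.

Lemma spow0 : spow 0 = 1. Proof. by []. Qed.

Lemma spow_unit l : spow l \is a GRing.unit.
Proof.
by apply/asboolP; exists (spow (- l)); rewrite -spowD addNr spow0.
Qed.

Lemma spow_nat (i : nat) : spow i = spow 1 ^+ i.
Proof.
by elim: i => [|i IH]; rewrite ?expr0 ?spow0// exprS -IH -spowD -intS.
Qed.

Lemma kummer_spow k : kummer (monomial a1 a2 1 k 0) = spow (M * k).
Proof.
apply: kummer_ext => [x|x nx].
  rewrite coef_kummer_raise !coef_monomial -[(M * k, 0)]/(raise (k, 0)).
  by rewrite (inj_eq raise_inj).
rewrite coef_kummer_nraise// coef_monomial; case: eqP => // E.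
by case: (nx (k, 0)).
Qed.

Lemma kummer_scalar c : kummer (scalar a1 a2 c) = scalar _ _ c.
Proof.
apply: kummer_ext => [x|x nx].
  by rewrite coef_kummer_raise !coef_scalar -{2}raise0 (inj_eq raise_inj).
rewrite coef_kummer_nraise// coef_scalar; case: eqP => // E.
by case: (nx 0); rewrite raise0.
Qed.

Lemma kummer_tddt_spow l : kummer_tddt (spow l) = scalar _ _ (l%:~R / m.+1%:R) * spow l.
Proof.
apply: coef_inj => x; rewrite /kummer_tddt !coef_scalarM coef_tddt coef_monomial.
by case: eqP => [->|_]; rewrite ?mulr0// !mulr1 mulrC.
Qed.

(** Euclidean division of the exponents of s by M. *)
Lemma kummer_basis x : exists! c : 'rV[A]_m.+1, x = \sum_i kummer (c 0 i) * spow i.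
Proof.
pose e (i : 'I_m.+1) (y : int * int) : int * int := raise y + (Posz i, 0).
have e_inj i i' y y' : e i y = e i' y' -> i = i' /\ y = y'.
  move=> E; have Ei : i = i'.
    have := congr1 (fun z => (z.1 %% M)%Z) E; rewrite /e /raise /= ![M * _]mulrC !modzMDl.
    by rewrite !modz_small ?ltz_nat ?ltn_ord// => -[/val_inj].
  by split=> //; move: E; rewrite Ei => /addIr/raise_inj.
have e_ex z : exists i y, z = e i y.
  have r0 : 0 <= (z.1 %% M)%Z by apply: modz_ge0.
  have rM : (`|(z.1 %% M)%Z| < m.+1)%N by rewrite -ltz_nat gez0_abs// ltz_mod.
  exists (Ordinal rM), ((z.1 %/ M)%Z, z.2); rewrite [LHS]surjective_pairing /e /raise /=.
  rewrite -[(_, _) + (_, _)]/(_ + _, _ + _) /= addr0 gez0_abs//; congr (_, _).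
  by rewrite {1}(divz_eq z.1 M) mulrC.
have subP (i : 'I_m.+1) : on_annulus a1 a2 (fun k j => coef x (e i (k, j)) : F).
  have sum al : summable (al / m.+1%:R) (coef x) -> summable al (fun y => coef x (e i (y.1, y.2))).
    move=> xs N; have := xs (N + weight (al / m.+1%:R) (Posz i, 0)).
    move=> /(@finite_preimage _ _ _ (e i)) fin;
      apply: sub_finite_set (fin _) => [[k j] /= [wy nz]|y z _ _ /e_inj[]//].
    by split=> //; rewrite /e weightD weight_raise; lra.
  by apply/on_annulusP; split; apply: sum; [exact: annulus_sum1|exact: annulus_sum2].
pose c : 'rV[A]_m.+1 := \row_i mk_annulus (subP i).
have coefE (d : 'rV[A]_m.+1) i y : coef (\sum_i kummer (d 0 i) * spow i) (e i y) = coef (d 0 i) y.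
  rewrite coefA_sum (bigD1 i)// [kummer _ * _]mulrC coef_spowM /e addrK coef_kummer_raise.
  rewrite big1 => [|i' ne]; first exact: addr0.
  rewrite [kummer _ * _]mulrC coef_spowM coef_kummer_nraise// => y' E.
  have [Ei _] : i = i' /\ y = y' by apply: e_inj; rewrite /e -E subrK.
  by rewrite Ei eqxx in ne.
exists c; split.
  by apply: coef_inj => z; have [i [[k j] ->]] := e_ex z; rewrite coefE mxE.
move=> d Ed; apply/matrixP => i0 i; rewrite (ord1 i0); apply: coef_inj => -[k j].
by rewrite -(coefE d) -Ed mxE.
Qed.

(** From s^M = t follows M s^m ds = 0, and M s^m is a unit. *)
Lemma kummer_unramified : unramified kummer.
Proof.
move=> V d dD dM dk; pose s := spow 1.
have d1 : d 1 = 0 by rewrite -(rmorph1 kummer) dk.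
have dX i : d (s ^+ i) = (i%:R * s ^+ i.-1) *: d s.
  elim: i => [|i IH]; first by rewrite d1 mul0r scale0r.
  rewrite exprS dM IH scalerA -scalerDl mulrCA; congr (_ *: _).
  rewrite -(natr1 i) mulrDl mul1r.
  by congr (_ + _); case: i {IH} => [|i]; rewrite ?mul0r //= exprS.
have ds : d s = 0.
  have := dX m.+1; rewrite -spow_nat -[Posz m.+1]mulr1 -kummer_spow dk.
  have u : m.+1%:R * s ^+ m \is a GRing.unit.
    rewrite unitrM unitrX ?spow_unit// andbT -(rmorph_nat (scalar _ _)).
    by apply: rmorph_unit; rewrite unitfE.
  by move=> /(congr1 ( *:%R (m.+1%:R * s ^+ m)^-1)); rewrite scaler0 scalerA mulVr// scale1r.
have d0 : d 0 = 0 by apply: (addrI (d 0)); rewrite -dD !addr0.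
move=> x; have [c [-> _]] := kummer_basis x.
apply: (big_ind (fun y => d y = 0)) => // [y z dy dz|i _]; first by rewrite dD dy dz addr0.
by rewrite dM dk scaler0 addr0 spow_nat dX -/s ds !scaler0.
Qed.

Lemma kummer_etale : finite_etale_cover kummer.
Proof.
by split; [exists m, (fun i => spow i); apply: kummer_basis|exact: kummer_unramified].
Qed.


End KummerCover.

(** * Change of basis and flat sections *)

Section Connections.
Variables (A : comUnitRingType) (D : A -> A) (n : nat) (nabla : 'cV[A]_n -> 'cV[A]_n).
Hypothesis nablaP : is_connection D nabla.

Lemma connection0 : nabla 0 = 0.
Proof. by apply: (addrI (nabla 0)); rewrite -nablaP.1 !addr0. Qed.

Lemma connection_matrixE (P : 'M[A]_n) (c : 'cV[A]_n) : P \in unitmx ->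
  nabla (P *m c) = P *m connection_of D (connection_matrix nabla P) c.
Proof.
move=> Pu; have PcE (Q : 'M[A]_n) (d : 'cV[A]_n) : Q *m d = \sum_j d j 0 *: col j Q.
  apply/matrixP => i k; rewrite !mxE summxE; apply: eq_bigr => j _.
  by rewrite !mxE ord1 mulrC.
rewrite /connection_of mulmxDr /connection_matrix -mulmxA mulKVmx// !PcE.
rewrite (big_morph nabla nablaP.1 connection0) -big_split; apply: eq_bigr => j _ /=.
rewrite nablaP.2 mxE; congr (_ + _ *: _).
by apply/matrixP => i k; rewrite !mxE ord1.
Qed.

(** nabla sends each vector of the cyclic basis except the last to the next one. *)
Lemma cyclic_companion (v : 'cV[A]_n) (i j j' : 'I_n) : cyclic_vector nabla v ->
  j' = j.+1 :> nat -> connection_matrix nabla (cyclic_family nabla v) i j = (i == j')%:R.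
Proof.
move=> vu jj'; set P := cyclic_family nabla v.
have colP (k : 'I_n) : col k P = iter k nabla v.
  by apply/matrixP => a b; rewrite !mxE ord1.
have E : col j (connection_matrix nabla P) = delta_mx j' 0.
  rewrite /connection_matrix colE -mulmxA -colE.
  have -> : col j (\matrix_(i, j) nabla (col j P) i 0) = col j' P.
    rewrite colP jj' iterS -colP.
    by apply/matrixP => a b; rewrite !mxE ord1.
  by rewrite colE mulmxA mulVmx// mul1mx.
by move/matrixP/(_ i 0): E; rewrite !mxE eqxx andbT.
Qed.

End Connections.

(** The extended derivation multiplies s^(-l) by -l / M, which cancels the exponent l / M of the
    column. *)
Lemma flat_of_exponents (F : fieldType) (a1 a2 : rat) (n m : nat)
    (nabla : 'cV[annulus F a1 a2]_n -> 'cV[annulus F a1 a2]_n) (ls : 'I_n -> int) (G : 'M_n) :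
  is_connection (@tddt F a1 a2) nabla -> m.+1%:R != 0 :> F -> G \in unitmx ->
  (forall i, nabla (col i G) = scalar a1 a2 ((ls i)%:~R / m.+1%:R) *: col i G) ->
  flat_after_finite_pullback (@tddt F a1 a2) nabla.
Proof.
move=> nablaP m0 Gu nablaG.
pose phi : {rmorphism annulus F a1 a2 ->
  annulus F (a1 / m.+1%:R) (a2 / m.+1%:R)} := @kummer F a1 a2 m.
exists (annulus F (a1 / m.+1%:R) (a2 / m.+1%:R)), phi.
exists (@kummer_tddt F a1 a2 m); split.
- exact: kummer_etale.
- exact: kummer_tddt_derivation.
- exact: kummer_tddtE.
pose s (l : int) := spow F a1 a2 m l.
pose T := diag_mx (\row_i s (- ls i)).
exists (map_mx phi G *m T).
  rewrite unitmx_mul; apply/andP; split.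
    rewrite unitmxE det_map_mx; apply: rmorph_unit; by rewrite -unitmxE.
  rewrite unitmxE det_diag; apply: rpred_prod => i _; rewrite mxE; exact: spow_unit.
move=> j; have -> : col j (map_mx phi G *m T) = s (- ls j) *: map_mx phi (col j G).
  apply/matrixP => i k; rewrite !mxE (bigD1 j)//= big1 ?addr0 => [|i' ne]; last first.
    by rewrite !mxE (negPf ne) mulr0n mulr0.
  rewrite !mxE eqxx mulr1n; exact: mulrC.
have [DD DM] := kummer_tddt_derivation F a1 a2 m.
have nE := connection_matrixE nablaP (col j G) (unitmx1 _ _).
rewrite !mul1mx nablaG in nE.
rewrite /pullback_connection /connection_of -scalemxAr -map_mxM.
have -> : map_mx (kummer_tddt (m := m)) (s (- ls j) *: map_mx phi (col j G)) =
    kummer_tddt (s (- ls j)) *: map_mx phi (col j G) +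
      s (- ls j) *: map_mx phi (map_mx (@tddt F a1 a2) (col j G)).
  by apply/matrixP => i k; rewrite !mxE DM kummer_tddtE.
rewrite -addrA -scalerDr -map_mxD -/(connection_of _ _ _) -nE kummer_tddt_spow.
have phiM c g : phi (scalar a1 a2 c * g) = scalar _ _ c * phi g.
  by rewrite -kummer_scalar; apply: (rmorphM phi).
apply/matrixP => i k; rewrite !mxE [X in _ + _ * X]phiM.
set c := scalar _ _ (_%:~R / _); have -> : c = - scalar _ _ ((ls j)%:~R / m.+1%:R).
  by rewrite /c rmorphN mulNr rmorphN.
by rewrite !mulNr mulrCA mulrA addNr.
Qed.

(** * From almost all primes of O to good primes of S *)

Section GoodPrimes.
Variables (S : idomainType) (a1 a2 : rat) (n : nat) (N : 'M[annulus {fraction S} a1 a2]_n.+1).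

Lemma integral_padic (P : prime_idealr S) x : padic_val_ge0 P x -> x \in integral_at P.
Proof.
case=> [->|[m m0 [pi [a [b [_ _ bP ->]]]]]]; first exact: rpred0.
apply/integral_atP; exists (pi ^+ `|m| * a), b; split=> //.
by rewrite -(gez0_abs m0) rmorphM rmorphXn /= mulrA.
Qed.

Lemma iter_tddt_coord_t (F : fieldType) p : iter p (@tddt F a1 a2) (coord_t F a1 a2) =
  coord_t F a1 a2.
Proof.
elim: p => //= p ->; apply: coef_inj => x; rewrite coef_tddt coef_monomial.
by case: eqP => [->|_]; rewrite ?mulr0 ?mul1r.
Qed.

Lemma p_curvature0_iter (F : fieldType) k (nabla : 'cV[annulus F a1 a2]_k ->
  'cV[annulus F a1 a2]_k) p v :
  p_curvature nabla p v = 0 -> iter p nabla v = nabla v.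
Proof.
move=> /eqP; rewrite subr_eq0 => /eqP->; rewrite /connection_along iter_tddt_coord_t.
by rewrite divrr ?scale1r// coord_t_unit.
Qed.

(** For Q above a large p, the intersection of Q with O contains p and is not exceptional; its
    extension to S is generated by elements of Q, hence lies in Q. The two hypotheses provide two
    extensions, which have the same elements. *)
Lemma good_primes_below (O : idomainType) (iO : {rmorphism O -> S}) :
  (forall p, prime p -> p%:R != 0 :> O) ->
  almost_all_primes (fun p : prime_idealr O =>
    exists2 P : prime_idealr S, is_extension iO p P & can_be_reduced P N) ->
  almost_all_primes (fun p : prime_idealr O =>
    exists2 P : prime_idealr S, is_extension iO p P &
      p_curvature_vanishes (reduced_connection P N)) ->
  for_large_primes (fun p => forall Q : prime_idealr S,
    p%:R \in (Q : {pred S}) -> exists P : prime_idealr S,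
      [/\ good N P, p%:R \in (P : {pred S}) & {subset (P : {pred S}) <= (Q : {pred S})}]).
Proof.
move=> O0 /(almost_all_large_primes O0) H1 /(almost_all_large_primes O0) H2.
apply: large_primes_impl (large_primes_and H1 H2) => p pp [{}H1 {}H2] Q pQ.
have [P0 P0E] := comap_prime_ideal iO Q.
have pP0 : p%:R \in (P0 : {pred O}) by rewrite P0E rmorph_nat.
have [P1 e1 int1] := H1 _ pP0; have [P e [q qk curv]] := H2 _ pP0.
have P1E x : (x \in (P1 : {pred S})) = (x \in (P : {pred S})).
  by apply/idP/idP => [/e1/e|/e/e1].
exists P; split.
- split; last by exists q => // v; apply: p_curvature0_iter.
  move=> i j x; have /integral_padic/integral_atP[a [b [bP E]]] := int1 i j x.1 x.2.
  by apply/integral_atP; exists a, b; rewrite -P1E.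
- apply/e; exists 1%N, (fun=> p%:R), (fun=> 1); split=> //.
  by rewrite big_ord1 rmorph_nat mulr1.
- move=> x /e[m [a [s [aP ->]]]]; apply: rpred_sum => k _.
  by rewrite mulrC idealMr// -P0E.
Qed.

End GoodPrimes.

Theorem theorem3p1 (R : realType)
  (S : idomainType) (iota : {rmorphism S -> complex R})
  (iota_inj : injective iota)
  (S_fg : finitely_generated_ring S)
  (O : idomainType) (iO : {rmorphism O -> S})
  (iO_inj : injective iO)
  (O_alg : forall s : S, (exists x, s = iO x) <->
     algebraicOver (ratr : rat -> complex R) (iota s))
  (O_int : localized_ring_of_integers O)
  (a1 a2 : rat) (r1_le_r2 : a2 <= a1) (n : nat)
  (nabla : 'cV[annulus {fraction S} a1 a2]_n -> 'cV[annulus {fraction S} a1 a2]_n)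
  (nablaP : is_connection (@tddt {fraction S} a1 a2) nabla)
  (cyclic : exists v : 'cV[annulus {fraction S} a1 a2]_n,
     let N := connection_matrix nabla (cyclic_family nabla v) in
     [/\ cyclic_vector nabla v,
         almost_all_primes (fun p : prime_idealr O =>
           exists2 P : prime_idealr S, is_extension iO p P &
             can_be_reduced P N) &
         almost_all_primes (fun p : prime_idealr O =>
           exists2 P : prime_idealr S, is_extension iO p P &
             p_curvature_vanishes (reduced_connection P N))]) :
  flat_after_finite_pullback (@tddt {fraction S} a1 a2) nabla.
Proof.
have intS (a : int) : iota a%:~R = a%:~R by rewrite rmorph_int.
have int_inj : injective (intr : int -> S).
  by move=> a b /(congr1 iota); rewrite !intS => /intr_inj.
have nat_neq0 (V : nzRingType) (f : {rmorphism V -> S}) p : (0 < p)%N -> p%:R != 0 :> V.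
  move=> p0; apply/eqP => /(congr1 (iota \o f)) /= /eqP.
  by rewrite !rmorph_nat !rmorph0 pnatr_eq0 -leqn0 leqNgt p0.
have K0 p : (0 < p)%N -> p%:R != 0 :> {fraction S}.
  by move=> p0; rewrite -(rmorph_nat (@FracField.tofrac S)) tofrac_eq0; apply: (nat_neq0 _ idfun).
(* Rank 0 is treated apart because the companion matrices above have size n.+1. *)
case: n nabla nablaP cyclic => [|n'] nab nabP [v [vcyc H1 H2]].
  have flat0 (i : 'I_0) : nab (col i 1%:M) = scalar a1 a2 (0%:~R / 1%:R) *: col i 1%:M by case: i.
  exact: (flat_of_exponents nabP (K0 1%N isT) (unitmx1 _ _) flat0).
have O0 p : prime p -> p%:R != 0 :> O by move=> /prime_gt0; apply: nat_neq0.
have good_below := good_primes_below O0 H1 H2.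
have [|[|m] [ls [G [m0 Gu nablaG]]]] := eigen_basis S_fg int_inj good_below; last 2 first.
- by [].
- have PGu : cyclic_family nab v *m G \in unitmx by rewrite unitmx_mul; apply/andP.
  apply: (flat_of_exponents nabP (K0 m.+1 isT) PGu (ls := ls)) => i.
  have -> : col i (cyclic_family nab v *m G) = cyclic_family nab v *m col i G.
    by rewrite !colE mulmxA.
  rewrite (connection_matrixE nabP _ vcyc) nablaG.
  exact: esym (scalemxAr _ _ _).
move=> i j jn; have jn' : (j.+1 < n'.+1)%N by [].
exact: (cyclic_companion (j' := Ordinal jn') i vcyc).
Qed.
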